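(* Let $S_1\subset\mathbf P^3$ be the quartic surface of the context. Then $S_1$ has exactly two singular points $$P_1=\left(0,\sqrt{b_1},\sqrt{b_2},0\right),\qquad P_2=\left(\sqrt{b_4},0,0,\sqrt{b_3}\right),$$ both of type $D_8$, and $S_1$ contains two tropes $\overline\Theta_1$ and $\overline\Theta_2$, which are the double conics cut out by the hyperplane sections $\sqrt{b_2}\,y+\sqrt{b_1}\,z=0$ and $\sqrt{b_3}\,x+\sqrt{b_4}\,t=0$, respectively. The two tropes $\overline\Theta_1$ and $\overline\Theta_2$ meet at $P_1$ and $P_2$.
   Context: $k$ is an algebraically closed field of characteristic $2$; $(x,y,z,t)$ are homogeneous coordinates on $\mathbf P^3$. The constants $a_1,a_2,a_3,c_i,d_i,b_1,\dots,b_4\in k$ satisfy: $a_1\neq a_2=a_3$; $b_1=\beta_3\gamma_2$, $b_2=\alpha_2\delta_3$, $b_3=\gamma_2\delta_3$, $b_4=\alpha_2\beta_3$ for some $\alpha_i,\beta_i,\gamma_i,\delta_i\in k$ with $\alpha_i\delta_i+\beta_i\gamma_i=1$ (so $b_1b_2=b_3b_4$); and $c_1d_1\neq0$, $b_2b_4c_2+b_1b_4c_3+b_1b_3d_2+b_2b_3d_3\neq0$ (this is the condition that the quadratic line complex $\{\sum X_iY_i=0\}\cap\{\sum(a_iX_iY_i+c_iX_i^2+d_iY_i^2)+b_1X_2Y_3+b_2X_3Y_2+b_3X_2X_3+b_4Y_2Y_3=0\}\subset\mathbf P^5$ be non-singular). $S_1$ is the quartic surface (the set of foci of singular lines of that complex)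 $$b_3^2c_1x^4+b_2^2d_1y^4+b_1^2d_1z^4+b_4^2c_1t^4$$ $$+(b_3^2d_2+b_2^2c_2+(a_1+a_2)^2c_3+(a_1+a_2)b_2b_3)x^2y^2+(b_3^2d_3+b_1^2c_3+(a_1+a_2)^2c_2+(a_1+a_2)b_1b_3)x^2z^2$$ $$+(b_2^2d_3+b_4^2c_3+(a_1+a_2)^2d_2+(a_1+a_2)b_2b_4)y^2t^2+(b_1^2d_2+b_4^2c_2+(a_1+a_2)^2d_3+(a_1+a_2)b_1b_4)z^2t^2$$ $$+(a_1+a_2)^2(b_3x^2yz+b_2xy^2t+b_1xz^2t+b_4yzt^2)=0.$$ A trope of a quartic surface is a conic on it along which some plane cuts the surface with multiplicity two (a double conic). Type $D_8$ means a rational double point whose minimal resolution has exceptional $(-2)$-curves with dual graph $D_8$. *)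

(* Defs.v *)
From mathcomp Require Import all_boot all_order all_algebra.
From mathcomp Require Import mpoly.

Set Implicit Arguments.
Unset Strict Implicit.
Unset Printing Implicit Defensive.

Import GRing.Theory.
Local Open Scope ring_scope.

Section ProjectiveSpace.
Variable k : closedFieldType.

(* A point of P^3(k) is a nonzero row vector, up to [same_point]. *)
Definition point (a b c d : k) : 'rV[k]_4 := \row_(i < 4) [:: a; b; c; d]`_i.

Definition same_point (P Q : 'rV[k]_4) : Prop := exists2 c, c != 0 & Q = c *: P.

Definition ev (F : {mpoly k[4]}) (P : 'rV[k]_4) : k := F.@[P ord0].

Definition Xx : {mpoly k[4]} := 'X_(@Ordinal 4 0 isT).
Definition Xy : {mpoly k[4]} := 'X_(@Ordinal 4 1 isT).
Definition Xz : {mpoly k[4]} := 'X_(@Ordinal 4 2 isT).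
Definition Xt : {mpoly k[4]} := 'X_(@Ordinal 4 3 isT).

Definition singular_point (F : {mpoly k[4]}) (P : 'rV[k]_4) : Prop :=
  [/\ P != 0, ev F P = 0 & forall i : 'I_4, ev (F^`M(i)) P = 0].

(* The locus l = q = 0 is an irreducible conic of the plane l = 0: the form q
   modulo l is not a product of two linear forms.  Taking m1 = 0 shows that
   q modulo l is nonzero. *)
Definition irreducible_conic (l q : {mpoly k[4]}) : Prop :=
  [/\ l != 0, l \is 1.-homog, q \is 2.-homog &
      ~ exists m1 m2 h : {mpoly k[4]},
          [/\ m1 \is 1.-homog, m2 \is 1.-homog & q = l * h + m1 * m2]].

(* The plane l = 0 cuts F = 0 in twice the conic l = q = 0; a nonzero constant
   in front of q ^+ 2 is a square in k. *)
Definition trope (F l q : {mpoly k[4]}) : Prop :=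
  irreducible_conic l q /\ exists G : {mpoly k[4]}, F = l * G + q ^+ 2.

Definition on_conic (l q : {mpoly k[4]}) (P : 'rV[k]_4) : Prop :=
  [/\ P != 0, ev l P = 0 & ev q P = 0].

End ProjectiveSpace.

(* Subsets of a field, and in particular its subrings, are predicates. *)
Section Subrings.
Variable L : fieldType.
Implicit Types A B R V p : L -> Prop.

Definition same_set A B : Prop := forall x, A x <-> B x.
Definition sub_set A B : Prop := forall x, A x -> B x.

Definition subring A : Prop :=
  A 1 /\ forall x y, A x -> A y -> A (x - y) /\ A (x * y).

Definition valuation_ring V : Prop := subring V /\ forall x, V x \/ V x^-1.

Definition unit_of R (x : L) : Prop := [/\ x != 0, R x & R x^-1].

(* The maximal ideal of R, when R is local. *)
Definition nonunit R (x : L) : Prop := R x /\ ~ unit_of R x.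

(* V dominates R. *)
Definition dominates V R : Prop :=
  sub_set R V /\ sub_set (nonunit R) (nonunit V).

Definition adjoin A (s : seq L) (x : L) : Prop :=
  forall B, subring B -> sub_set A B -> (forall y, y \in s -> B y) -> B x.

Definition prime_ideal A p : Prop :=
  [/\ sub_set p A, p 0, (forall x y, p x -> p y -> p (x + y)),
      (forall a x, A a -> p x -> p (a * x)) &
      ~ p 1 /\ forall x y, A x -> A y -> p (x * y) -> p x \/ p y].

Definition localization A p (x : L) : Prop :=
  exists a b, [/\ A a, A b, ~ p b & x = a / b].

Definition generated1 R (I : L -> Prop) (e : L) : Prop :=
  R e /\ forall x, I x <-> exists2 a, R a & x = e * a.

Definition generated2 R (I : L -> Prop) (u v : L) : Prop :=
  [/\ R u, R v &
      forall x, I x <-> exists a b, [/\ R a, R b & x = u * a + v * b]].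

End Subrings.

Section FunctionField.
Variables (k : closedFieldType) (L : fieldType) (iota : {rmorphism k -> L}).
Variables (F : {mpoly k[4]}) (xi : 'I_4 -> L).

(* The field L, with the embedding iota of k, is the field of rational functions
   of the integral surface F = 0, and xi is its generic point. *)
Definition function_field : Prop :=
  (forall d (p : {mpoly k[4]}), p \is d.-homog ->
     (mmap iota xi p = 0 <-> exists g, p = g * F)) /\
  (forall z : L, exists d (p q : {mpoly k[4]}),
     [/\ p \is d.-homog, q \is d.-homog, mmap iota xi q != 0 &
         z = mmap iota xi p / mmap iota xi q]).

Definition local_ring (P : 'rV[k]_4) (z : L) : Prop :=
  exists d (p q : {mpoly k[4]}),
    [/\ p \is d.-homog, q \is d.-homog, ev q P != 0 &
        z = mmap iota xi p / mmap iota xi q].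

End FunctionField.

(* An integral scheme that is separated, birational and of finite type over
   Spec O, where O is a local ring with fraction field L, is determined by the
   set of its local rings, all of them subrings of L.  Such a scheme is given
   here by a finite affine cover Spec (A i), where each A i is a finitely
   generated O-algebra inside L, and it is handled through its set of local
   rings [pt].  Inclusion of local rings is generization of points. *)
Section Model.
Variables (k : closedFieldType) (L : fieldType) (iota : {rmorphism k -> L}).
Variables (O : L -> Prop) (n : nat) (A : 'I_n -> L -> Prop).
Implicit Types R V E : L -> Prop.

Definition affine_cover : Prop :=
  forall i, exists s : seq L, same_set (A i) (adjoin O s).

Definition pt R : Prop :=
  exists (i : 'I_n) (p : L -> Prop),
    prime_ideal (A i) p /\ same_set R (localization (A i) p).

(* Valuative criterion: existence is universal closedness over Spec O, and
   uniqueness is separatedness. *)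
Definition proper_separated : Prop :=
  forall V, valuation_ring V -> sub_set O V ->
    (exists2 R, pt R & dominates V R) /\
    (forall R R', pt R -> pt R' -> dominates V R -> dominates V R' ->
       same_set R R').

(* Points with residue field k.  As k is algebraically closed, and the residue
   field of O will be k, these are the closed points. *)
Definition closed_pt R : Prop :=
  pt R /\ forall x, R x -> exists c : k, nonunit R (x - iota c).

(* When O is a two-dimensional local ring of a surface, the local rings at
   closed points have dimension two; at the other points regularity is
   inherited by localization. *)
Definition regular : Prop :=
  forall R, closed_pt R -> exists u v, generated2 R (nonunit R) u v.

(* The scheme is isomorphic to Spec O over the complement of the closed point. *)
Definition iso_outside : Prop :=
  forall R, pt R -> ~ dominates R O ->
    exists p, prime_ideal O p /\ same_set R (localization O p).

Definition resolution : Prop :=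
  [/\ affine_cover, proper_separated, regular & iso_outside].

(* Generic points of the curves contracted to the closed point of Spec O; the
   local ring E at such a point is a discrete valuation ring of L. *)
Definition exceptional_curve E : Prop :=
  [/\ pt E, dominates E O & ~ closed_pt E].

Definition on_curve R E : Prop := closed_pt R /\ sub_set R E.

(* e = 0 is a local equation of the curve E at its closed point R, the curve is
   smooth there, and t restricts to a local parameter of the curve. *)
Definition curve_parameters R E (e t : L) : Prop :=
  generated2 R (nonunit R) e t /\
  generated1 R (fun x => R x /\ nonunit E x) e.

Definition smooth_curve E : Prop :=
  forall R, on_curve R E -> exists e t, curve_parameters R E e t.

(* The residue field of E, which is the function field of the curve, is a purely
   transcendental extension k(tau). *)
Definition rational_curve E : Prop :=
  exists tau : L,
    [/\ E tau,
        (forall p : {poly k}, p != 0 -> unit_of E (map_poly iota p).[tau]) &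
        (forall v, E v -> exists p q : {poly k}, q != 0 /\
           nonunit E (v - (map_poly iota p).[tau] / (map_poly iota q).[tau]))].

(* E is smooth at R, and the class of h in the conormal sheaf I/I^2 of E has
   order m at R: the quotient of h by a local equation restricts to a rational
   function of order m on E. *)
Definition conormal_order R E (h : L) (m : int) : Prop :=
  exists e t w, [/\ curve_parameters R E e t, unit_of R w &
                    nonunit E (h / e - w * t ^ m)].

(* E.E is the degree of the normal bundle of E, hence minus the degree of the
   divisor of a nonzero rational section h of I/I^2. *)
Definition self_intersection E (d : int) : Prop :=
  exists2 h, generated1 E (nonunit E) h &
  exists (N : nat) (R : 'I_N -> L -> Prop) (m : 'I_N -> int),
    [/\ forall i j, same_set (R i) (R j) -> i = j,
        forall i, on_curve (R i) E /\ conormal_order (R i) E h (m i),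
        forall R', on_curve R' E -> (forall i, ~ same_set R' (R i)) ->
          conormal_order R' E h 0 &
        d = - \sum_(i < N) m i].

Definition disjoint_curves E E' : Prop :=
  forall R, ~ (on_curve R E /\ on_curve R E').

Definition meet_transversally_once E E' : Prop :=
  exists2 R, on_curve R E /\ on_curve R E' &
    (exists e e', curve_parameters R E e e' /\ curve_parameters R E' e' e) /\
    (forall R', on_curve R' E -> on_curve R' E' -> same_set R' R).

Definition minus_two_curve E : Prop :=
  [/\ smooth_curve E, rational_curve E & self_intersection E (- 2%:Z)].

Definition exceptional_dual_graph (r : nat) (adj : rel 'I_r) : Prop :=
  exists E : 'I_r -> L -> Prop,
    [/\ forall i, exceptional_curve (E i) /\ minus_two_curve (E i),
        forall i j, same_set (E i) (E j) -> i = j,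
        forall E', exceptional_curve E' -> exists i, same_set E' (E i) &
        forall i j, i != j ->
          if adj i j then meet_transversally_once (E i) (E j)
          else disjoint_curves (E i) (E j)].

End Model.

(* 0 - 1 - 2 - 3 - 4 - 5, with both 6 and 7 attached to 5. *)
Definition D8_graph : rel 'I_8 := fun i j =>
  let edge (a b : nat) :=
    ((b == a.+1) && (b <= 6)%N) || ((a == 5%N) && (b == 7%N)) in
  edge i j || edge j i.

(* P is a point of type D_8 of the integral surface F = 0.  No exceptional curve
   is a (-1)-curve, so the resolution is the minimal one.  An isolated singular
   point of a surface in P^3 is normal, and p_a(Z) = 1 + Z.Z/2 <= 0 for every
   positive cycle Z on a D_8 configuration of (-2)-curves, so that the
   singularity is rational, with multiplicity - Z.Z = 2 for the fundamental
   cycle Z: it is a rational double point. *)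
Definition type_D8 (k : closedFieldType) (F : {mpoly k[4]}) (P : 'rV[k]_4) :
    Prop :=
  singular_point F P /\
  exists (L : fieldType) (iota : {rmorphism k -> L}) (xi : 'I_4 -> L),
    function_field iota F xi /\
    exists (n : nat) (A : 'I_n -> L -> Prop),
      resolution iota (local_ring iota xi P) A /\
      exceptional_dual_graph iota (local_ring iota xi P) A D8_graph.

Definition S1 (k : closedFieldType)
    (a1 a2 c1 c2 c3 d1 d2 d3 b1 b2 b3 b4 : k) : {mpoly k[4]} :=
  let x := Xx k in let y := Xy k in let z := Xz k in let t := Xt k in
  let a := a1 + a2 in
  (b3 ^+ 2 * c1) *: x ^+ 4 + (b2 ^+ 2 * d1) *: y ^+ 4
  + (b1 ^+ 2 * d1) *: z ^+ 4 + (b4 ^+ 2 * c1) *: t ^+ 4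
  + (b3 ^+ 2 * d2 + b2 ^+ 2 * c2 + a ^+ 2 * c3 + a * b2 * b3)
      *: (x ^+ 2 * y ^+ 2)
  + (b3 ^+ 2 * d3 + b1 ^+ 2 * c3 + a ^+ 2 * c2 + a * b1 * b3)
      *: (x ^+ 2 * z ^+ 2)
  + (b2 ^+ 2 * d3 + b4 ^+ 2 * c3 + a ^+ 2 * d2 + a * b2 * b4)
      *: (y ^+ 2 * t ^+ 2)
  + (b1 ^+ 2 * d2 + b4 ^+ 2 * c2 + a ^+ 2 * d3 + a * b1 * b4)
      *: (z ^+ 2 * t ^+ 2)
  + a ^+ 2 *: (b3 *: (x ^+ 2 * y * z) + b2 *: (x * y ^+ 2 * t)
               + b1 *: (x * z ^+ 2 * t) + b4 *: (y * z * t ^+ 2)).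

(* Main.v *)
(* In characteristic 2 the square roots of the coefficients give, for independent
   linear forms r = l2, u = l1, v, w,
     S1 = Q^2 - eta^2 r u (r v + u w),  Q = sqrt(c1) r^2 + sqrt(d1) u^2 + del r u + v w.
   The planes u = 0 and r = 0 thus cut S1 in the double conics Q = 0, and all
   partial derivatives vanish exactly where r^2 u = r u^2 = r^2 v = u^2 w = 0, which
   together with Q = 0 means r = u = v w = 0: these are P1 and P2, exchanged by
   (r, v) <-> (u, w).  In the chart v = 1, with W = Q / eta, the surface becomes
   W^2 = r u (r + u w), where w = eta W - sqrt(c1) r^2 - sqrt(d1) u^2 - del r u.
   Blowing up leads to eight affine charts with monomial coordinates in r, u, W.
   Properness is the valuative criterion for these charts, and the exceptional
   curves are the specializations of the charts along r = u = W = 0. *)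

From HB Require Import structures.
Require Import Defs.
From mathcomp Require Import all_boot all_order all_algebra all_field.
From mathcomp Require Import generic_quotient.
From mathcomp Require Import ring.
From mathcomp Require Import mpoly.
From Stdlib Require Import Classical ClassicalEpsilon FunctionalExtensionality PropExtensionality.

Set Implicit Arguments.
Unset Strict Implicit.
Unset Printing Implicit Defensive.

Import GRing.Theory.
Local Open Scope ring_scope.

(** * Subrings of a field *)

(** The definitions speak of subrings of the function field and not of schemes, so every geometric
    property has to be read off from algebra in the charts. One device does this uniformly: near a
    point of an exceptional curve with local equation [e] and coordinate [t], every chart generator
    is congruent modulo [e] to a rational function of [t]. Regularity, rationality, the list of
    closed points and the uniqueness of local rings all follow from such congruences. The terms
    [W^2 = r^2 u + b r u^4] are those of a D_8 equation. Comparing [r] with [u^3] leads to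
    [rho = r / u^3], and since [b] is nonzero the two end curves [rho = 0] and [rho = - b] are
    distinct. At P1 and P2 this [b] is, up to sign, a square root of [d1] and of [c1]: this is the
    role of [c1 * d1 != 0]. The other nonvanishing condition makes the coefficient of [v w] in Q
    nonzero; the same coefficient allows [v] and [w] to be chosen so that the mixed terms [v r] and
    [w u] of Q disappear. The resolution of the affine surface holds in every characteristic, whence
    the signs; characteristic 2 enters only with the reduction of the quartic and its singular
    points. *)

Section LocalSubrings.
Variable L : fieldType.
Implicit Types A B R T V p : L -> Prop.

Lemma same_setE A B : same_set A B -> A = B.
Proof.
by move=> h; apply: functional_extensionality => x; apply: propositional_extensionality.
Qed.

Section SubringClosure.
Variable A : L -> Prop.
Hypothesis sA : subring A.

Lemma subring1 : A 1. Proof. by case: sA. Qed.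
Lemma subringB x y : A x -> A y -> A (x - y).
Proof. by move=> hx hy; case: (proj2 sA _ _ hx hy). Qed.
Lemma subringM x y : A x -> A y -> A (x * y).
Proof. by move=> hx hy; case: (proj2 sA _ _ hx hy). Qed.
Lemma subring0 : A 0.
Proof. by rewrite -(subrr 1); apply: subringB; exact: subring1. Qed.
Lemma subringN x : A x -> A (- x).
Proof. by move=> hx; rewrite -sub0r; apply: subringB => //; exact: subring0. Qed.
Lemma subringD x y : A x -> A y -> A (x + y).
Proof. by move=> hx hy; rewrite -[y]opprK; apply: subringB => //; exact: subringN. Qed.
Lemma subringX x n : A x -> A (x ^+ n).
Proof.
move=> hx; elim: n => [|n IH]; first by rewrite expr0; exact: subring1.
by rewrite exprS; apply: subringM.
Qed.

Lemma nonunit0 : nonunit A 0.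
Proof. by split; [exact: subring0 | case=> /eqP]. Qed.

Lemma nonunit1 : ~ nonunit A 1.
Proof.
by case=> _; apply; split; rewrite ?oner_neq0 ?invr1 //; exact: subring1.
Qed.

Lemma unit_of1 : unit_of A 1.
Proof. by split; rewrite ?oner_neq0 ?invr1 //; exact: subring1. Qed.

Lemma unit_ofV x : unit_of A x -> unit_of A x^-1.
Proof. by case=> h1 h2 h3; split; rewrite ?invr_eq0 ?invrK. Qed.

Lemma unit_ofM x y : unit_of A x -> unit_of A y -> unit_of A (x * y).
Proof.
case=> h1 h2 h3 [h4 h5 h6]; split; first by rewrite mulf_neq0.
- exact: subringM.
- by rewrite invfM; apply: subringM.
Qed.

Lemma unit_ofX x n : unit_of A x -> unit_of A (x ^+ n).
Proof.
move=> hx; elim: n => [|n IH]; first by rewrite expr0; exact: unit_of1.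
by rewrite exprS; apply: unit_ofM.
Qed.

Lemma unit_ofN x : unit_of A x -> unit_of A (- x).
Proof.
by case=> h1 h2 h3; split; rewrite ?oppr_eq0 ?invrN //; apply: subringN.
Qed.

Lemma unit_or_nonunit x : A x -> unit_of A x \/ nonunit A x.
Proof. by move=> hx; case: (classic (unit_of A x)); [left | right]. Qed.

Lemma unit_of_mull x y : A x -> A y -> unit_of A (x * y) -> unit_of A x.
Proof.
move=> hx hy [h1 h2 h3]; have hx0 : x != 0 by move: h1; rewrite mulf_eq0 negb_or; case/andP.
have hy0 : y != 0 by move: h1; rewrite mulf_eq0 negb_or; case/andP.
split=> //; have -> : x^-1 = y * (x * y)^-1 by field; rewrite hx0 hy0.
exact: subringM.
Qed.

Lemma unit_of_mulr x y : A x -> A y -> unit_of A (x * y) -> unit_of A y.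
Proof. by move=> hx hy; rewrite mulrC; apply: unit_of_mull. Qed.

Lemma unit_of_mul1 x y : A x -> A y -> x * y = 1 -> unit_of A x.
Proof. by move=> hx hy h; apply: (unit_of_mull hx hy); rewrite h; exact: unit_of1. Qed.

Lemma unit_of_expr x n : A x -> unit_of A (x ^+ n.+1) -> unit_of A x.
Proof.
by move=> hx; rewrite exprS; apply: unit_of_mull => //; exact: subringX.
Qed.

Lemma nonunitMr x y : nonunit A x -> A y -> nonunit A (x * y).
Proof.
case=> hx nx hy; split; first exact: subringM.
by move=> h; apply: nx; exact: unit_of_mull h.
Qed.

Lemma nonunitMl x y : A x -> nonunit A y -> nonunit A (x * y).
Proof. by move=> hx hy; rewrite mulrC; exact: nonunitMr. Qed.

Lemma nonunitN x : nonunit A x -> nonunit A (- x).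
Proof.
move=> hx; rewrite -mulN1r; apply: nonunitMl => //; apply: subringN; exact: subring1.
Qed.

Lemma nonunitM_or x y : A x -> A y -> nonunit A (x * y) ->
  nonunit A x \/ nonunit A y.
Proof.
move=> hx hy [_ h]; case: (unit_or_nonunit hx) => [ux|]; last by left.
case: (unit_or_nonunit hy) => [uy|]; last by right.
by case: h; exact: unit_ofM.
Qed.

Lemma nonunit_unitl u x : unit_of A u -> A x -> nonunit A (u * x) -> nonunit A x.
Proof.
by move=> hu hx h; case: (nonunitM_or _ hx h) => // [|[]//]; case: hu.
Qed.

Lemma nonunitX x n : nonunit A x -> nonunit A (x ^+ n.+1).
Proof. by move=> hx; rewrite exprS; apply: nonunitMr => //; apply: subringX; case: hx. Qed.

Lemma nonunit_expr x n : A x -> nonunit A (x ^+ n) -> nonunit A x.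
Proof.
move=> hx; elim: n => [|n IH]; first by move/nonunit1.
by rewrite exprS => h; case: (nonunitM_or hx (subringX n hx) h).
Qed.

End SubringClosure.

(** A ring multiple of a nonunit is a nonunit in any subring ([nonunitMr]), so closure under sums is
    exactly what turns the nonunits into the unique maximal ideal. *)
Definition local_subring T : Prop :=
  subring T /\ forall x y, nonunit T x -> nonunit T y -> nonunit T (x + y).

Section LocalClosure.
Variable T : L -> Prop.
Hypothesis lT : local_subring T.
Let sT : subring T := proj1 lT.

Lemma nonunitD x y : nonunit T x -> nonunit T y -> nonunit T (x + y).
Proof. exact: (proj2 lT). Qed.

Lemma nonunitB x y : nonunit T x -> nonunit T y -> nonunit T (x - y).
Proof. by move=> hx hy; apply: nonunitD => //; exact: nonunitN. Qed.

Lemma unit_ofD x y : unit_of T x -> nonunit T y -> unit_of T (x + y).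
Proof.
move=> ux ny; have Tx : T x by case: ux.
have Ty : T y by case: ny.
case: (unit_or_nonunit (subringD sT Tx Ty)) => // h.
by case: (nonunitB h ny) => _; rewrite addrK.
Qed.

Lemma nonunit_congr x y : nonunit T (x - y) -> nonunit T y -> nonunit T x.
Proof. by move=> h hy; rewrite -(subrK y x); exact: nonunitD. Qed.

Lemma unit_congr x y : nonunit T (x - y) -> unit_of T y -> unit_of T x.
Proof. by move=> h hy; rewrite -(subrK y x) addrC; exact: unit_ofD. Qed.

End LocalClosure.

Lemma unit_of_sub R T x : sub_set R T -> unit_of R x -> unit_of T x.
Proof. by move=> h [h1 h2 h3]; split=> //; exact: h. Qed.

Lemma nonunit_of_sub R T x : sub_set R T -> R x -> nonunit T x -> nonunit R x.
Proof. by move=> h hx [_ nx]; split=> // ux; apply: nx; exact: unit_of_sub ux. Qed.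

Lemma dominates_unit T R x : dominates T R -> R x -> unit_of T x -> unit_of R x.
Proof.
move=> [_ d] hx ux; case: (classic (unit_of R x)) => // nx.
by have [_] := d x (conj hx nx).
Qed.

(** One of [x / y] and [y / x] lies in [V]; factoring out the denominator writes [x + y] as a
    multiple of a nonunit. *)
Lemma valuation_local V : valuation_ring V -> local_subring V.
Proof.
move=> [sV vV]; split=> // x y nx ny.
have hx : V x by case: nx.
have hy : V y by case: ny.
have [->|x0] := eqVneq x 0; first by rewrite add0r.
have [->|y0] := eqVneq y 0; first by rewrite addr0.
case: (vV (x / y)) => h.
  have -> : x + y = y * (x / y + 1) by rewrite mulrDr mulr1 mulrCA divff // mulr1.
  by apply: nonunitMr => //; apply: subringD => //; exact: subring1.
have -> : x + y = x * (1 + (x / y)^-1).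
  by rewrite mulrDr mulr1 invf_div mulrCA divff // mulr1.
by apply: nonunitMr => //; apply: subringD => //; exact: subring1.
Qed.

Lemma valuation_inv V x : valuation_ring V -> x != 0 -> ~ V x -> nonunit V x^-1.
Proof.
move=> [sV vV] x0 nx; case: (vV x) => // h; split=> // -[_ _].
by rewrite invrK.
Qed.

Lemma adjoin_subring A s : subring (adjoin A s).
Proof.
split=> [B sB _ _|x y hx hy]; first exact: subring1.
split=> B sB hA hs; [apply: subringB | apply: subringM] => //; by [exact: hx | exact: hy].
Qed.

Lemma adjoin_base A s : sub_set A (adjoin A s).
Proof. by move=> x hx B _ hA _; exact: hA. Qed.

Lemma adjoin_gen A s x : x \in s -> adjoin A s x.
Proof. by move=> hx B _ _ hs; exact: hs. Qed.

Lemma adjoin_min A s B : subring B -> sub_set A B -> (forall y, y \in s -> B y) ->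
  sub_set (adjoin A s) B.
Proof. by move=> h1 h2 h3 x; apply. Qed.

(** When [T] is local and contains [A], this is the local ring of Spec [A] at the centre of [T], the
    trace on [A] of its maximal ideal. The equation [T = fracs A T] then says that [T] itself is a
    local ring of the chart. *)
Definition fracs A T (x : L) : Prop :=
  exists a b, [/\ A a, A b, unit_of T b & x = a / b].

Section Fracs.
Variables (A T : L -> Prop).
Hypotheses (sA : subring A) (lT : local_subring T) (AT : sub_set A T).
Let sT : subring T := proj1 lT.

Lemma fracs_sub : sub_set (fracs A T) T.
Proof.
move=> _ [a [b [Aa _ [_ _ Tb] ->]]]; apply: subringM => //; exact: AT.
Qed.

Lemma fracs_base : sub_set A (fracs A T).
Proof.
move=> a Aa; exists a, 1; split=> //; [exact: subring1 | exact: unit_of1 | by rewrite divr1].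
Qed.

Lemma fracs_subring : subring (fracs A T).
Proof.
split=> [|_ _ [a [b [Aa Ab ub ->]]] [c [d [Ac Ad ud ->]]]].
  by apply: fracs_base; exact: subring1.
have [b0 _ _] := ub; have [d0 _ _] := ud.
split.
  exists (a * d - b * c), (b * d); split; try by [apply: unit_ofM].
  - by apply: subringB => //; apply: subringM.
  - exact: subringM.
  - by field; rewrite b0 d0.
exists (a * c), (b * d); split; try by [apply: unit_ofM | apply: subringM].
by field; rewrite b0 d0.
Qed.

Lemma fracs_unit x : fracs A T x -> unit_of T x -> unit_of (fracs A T) x.
Proof.
move=> hx ux; split=> //; first by case: ux.
case: hx ux => a [b [Aa Ab ub ->]] [ab0 _ Tab].
have [b0 _ Tb] := ub.
have a0 : a != 0 by move: ab0; rewrite mulf_eq0 negb_or; case/andP.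
exists b, a; split=> //; last by rewrite invf_div.
split=> //; first exact: AT.
have -> : a^-1 = (a / b)^-1 * b^-1 by field; rewrite a0 b0.
exact: subringM.
Qed.

Lemma fracs_dominated : dominates T (fracs A T).
Proof.
split; first exact: fracs_sub.
move=> x [hx nx]; split; first exact: fracs_sub.
by move=> ux; apply: nx; exact: fracs_unit.
Qed.

(** If [x] is nonzero, [x^-1] is a unit of [T], hence a unit of the localization. Separatedness
    rests on this: a function regular on [T] is regular at the centre of [T] in a chart as soon as
    its inverse is. *)
Lemma fracs_inv x : T x -> fracs A T x^-1 -> fracs A T x.
Proof.
move=> hx h; have [->|x0] := eqVneq x 0; first exact: (subring0 fracs_subring).
have [_ _] := fracs_unit h (unit_ofV (And3 x0 hx (fracs_sub h))).
by rewrite invrK.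
Qed.

Lemma fracs_prime : prime_ideal A (fun x => A x /\ nonunit T x).
Proof.
split.
- by move=> x [].
- by split; [exact: subring0 | exact: nonunit0].
- move=> x y [Ax nx] [Ay ny]; split; [exact: subringD | exact: nonunitD].
- move=> a x Aa [Ax nx]; split; [exact: subringM | apply: nonunitMl => //; exact: AT].
- split=> [[_]|x y Ax Ay [_ nxy]]; first exact: nonunit1.
  by case: (nonunitM_or sT (AT Ax) (AT Ay) nxy); [left | right].
Qed.

Lemma fracs_localization :
  same_set (fracs A T) (localization A (fun x => A x /\ nonunit T x)).
Proof.
move=> x; split=> [[a [b [Aa Ab ub ->]]]|[a [b [Aa Ab nb ->]]]]; exists a, b; split=> //.
  by move=> [_ []].
by case: (unit_or_nonunit (AT Ab)) => // h; case: nb.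
Qed.

End Fracs.

Section Localization.
Variables (A p : L -> Prop).
Hypotheses (sA : subring A) (pp : prime_ideal A p).

Lemma prime_memN1 b : A b -> ~ p b -> b != 0.
Proof. by case: pp => _ p0 _ _ _ _; apply: contra_notN => /eqP->. Qed.

Lemma localization_base : sub_set A (localization A p).
Proof.
move=> a Aa; exists a, 1; case: pp => _ _ _ _ [p1 _].
by split=> //; [exact: subring1 | rewrite divr1].
Qed.

Lemma localization_subring : subring (localization A p).
Proof.
split=> [|_ _ [a [b [Aa Ab nb ->]]] [c [d [Ac Ad nd ->]]]].
  by apply: localization_base; exact: subring1.
have b0 := prime_memN1 Ab nb; have d0 := prime_memN1 Ad nd.
have nbd : ~ p (b * d) by case: pp => _ _ _ _ [_ h] /(h _ _ Ab Ad) [].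
split.
  exists (a * d - b * c), (b * d); split=> //.
  - by apply: subringB => //; apply: subringM.
  - exact: subringM.
  - by field; rewrite b0 d0.
exists (a * c), (b * d); split=> //; try exact: subringM.
by field; rewrite b0 d0.
Qed.

Lemma localization_nonunit a : A a -> nonunit (localization A p) a <-> p a.
Proof.
move=> Aa; split=> [[_ nu]|pa].
  apply: NNPP => na; apply: nu; split.
  - exact: prime_memN1.
  - exact: localization_base.
  - by exists 1, a; split=> //; [exact: subring1 | rewrite div1r].
split; first exact: localization_base.
move=> [a0 _ [c [d [Ac Ad nd e]]]].
have d0 := prime_memN1 Ad nd; apply: nd.
have -> : d = c * a by rewrite -[LHS](mulfK a0) [d * a]mulrC -mulrA e; field; rewrite d0.
by case: pp => _ _ _ h _; exact: h.
Qed.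

Lemma localization_unit b : A b -> ~ p b -> unit_of (localization A p) b.
Proof.
move=> Ab nb; case: (unit_or_nonunit (localization_base Ab)) => //.
by move/(localization_nonunit Ab).
Qed.

Lemma localization_nonunitE x : nonunit (localization A p) x <->
  exists a b, [/\ p a, A b, ~ p b & x = a / b].
Proof.
have pA : sub_set p A by case: pp.
split=> [[[a [b [Aa Ab nb ->]]] nu]|[a [b [pa Ab nb ->]]]].
  exists a, b; split=> //; apply: NNPP => na; apply: nu.
  apply: unit_ofM; [exact: localization_subring | exact: localization_unit |].
  by apply: unit_ofV; exact: localization_unit.
apply: nonunitMr; first exact: localization_subring.
  by apply/(localization_nonunit (pA _ pa)).
by case: (unit_ofV (localization_unit Ab nb)).
Qed.

Lemma localization_local : local_subring (localization A p).
Proof.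
split; first exact: localization_subring.
case: (pp) => pA p0 pD pM [p1 pMor].
move=> _ _ /localization_nonunitE [a [b [pa Ab nb ->]]]
  /localization_nonunitE [c [d [pc Ad nd ->]]].
have b0 := prime_memN1 Ab nb; have d0 := prime_memN1 Ad nd.
apply/localization_nonunitE; exists (d * a + b * c), (b * d); split.
- by apply: pD; apply: pM.
- exact: subringM.
- by move=> /(pMor _ _ Ab Ad) [].
- by field; rewrite b0 d0.
Qed.

(** The elements of [A] outside [p] are the ones that become units, so every point of a chart can be
    described by [fracs], without reference to its prime. *)
Lemma localization_fracs : localization A p = fracs A (localization A p).
Proof.
apply: same_setE => x; split=> [[a [b [Aa Ab nb ->]]]|].
  by exists a, b; split=> //; exact: localization_unit.
exact: (fracs_sub localization_local localization_base).
Qed.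

End Localization.

End LocalSubrings.

(** * Local rings along and on a curve of an affine chart *)

Section Residues.
Variables (k : closedFieldType) (L : fieldType) (iota : {rmorphism k -> L}).
Implicit Types (O R T E A : L -> Prop) (P Q : {poly k}) (c : k).

Local Notation pe P t := (map_poly iota P).[t].

Lemma peD P Q t : pe (P + Q) t = pe P t + pe Q t.
Proof. by rewrite rmorphD hornerD. Qed.
Lemma peB P Q t : pe (P - Q) t = pe P t - pe Q t.
Proof. by rewrite rmorphB hornerD hornerN. Qed.
Lemma peM P Q t : pe (P * Q) t = pe P t * pe Q t.
Proof. by rewrite rmorphM hornerM. Qed.
Lemma peC c t : pe c%:P t = iota c.
Proof. by rewrite map_polyC hornerC. Qed.
Lemma peX t : pe 'X t = t.
Proof. by rewrite map_polyX hornerX. Qed.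
Lemma pe1 t : pe 1 t = 1.
Proof. by rewrite rmorph1 hornerC. Qed.
Lemma pe0 t : pe 0 t = 0.
Proof. by rewrite rmorph0 horner0. Qed.

Lemma pe_closed T P t : subring T -> (forall c, T (iota c)) -> T t -> T (pe P t).
Proof.
move=> sT Tc Tt; elim/poly_ind: P => [|P c IH]; first by rewrite pe0; exact: subring0.
rewrite peD peM peX peC; apply: subringD => //; exact: subringM.
Qed.

Lemma pe_root P c t : exists Q, pe P t - iota P.[c] = (t - iota c) * pe Q t.
Proof.
have /factor_theorem [Q eQ] : root (P - P.[c]%:P) c.
  by rewrite /root hornerD hornerN hornerC subrr.
exists Q; rewrite -[iota P.[c]](peC _ t) -peB eQ peM peB peX peC mulrC //.
Qed.

(** The residue of [t] is transcendental over [k]; units of [T] express this without forming the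
    residue field. *)
Definition transcendental T (t : L) : Prop := forall P, P != 0 -> unit_of T (pe P t).

(** As [k] is algebraically closed, a polynomial in [t] is a product of factors [t - iota c]; if no
    such factor is a nonunit, all nonzero polynomials in [t] are units. Thus a point of a curve with
    coordinate [t] is either closed or generic. *)
Lemma residue_dichotomy T t : local_subring T -> (forall c, T (iota c)) -> T t ->
  (exists c, nonunit T (t - iota c)) \/ transcendental T t.
Proof.
move=> lT Tc Tt; have sT := proj1 lT.
case: (classic (exists c, nonunit T (t - iota c))) => h; [by left | right].
move=> P P0; have [s eP] := closed_field_poly_normal P.
rewrite eP -mul_polyC peM peC; apply: unit_ofM => //.
  have l0 : lead_coef P != 0 by rewrite lead_coef_eq0.
  by split; rewrite ?fmorph_eq0 -?fmorphV.
elim: s {eP} => [|c s IH]; first by rewrite big_nil pe1; exact: unit_of1.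
rewrite big_cons peM; apply: unit_ofM => //.
case: (@unit_or_nonunit _ T (pe ('X - c%:P) t)) => //; first exact: pe_closed.
by rewrite peB peX peC => hc; case: h; exists c.
Qed.

Lemma transcendental_neq T t c : transcendental T t -> ~ nonunit T (t - iota c).
Proof.
move=> h [_]; apply; move: (h ('X - c%:P)); rewrite peB peX peC; apply.
by rewrite polyXsubC_eq0.
Qed.

Lemma transcendental_unit T t : transcendental T t -> unit_of T t.
Proof. by move=> h; move: (h 'X); rewrite peX; apply; rewrite polyX_eq0. Qed.

Lemma nonunit_iota T c : (forall c, T (iota c)) -> nonunit T (iota c) -> c = 0.
Proof.
move=> Tc [_ h]; apply/eqP; apply: contra_notT h => c0.
by split; rewrite ?fmorph_eq0 -?fmorphV.
Qed.

Lemma unit_iota T c : (forall c, T (iota c)) -> c != 0 -> unit_of T (iota c).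
Proof. by move=> Tc c0; split; rewrite ?fmorph_eq0 -?fmorphV. Qed.

Definition in_ideal T e x : Prop := exists2 a, T a & x = e * a.

Section Ideal.
Variables (T : L -> Prop) (e : L).
Hypothesis sT : subring T.
Lemma in_ideal0 : in_ideal T e 0.
Proof. by exists 0; rewrite ?mulr0 //; exact: subring0. Qed.
Lemma in_idealD x y : in_ideal T e x -> in_ideal T e y -> in_ideal T e (x + y).
Proof.
by move=> [a Ta ->] [b Tb ->]; exists (a + b); rewrite ?mulrDr //; exact: subringD.
Qed.
Lemma in_idealMr x y : in_ideal T e x -> T y -> in_ideal T e (x * y).
Proof. by move=> [a Ta ->] Ty; exists (a * y); rewrite ?mulrA //; exact: subringM. Qed.
Lemma in_idealMl x y : T x -> in_ideal T e y -> in_ideal T e (x * y).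
Proof. by move=> Tx h; rewrite mulrC; exact: in_idealMr. Qed.
Lemma in_idealN x : in_ideal T e x -> in_ideal T e (- x).
Proof. by move=> [a Ta ->]; exists (- a); rewrite ?mulrN //; exact: subringN. Qed.
Lemma in_idealB x y : in_ideal T e x -> in_ideal T e y -> in_ideal T e (x - y).
Proof. by move=> hx hy; apply: in_idealD => //; exact: in_idealN. Qed.
Lemma in_ideal_self : in_ideal T e e.
Proof. by exists 1; rewrite ?mulr1 //; exact: subring1. Qed.
Lemma in_ideal_div v x : unit_of T v -> in_ideal T e (v * x) -> in_ideal T e x.
Proof.
move=> [v0 _ hv] h; rewrite -[x](mulKf v0); exact: in_idealMl.
Qed.
Lemma in_ideal_nonunit x : nonunit T e -> in_ideal T e x -> nonunit T x.
Proof. by move=> he [a Ta ->]; exact: nonunitMr. Qed.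
End Ideal.

(** Modulo [e] the element [x] is the rational function [b / a] of [t]. Denominators cannot be
    avoided: local rings consist of fractions, and at infinity on curve 5 even the generator [U] is
    a proper fraction in the coordinate. *)
Definition reduces T e t x : Prop := exists a b : {poly k},
  unit_of T (pe a t) /\ in_ideal T e (pe a t * x - pe b t).

Section Charts.
Variables (O : L -> Prop) (r u W : L).
Hypothesis lO : local_subring O.
Hypothesis Oc : forall c, O (iota c).
Hypotheses (Or : nonunit O r) (Ou : nonunit O u) (OW : nonunit O W).
Hypothesis Om : forall x, O x -> exists c a1 a2 a3,
  [/\ O a1, O a2, O a3 & x = iota c + (r * a1 + u * a2 + W * a3)].

(** By [Om] the residue field of [O] is [k] and its maximal ideal is generated by [r], [u], [W], so
    domination can be tested on these three elements. *)
Lemma dominatesP T : local_subring T -> sub_set O T ->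
  dominates T O <-> [/\ nonunit T r, nonunit T u & nonunit T W].
Proof.
move=> lT OT; split=> [[_ d]|[nr nu nW]]; first by split; exact: d.
split=> // x hx; have [c [a1 [a2 [a3 [h1 h2 h3 e]]]]] := Om (proj1 hx).
have sO := proj1 lO.
have mO : nonunit O (r * a1 + u * a2 + W * a3).
  by do 2?[apply: nonunitD => //]; exact: nonunitMr.
have c0 : iota c = 0.
  have : nonunit O (iota c) by rewrite -(addrK (r * a1 + u * a2 + W * a3) (iota c)) -e; apply: nonunitB.
  by move/(nonunit_iota Oc)->; rewrite rmorph0.
rewrite e c0 add0r.
by do 2?[apply: nonunitD => //]; apply: nonunitMr (OT _ _) => //; case: lT.
Qed.

Section OneChart.
Variable gens : seq L.
Let A := adjoin O gens.

Section Reduction.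
Variables (T : L -> Prop) (e t : L).
Hypotheses (lT : local_subring T) (AT : sub_set A T) (Tt : T t).
Hypothesis fT : T = fracs A T.
Hypotheses (ne : nonunit T e)
  (hr : in_ideal T e r) (hu : in_ideal T e u) (hW : in_ideal T e W).
Hypothesis hg : forall g, g \in gens -> reduces T e t g.

Let sT : subring T := proj1 lT.
Let OT : sub_set O T. Proof. by move=> x Ox; apply: AT; exact: adjoin_base. Qed.
Let Tc c : T (iota c). Proof. exact: OT. Qed.
Let Tp P : T (pe P t). Proof. exact: pe_closed. Qed.

(** The reducing elements form a subring. It contains [O], whose elements are constants modulo [r],
    [u], [W] and hence modulo [e], and the generators, so it contains the chart; then it remains to
    divide by units of [T]. *)
Lemma reduces_all x : T x -> reduces T e t x.
Proof.
have sB : subring (fun x => T x /\ reduces T e t x).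
  split=> [|y z [Ty [a [b [ua hab]]]] [Tz [a' [b' [ua' hab']]]]].
    split; [exact: subring1 | exists 1, 1; rewrite pe1 mulr1 subrr].
    by split; [exact: unit_of1 | exact: in_ideal0].
  split; split; try by [apply: subringB | apply: subringM].
    exists (a * a'), (b * a' - b' * a); rewrite peB !peM; split; first exact: unit_ofM.
    have -> : pe a t * pe a' t * (y - z) - (pe b t * pe a' t - pe b' t * pe a t) =
      pe a' t * (pe a t * y - pe b t) - pe a t * (pe a' t * z - pe b' t) by ring.
    by apply: in_idealB => //; apply: in_idealMl.
  exists (a * a'), (b * b'); rewrite !peM; split; first exact: unit_ofM.
  have -> : pe a t * pe a' t * (y * z) - pe b t * pe b' t =
    pe a' t * z * (pe a t * y - pe b t) + pe b t * (pe a' t * z - pe b' t) by ring.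
  by apply: in_idealD => //; apply: in_idealMl => //; apply: subringM.
have AB : sub_set A (fun x => T x /\ reduces T e t x).
  apply: adjoin_min => // [x0 Ox|g hgg]; last by split; [apply: AT; exact: adjoin_gen | exact: hg].
  split; first exact: OT.
  have [c [a1 [a2 [a3 [h1 h2 h3 ->]]]]] := Om Ox.
  exists 1, c%:P; rewrite pe1 peC mul1r addrC addKr; split; first exact: unit_of1.
  by do 2?[apply: in_idealD => //]; apply: in_idealMr => //; exact: OT.
rewrite {1}fT => -[y [z [/AB[Ty [a [b [ua hab]]]] /AB[Tz [a' [b' [ua' hab']]]] uz ->]]].
(* The denominator [z] is a unit, so the numerator [b'] of its reduction is a unit at [t] and may
   serve as a denominator. *)
have ub' : unit_of T (pe b' t).
  apply: (unit_congr lT (y := pe a' t * z)); last exact: unit_ofM.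
  by rewrite -opprB; apply: nonunitN => //; exact: in_ideal_nonunit hab'.
exists (a * b'), (b * a'); rewrite !peM; split; first exact: unit_ofM.
apply: (in_ideal_div sT uz); have [z0 _ _] := uz.
have -> : z * (pe a t * pe b' t * (y / z) - pe b t * pe a' t) =
  pe b' t * (pe a t * y - pe b t) - pe b t * (pe a' t * z - pe b' t) by field; rewrite z0.
by apply: in_idealB => //; apply: in_idealMl.
Qed.

(** The residue is the value [b(c) / a(c)] of the reduction of [x]; here [a(c)] is nonzero because
    the unit [a(t)] is congruent to it. *)
Lemma closed_residue c x : nonunit T (t - iota c) -> T x ->
  exists c', nonunit T (x - iota c').
Proof.
move=> nt Tx; have [a [b [ua hab]]] := reduces_all Tx.
have [Q eQ] := pe_root a c t; have [Q' eQ'] := pe_root b c t.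
have na : nonunit T (pe a t - iota a.[c]) by rewrite eQ; exact: nonunitMr.
have nb : nonunit T (pe b t - iota b.[c]) by rewrite eQ'; exact: nonunitMr.
have ac0 : a.[c] != 0.
  apply: contraTneq isT => ac; case: na; rewrite ac rmorph0 subr0 => _; by case.
exists (b.[c] / a.[c]); apply: (nonunit_unitl sT (unit_iota Tc ac0)).
  by apply: subringB.
have -> : iota a.[c] * (x - iota (b.[c] / a.[c])) =
  (pe a t * x - pe b t) - (pe a t - iota a.[c]) * x + (pe b t - iota b.[c]).
  rewrite rmorphM fmorphV; field; by rewrite fmorph_eq0.
apply: nonunitD => //; apply: nonunitB => //; last exact: nonunitMr.
exact: in_ideal_nonunit hab.
Qed.

(** If [x] is a nonunit with reduction [b / a], then [b(c) = 0], so [t - iota c] divides [b(t)] and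
    [x] lies in the ideal of [e] and [t - iota c]. *)
Lemma closed_generated2 c : nonunit T (t - iota c) ->
  generated2 T (nonunit T) e (t - iota c).
Proof.
move=> nt; split; [by case: ne | by case: nt | move=> x; split=> [nx|[y [z [Ty Tz ->]]]]]; last first.
  by apply: nonunitD => //; exact: nonunitMr.
have [a [b [ua hab]]] := reduces_all (proj1 nx).
have nb : nonunit T (pe b t).
  have -> : pe b t = pe a t * x - (pe a t * x - pe b t) by ring.
  by apply: nonunitB => //; [exact: nonunitMl | exact: in_ideal_nonunit hab].
have [Q eQ] := pe_root b c t.
have bc : iota b.[c] = 0.
  have : nonunit T (iota b.[c]).
    have -> : iota b.[c] = pe b t - (t - iota c) * pe Q t by rewrite -eQ subKr.
    by apply: nonunitB => //; exact: nonunitMr.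
  by move/(nonunit_iota Tc)->; rewrite rmorph0.
move: eQ; rewrite bc subr0 => eQ; have [y Ty ey] := hab; have [a0 Ta Tav] := ua.
exists (y / pe a t), (pe Q t / pe a t); split; try exact: subringM.
by apply: (mulfI a0); rewrite -(subrK (pe b t) (_ * x)) ey eQ; field; rewrite a0.
Qed.

(** The numerator [b(t)] of the reduction is a nonunit at the generic point [E], where [t] is
    transcendental; hence [b = 0] and [e] divides [x]. This applies to [T = E] as well as to closed
    points of the curve. *)
Lemma reduces_nonunit E x : local_subring E -> sub_set T E -> transcendental E t ->
  nonunit E e -> T x -> nonunit E x -> in_ideal T e x.
Proof.
move=> lE TE tr nE Tx nx; have [a [b [ua hab]]] := reduces_all Tx.
have sE := proj1 lE.
have nb : nonunit E (pe b t).
  have -> : pe b t = pe a t * x - (pe a t * x - pe b t) by ring.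
  apply: nonunitB => //; first by apply: nonunitMl => //; exact: TE.
  by apply: in_ideal_nonunit nE _ => //; case: hab => y Ty ->; exists y => //; exact: TE.
have b0 : b = 0 by apply/eqP/negPn/negP => b0; case: nb => _; apply; exact: tr.
by move: hab; rewrite b0 pe0 subr0; exact: in_ideal_div.
Qed.

Lemma generic_generated1 : transcendental T t -> generated1 T (nonunit T) e.
Proof.
move=> tr; split; first by case: ne.
move=> x; split=> [nx|[a Ta ->]]; last exact: nonunitMr.
by apply: (@reduces_nonunit T) => //; case: nx.
Qed.

Lemma curve_generated1 E : local_subring E -> sub_set T E -> transcendental E t ->
  nonunit E e -> generated1 T (fun x => T x /\ nonunit E x) e.
Proof.
move=> lE TE tr nE; split; first by case: ne.
move=> x; split=> [[Tx nx]|[a Ta ->]]; first exact: (@reduces_nonunit E).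
split; first by apply: subringM => //; case: ne.
by apply: nonunitMr => //; [case: lE | exact: TE].
Qed.

Lemma generic_rational : transcendental T t -> rational_curve iota T.
Proof.
move=> tr; exists t; split=> // x /reduces_all [a [b [ua hab]]].
have [a0 _ hv] := ua.
exists b, a; split; first by apply: contraNneq a0 => ->; rewrite pe0.
have -> : x - pe b t / pe a t = (pe a t * x - pe b t) / pe a t by field.
by apply: nonunitMr => //; exact: in_ideal_nonunit hab.
Qed.

End Reduction.

Section Uniqueness.
Variables (T T' : L -> Prop) (t : L).
Hypotheses (lT : local_subring T) (AT : sub_set A T) (fT : T = fracs A T).
Hypotheses (lT' : local_subring T') (AT' : sub_set A T') (fT' : T' = fracs A T').
Hypotheses (dT : dominates T O) (dT' : dominates T' O) (Tt : T t) (Tt' : T' t).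
Hypothesis hg : forall g, g \in gens -> exists a b : {poly k},
  [/\ unit_of T (pe a t), unit_of T' (pe a t),
      nonunit T (pe a t * g - pe b t) & nonunit T' (pe a t * g - pe b t)].
Hypothesis ht : forall P, nonunit T (pe P t) <-> nonunit T' (pe P t).

(** A local ring of a chart is determined by the prime it cuts out there. Every chart element has
    the same reduction [b / a] for both rings, and by [ht] the numerator vanishes for both or for
    neither. *)
Lemma local_ring_unique : T = T'.
Proof.
have sT := proj1 lT; have sT' := proj1 lT'.
have OT : sub_set O T by case: dT.
have OT' : sub_set O T' by case: dT'.
have Tp P : T (pe P t) by apply: pe_closed => // c; exact: OT.
have Tp' P : T' (pe P t) by apply: pe_closed => // c; exact: OT'.
pose B x := [/\ T x, T' x & exists a b : {poly k},
  [/\ unit_of T (pe a t), unit_of T' (pe a t),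
      nonunit T (pe a t * x - pe b t) & nonunit T' (pe a t * x - pe b t)]].
have sB : subring B.
  split=> [|x y [Tx Tx' [a [b [u1 u2 h1 h2]]]] [Ty Ty' [a' [b' [u3 u4 h3 h4]]]]].
    split; try exact: subring1.
    by exists 1, 1; rewrite pe1 mulr1 subrr; split; by [exact: unit_of1 | exact: nonunit0].
  split; split; try by [apply: subringB | apply: subringM].
    exists (a * a'), (b * a' - b' * a); rewrite peB !peM.
    have -> : pe a t * pe a' t * (x - y) - (pe b t * pe a' t - pe b' t * pe a t) =
      pe a' t * (pe a t * x - pe b t) - pe a t * (pe a' t * y - pe b' t) by ring.
    by split; try exact: unit_ofM; apply: nonunitB => //; exact: nonunitMl.
  exists (a * a'), (b * b'); rewrite !peM.
  have -> : pe a t * pe a' t * (x * y) - pe b t * pe b' t =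
    pe a' t * y * (pe a t * x - pe b t) + pe b t * (pe a' t * y - pe b' t) by ring.
  by split; try exact: unit_ofM; apply: nonunitD => //; apply: nonunitMl => //; apply: subringM.
have AB : sub_set A B.
  apply: adjoin_min => // [x Ox|g /[dup]hgg /hg h]; last first.
    by split=> //; [apply: AT | apply: AT']; exact: adjoin_gen.
  split; [exact: OT | exact: OT' |].
  have [c [a1 [a2 [a3 [h1 h2 h3 e]]]]] := Om Ox.
  exists 1, c%:P; rewrite pe1 peC mul1r.
  have h : nonunit O (x - iota c).
    have sO := proj1 lO; rewrite e addrC addKr.
    by do 2?[apply: nonunitD => //]; exact: nonunitMr.
  split; try exact: unit_of1; by [case: dT => _; exact | case: dT' => _; exact].
have mAB x : A x -> nonunit T x <-> nonunit T' x.
  move=> /AB [Tx Tx' [a [b [u1 u2 h1 h2]]]]; split=> h.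
    apply: (nonunit_unitl sT' u2 Tx'); apply: (nonunit_congr lT' h2); apply/ht.
    by rewrite -(subKr (pe a t * x) (pe b t)); apply: nonunitB => //; apply: nonunitMl.
  apply: (nonunit_unitl sT u1 Tx); apply: (nonunit_congr lT h1); apply/ht.
  by rewrite -(subKr (pe a t * x) (pe b t)); apply: nonunitB => //; apply: nonunitMl.
have uAB x : A x -> unit_of T x <-> unit_of T' x.
  move=> Ax; have [h1 h2] := mAB x Ax; split=> ux.
    by case: (unit_or_nonunit (AT' Ax)) => // /h2 [].
  by case: (unit_or_nonunit (AT Ax)) => // /h1 [].
apply: same_setE => x; rewrite fT fT'.
by split=> -[a [b [Aa Ab ub ->]]]; exists a, b; split=> //; apply/uAB.
Qed.
End Uniqueness.

Section ClosedPoints.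
Variables (E : L -> Prop) (t : L) (c : k).
Hypotheses (lE : local_subring E) (AE : sub_set A E) (dE : dominates E O).
Hypotheses (At : A t) (tr : transcendental E t).
Hypothesis hg : forall g, g \in gens -> exists a b : {poly k},
  a.[c] != 0 /\ nonunit E (pe a t * g - pe b t).

(** The closed point is the kernel of the evaluation [x |-> b(c) / a(c)], where [b / a] is the
    function that [x] induces on the curve. It suffices that [a(c)] can be made nonzero for the
    generators. *)
Lemma closed_point_exists : exists R : L -> Prop,
  [/\ local_subring R, sub_set A R, R = fracs A R & sub_set R E] /\
  [/\ nonunit R (t - iota c), forall x, A x -> nonunit E x -> nonunit R x &
      forall x, R x -> exists c', nonunit R (x - iota c')].
Proof.
have sE := proj1 lE; have sA : subring A by exact: adjoin_subring.
have OA : sub_set O A by exact: adjoin_base.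
have gA g : g \in gens -> A g by exact: adjoin_gen.
have minA B : subring B -> sub_set O B -> (forall g, g \in gens -> B g) -> sub_set A B.
  exact: adjoin_min.
clearbody A.
have Ac c' : A (iota c') by exact: OA.
have Ap P : A (pe P t) := pe_closed P sA Ac At.
have OE : sub_set O E by case: dE.
have Ec c' : E (iota c') by exact: OE.
have Ep P : E (pe P t) by exact: AE.
have prodE x y a b a' b' : E x -> E y -> nonunit E (pe a t * x - pe b t) ->
    nonunit E (pe a' t * y - pe b' t) ->
    nonunit E (pe (a * a') t * (x * y) - pe (b * b') t).
  move=> Ex Ey h1 h2; rewrite !peM.
  have -> : pe a t * pe a' t * (x * y) - pe b t * pe b' t =
    pe a' t * y * (pe a t * x - pe b t) + pe b t * (pe a' t * y - pe b' t) by ring.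
  by apply: nonunitD => //; apply: nonunitMl => //; apply: subringM.
have subE x y a b a' b' : E x -> E y -> nonunit E (pe a t * x - pe b t) ->
    nonunit E (pe a' t * y - pe b' t) ->
    nonunit E (pe (a * a') t * (x - y) - pe (b * a' - b' * a) t).
  move=> Ex Ey h1 h2; rewrite peB !peM.
  have -> : pe a t * pe a' t * (x - y) - (pe b t * pe a' t - pe b' t * pe a t) =
    pe a' t * (pe a t * x - pe b t) - pe a t * (pe a' t * y - pe b' t) by ring.
  by apply: nonunitB => //; exact: nonunitMl.
have hA : forall x, A x -> exists a b : {poly k}, a.[c] != 0 /\ nonunit E (pe a t * x - pe b t).
  suff hB : sub_set A (fun x => E x /\ exists a b : {poly k},
     a.[c] != 0 /\ nonunit E (pe a t * x - pe b t)) by move=> x /hB [].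
  apply: minA.
  - split=> [|x y [Ex [a [b [n1 h1]]]] [Ey [a' [b' [n2 h2]]]]].
      split; first exact: subring1.
      by exists 1, 1; rewrite pe1 mulr1 subrr hornerC oner_neq0; split=> //; exact: nonunit0.
    split; split; try by [apply: subringB | apply: subringM].
      by exists (a * a'), (b * a' - b' * a); rewrite hornerM mulf_neq0 //; split=> //; exact: subE.
    by exists (a * a'), (b * b'); rewrite hornerM mulf_neq0 //; split=> //; exact: prodE.
  - move=> x Ox; split; first exact: OE.
    have [c' [a1 [a2 [a3 [h1 h2 h3 e]]]]] := Om Ox.
    exists 1, c'%:P; rewrite pe1 peC mul1r hornerC oner_neq0; split=> //.
    case: dE => _; apply.
    have sO := proj1 lO; rewrite e addrC addKr.
    by do 2?[apply: nonunitD => //]; exact: nonunitMr.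
  - by move=> g hgg; split; [apply: AE; exact: gA | exact: hg].
pose p x := A x /\ exists a b : {poly k}, [/\ a.[c] != 0, b.[c] = 0 & nonunit E (pe a t * x - pe b t)].
(* As [t] is transcendental on [E], two fractions for the same element agree as rational functions.
   This makes [p] a proper ideal and a prime one. *)
have unique x a b a' b' : E x -> nonunit E (pe a t * x - pe b t) ->
    nonunit E (pe a' t * x - pe b' t) -> a' * b = a * b'.
  move=> Ex h1 h2; have : nonunit E (pe (a' * b - a * b') t).
    rewrite peB !peM.
    have -> : pe a' t * pe b t - pe a t * pe b' t =
      pe a t * (pe a' t * x - pe b' t) - pe a' t * (pe a t * x - pe b t) by ring.
    by apply: nonunitB => //; exact: nonunitMl.
  by move=> [_ h]; apply/eqP; rewrite -subr_eq0; apply/negPn/negP => /tr.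
have pp : prime_ideal A p.
  split.
  - by move=> x [].
  - split; first exact: subring0.
    exists 1, 0; rewrite pe0 mulr0 subrr horner0 hornerC oner_neq0; split=> //; exact: nonunit0.
  - move=> x y [Ax [a [b [n1 z1 h1]]]] [Ay [a' [b' [n2 z2 h2]]]]; split; first exact: subringD.
    exists (a * a'), (b * a' + b' * a); rewrite hornerM mulf_neq0 // hornerD !hornerM z1 z2 !mul0r addr0.
    split=> //; rewrite peD !peM.
    have -> : pe a t * pe a' t * (x + y) - (pe b t * pe a' t + pe b' t * pe a t) =
      pe a' t * (pe a t * x - pe b t) + pe a t * (pe a' t * y - pe b' t) by ring.
    by apply: nonunitD => //; exact: nonunitMl.
  - move=> x y Ax [Ay [a' [b' [n2 z2 h2]]]]; split; first exact: subringM.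
    have [a [b [n1 h1]]] := hA _ Ax.
    exists (a * a'), (b * b'); rewrite hornerM mulf_neq0 // hornerM z2 mulr0; split=> //.
    by apply: prodE => //; exact: AE.
  - split=> [[_ [a [b [n1 z1 h1]]]]|x y Ax Ay [_ [a0 [b0 [n0 z0 h0]]]]].
      have h2 : nonunit E (pe 1 t * 1 - pe 1 t) by rewrite pe1 mulr1 subrr; exact: nonunit0.
      have := unique _ _ _ _ _ (subring1 sE) h1 h2; rewrite mul1r mulr1 => e.
      by move: n1; rewrite -e z1 eqxx.
    have [a [b [n1 h1]]] := hA _ Ax; have [a' [b' [n2 h2]]] := hA _ Ay.
    have := unique _ _ _ _ _ (subringM sE (AE Ax) (AE Ay))
      (prodE _ _ _ _ _ _ (AE Ax) (AE Ay) h1 h2) h0.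
    move/(congr1 (fun q => q.[c])); rewrite !hornerM z0 mulr0 => /eqP.
    rewrite !mulf_eq0 (negbTE n0) /= => /orP [] /eqP e.
      by left; split=> //; exists a, b.
    by right; split=> //; exists a', b'.
pose R := localization A p; exists R.
have sR : subring R by exact: localization_subring.
have AR : sub_set A R by exact: localization_base.
have Rc c' : R (iota c') by exact: AR.
have mE x : A x -> nonunit E x -> nonunit R x.
  move=> Ax nx; apply/(localization_nonunit sA pp Ax); split=> //.
  by exists 1, 0; rewrite pe0 pe1 subr0 mul1r horner0 hornerC oner_neq0.
have ntc : nonunit R (t - iota c).
  have Atc : A (t - iota c) by exact: subringB.
  apply/(localization_nonunit sA pp Atc); split=> //.
  exists 1, ('X - c%:P); rewrite pe1 mul1r peB peX peC subrr hornerXsubC subrr hornerC oner_neq0.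
  by split=> //; exact: nonunit0.
have lR : local_subring R by exact: localization_local.
have resA x : A x -> exists c', nonunit R (x - iota c').
  move=> Ax; have [a [b [ac0 h]]] := hA _ Ax.
  have [Q eQ] := pe_root a c t; have [Q' eQ'] := pe_root b c t.
  have na : nonunit R (pe a t - iota a.[c]) by rewrite eQ; apply: nonunitMr => //; exact: AR.
  have nb : nonunit R (pe b t - iota b.[c]) by rewrite eQ'; apply: nonunitMr => //; exact: AR.
  have Rx := AR _ Ax.
  exists (b.[c] / a.[c]); apply: (nonunit_unitl sR (unit_iota Rc ac0)).
    by apply: subringB.
  have -> : iota a.[c] * (x - iota (b.[c] / a.[c])) =
    (pe a t * x - pe b t) - (pe a t - iota a.[c]) * x + (pe b t - iota b.[c]).
    rewrite rmorphM fmorphV; field; by rewrite fmorph_eq0.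
  apply: nonunitD => //; apply: nonunitB => //; last exact: nonunitMr.
  by apply: mE => //; apply: subringB => //; apply: subringM.
split; split=> //.
- exact: localization_fracs.
- move=> _ [x [y [Ax Ay ny ->]]]; apply: subringM => //; first exact: AE.
  have [a [b [ac0 h]]] := hA _ Ay.
  suff [] : unit_of E y by [].
  apply: (unit_of_mulr sE (Ep a) (AE Ay)); apply: (unit_congr lE h); apply: tr.
  apply: contra_notN ny => /eqP P0; split=> //.
  by exists a, b; split=> //; rewrite P0 horner0.
- move=> _ [a [b [Aa Ab nb ->]]].
  have [ca hca] := resA _ Aa; have [cb hcb] := resA _ Ab.
  have ub : unit_of R b by exact: localization_unit.
  have cb0 : cb != 0.
    by apply: contraTneq isT => e; case: hcb; rewrite e rmorph0 subr0 => _; case.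
  exists (ca / cb); rewrite rmorphM fmorphV.
  have [b0 _ _] := ub.
  have -> : a / b - iota ca / iota cb =
     ((a - iota ca) - iota (ca / cb) * (b - iota cb)) / b.
    by rewrite rmorphM fmorphV; field; rewrite b0 fmorph_eq0 cb0.
  apply: nonunitMr => //; last by case: (unit_ofV ub).
  by apply: nonunitB => //; apply: nonunitMl => //; exact: AR.
Qed.
End ClosedPoints.

End OneChart.
End Charts.
End Residues.

(** * The eight charts of the resolution *)

Lemma mul1_inv (L : fieldType) (x y : L) : x * y = 1 -> x^-1 = y.
Proof.
move=> h; have x0 : x != 0 by apply/negP => /eqP x0; move/eqP: h; rewrite x0 mul0r eq_sym oner_eq0.
by rewrite -[LHS]mulr1 -h mulKf.
Qed.

Ltac mem sT := intros; repeat first [ assumption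
  | match goal with H : forall _, _ |- _ => exact (H _) end | apply: (subringM sT) | apply: (subringB sT)
  | apply: (subringD sT) | apply: (subringN sT) | apply: (subringX sT)
  | exact: (subring1 sT) ].

(* For [W ^+ 2 = r * u * (r + u * w)] the functions below are [h = W / r],
   [U = u / h ^+ 2], [X j = h ^+ j.+1 / r], [Y j = r / h ^+ j], [rho = r / u ^+ 3],
   [om = W / u ^+ 3], [sig = u ^+ 4 / W], [tau = sig^-1], and [U (rho + b + s) = rho]. *)
Section Charts.
Variables (k : closedFieldType) (L : fieldType) (iota : {rmorphism k -> L}).
Variables (eta c0 b del : k) (r u W h U rho om sig tau kap s : L) (X Y : nat -> L).
Hypothesis b0 : b != 0.
Hypotheses (hW : W = h * r) (hu : u = h ^+ 2 * U)
  (hXY : forall j, X j * Y j = h) (hXS : forall j, X j.+1 = h * X j)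
  (hYS : forall j, Y j = h * Y j.+1) (hXY1 : forall j, X j * Y j.+1 = 1)
  (hY0 : Y 0 = r)
  (hU : U * (1 + (iota eta * u * h + iota c0 * r * u + iota b * (U ^+ 3 * X 5)
                 + iota del * u ^+ 2)) = 1)
  (hrho : rho * (U ^+ 3 * X 5) = 1) (hom : om = h * rho) (hsig : sig = h * U ^+ 4 * X 5)
  (hst : sig * tau = 1) (huos : u = om * sig) (hout : om = u * tau)
  (hosk : om = sig * kap) (hkap : kap = rho * (rho + iota b + s))
  (hkt : kap = u * tau ^+ 2) (hUr : U * (rho + iota b + s) = rho)
  (hrr : r = rho * u ^+ 3) (hWo : W = om * u ^+ 3)
  (hs : s = u * (iota eta * om + iota c0 * rho ^+ 2 * u ^+ 3 + iota del * rho * u)).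

(** In charts 0 to 5, [h = X i * Y i] and [r = X i ^+ i * Y i ^+ i.+1] are monomials, and [U] is a
    root of the equation [hU]. Chart 6 is the hypersurface [om = sig * kap]. Chart 7 has the
    equation [kap = u * tau ^+ 2], with [u] already in [O]. *)
Definition chart (i : nat) : seq L :=
  if (i < 6)%N then [:: X i; Y i; U]
  else if i == 6 then [:: sig; rho; om] else [:: tau; rho].

Lemma chart_lowP (T : L -> Prop) i : (i < 6)%N ->
  (forall g, g \in chart i -> T g) <-> [/\ T (X i), T (Y i) & T U].
Proof.
rewrite /chart => ->; split=> [H|[h1 h2 h3] g]; first by split; apply: H; rewrite !inE eqxx ?orbT.
by rewrite !inE => /or3P [] /eqP->.
Qed.

Lemma chart6P (T : L -> Prop) :
  (forall g, g \in chart 6 -> T g) <-> [/\ T sig, T rho & T om].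
Proof.
rewrite /chart /=; split=> [H|[h1 h2 h3] g]; first by split; apply: H; rewrite !inE eqxx ?orbT.
by rewrite !inE => /or3P [] /eqP->.
Qed.

Lemma chart7P (T : L -> Prop) :
  (forall g, g \in chart 7 -> T g) <-> T tau /\ T rho.
Proof.
rewrite /chart /=; split=> [H|[h1 h2] g]; first by split; apply: H; rewrite !inE eqxx ?orbT.
by rewrite !inE => /orP [] /eqP->.
Qed.

Lemma chart_cases i : (i < 8)%N -> [\/ (i < 6)%N, i = 6 | i = 7].
Proof.
move=> hi; case: (ltnP i 6) => h6; first by constructor 1.
move: h6 hi; case: i => [|[|[|[|[|[|[|[|i]]]]]]]] // _ _; [by constructor 2 | by constructor 3].
Qed.

Lemma XD j d : X (j + d) = h ^+ d * X j.
Proof.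
by elim: d => [|d IH]; [rewrite addn0 expr0 mul1r | rewrite addnS hXS IH exprS mulrA].
Qed.

Lemma YD j d : Y j = h ^+ d * Y (j + d).
Proof.
elim: d => [|d IH]; first by rewrite addn0 expr0 mul1r.
by rewrite IH addnS exprSr -mulrA -hYS.
Qed.

Lemma Xsub i j : (i <= j)%N -> X j = h ^+ (j - i) * X i.
Proof. by move=> hij; rewrite -XD subnKC. Qed.

Lemma Ysub i j : (i <= j)%N -> Y i = h ^+ (j - i) * Y j.
Proof. by move=> hij; rewrite {1}(YD i (j - i)) subnKC. Qed.

Lemma invX j : (X j)^-1 = Y j.+1. Proof. exact: mul1_inv. Qed.
Lemma invY j : (Y j.+1)^-1 = X j. Proof. by apply: mul1_inv; rewrite mulrC. Qed.
Lemma invrho : rho^-1 = U ^+ 3 * X 5. Proof. exact: mul1_inv. Qed.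
Lemma invsig : sig^-1 = tau. Proof. exact: mul1_inv. Qed.
Lemma invtau : tau^-1 = sig. Proof. by apply: mul1_inv; rewrite mulrC. Qed.
Lemma invU : U^-1 = 1 + (iota eta * u * h + iota c0 * r * u + iota b * (U ^+ 3 * X 5)
                 + iota del * u ^+ 2).
Proof. exact: mul1_inv. Qed.
Lemma rho_neq0 : rho != 0.
Proof. by apply: contraNneq (oner_neq0 L) => r0; rewrite -hrho r0 mul0r. Qed.
Lemma sig_neq0 : sig != 0.
Proof. by apply: contraNneq (oner_neq0 L) => r0; rewrite -hst r0 mul0r. Qed.
Lemma U_neq0 : U != 0.
Proof. by apply: contraNneq (oner_neq0 L) => r0; rewrite -hU r0 mul0r. Qed.
Lemma X_neq0 j : X j != 0.
Proof. by apply: contraNneq (oner_neq0 L) => r0; rewrite -(hXY1 j) r0 mul0r. Qed.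
Lemma u_neq0 : u != 0.
Proof.
move: sig_neq0; rewrite hsig mulf_eq0 negb_or mulf_eq0 negb_or => /andP [/andP [h0 _] _].
by rewrite hu mulf_neq0 ?expf_neq0 ?U_neq0.
Qed.
Lemma kap_neq0 : kap != 0.
Proof. by apply: contraNneq u_neq0 => k0; rewrite huos hosk k0 mulr0 mul0r. Qed.
Lemma invU_rho : U^-1 = (rho + iota b + s) * rho^-1.
Proof. by apply: mul1_inv; rewrite mulrA hUr divff // rho_neq0. Qed.

Variable O : L -> Prop.
Hypothesis lO : local_subring O.
Hypothesis Oc : forall c, O (iota c).
Hypotheses (Or : nonunit O r) (Ou : nonunit O u) (OW : nonunit O W).

Section Membership.
Variable T : L -> Prop.
Hypotheses (sT : subring T) (OT : sub_set O T).

Lemma mem_iota c : T (iota c). Proof. exact: OT. Qed.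
Lemma mem_r : T r. Proof. by apply: OT; case: Or. Qed.
Lemma mem_u : T u. Proof. by apply: OT; case: Ou. Qed.
Lemma mem_W : T W. Proof. by apply: OT; case: OW. Qed.
Lemma mem_s : T om -> T rho -> T s.
Proof.
by move=> h1 h2; rewrite hs; have := mem_u; have := mem_iota; mem sT.
Qed.
Lemma mem_h i : T (X i) -> T (Y i) -> T h.
Proof. by move=> h1 h2; rewrite -(hXY i); mem sT. Qed.
Lemma mem_X5 i : (i < 6)%N -> T (X i) -> T (Y i) -> T (X 5).
Proof. by move=> hi h1 h2; rewrite (Xsub (i := i)) //; have := mem_h h1 h2; mem sT. Qed.
End Membership.

(** * The valuative criterion for the eight charts *)

Section Separated.
Variables (F T : L -> Prop).
Hypotheses (sF : subring F) (OF : sub_set O F) (sT : subring T).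
Hypothesis invF : forall x, T x -> F x^-1 -> F x.

Lemma separated_up i j : (i < j)%N -> F (X i) -> F (Y i) -> T (Y j) -> F (X j) /\ F (Y j).
Proof.
case: j => // j; rewrite ltnS => hij h1 h2 h3; have Fh : F h by exact: mem_h h1 h2.
split; first by rewrite (Xsub (i := i)) ?leqW //; mem sF.
by apply: invF => //; rewrite invY (Xsub hij); mem sF.
Qed.

Lemma separated_down i j : (j < i)%N -> F (X i) -> F (Y i) -> T (X j) -> F (X j) /\ F (Y j).
Proof.
move=> hij h1 h2 h3; have Fh : F h by exact: mem_h h1 h2.
split; last by rewrite (Ysub (ltnW hij)); mem sF.
by apply: invF => //; rewrite invX (Ysub hij); mem sF.
Qed.

Lemma separated_rho i : (i < 6)%N -> F (X i) -> F (Y i) -> F U -> T rho -> F rho.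
Proof.
move=> hi h1 h2 h3 h4; apply: invF => //; rewrite invrho.
by have := mem_X5 sF hi h1 h2; mem sF.
Qed.

Lemma separated_sig i : (i < 6)%N -> F (X i) -> F (Y i) -> F U -> F sig.
Proof.
move=> hi h1 h2 h3; rewrite hsig.
by have := mem_X5 sF hi h1 h2; have := mem_h sF h1 h2; mem sF.
Qed.

Lemma separated_low j : (j < 6)%N -> F rho -> F om ->
  T (X j) -> T (Y j) -> T U -> [/\ F (X j), F (Y j) & F U].
Proof.
move=> hj h1 h2 h3 h4 h5.
have FV : F rho^-1.
  apply: invF; last by rewrite invrK.
  by rewrite invrho; have := mem_X5 sT hj h3 h4; mem sT.
have Fh : F h.
  have -> : h = om * rho^-1 by rewrite hom mulfK // rho_neq0.
  by mem sF.
have FU : F U.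
  apply: invF => //; rewrite invU_rho.
  have := mem_s sF OF h2 h1; have := mem_iota OF b; mem sF.
(* [Y 6], the inverse of [X 5], lies one step beyond the last low chart: every [Y j] and every
   inverse [Y j.+1] of an [X j] with [j < 6] is a power of [h] times [Y 6]. *)
have FY6 : F (Y 6).
  have -> : Y 6 = U ^+ 3 * rho.
    rewrite -invX; apply: mul1_inv; rewrite -hrho; ring.
  by mem sF.
split=> //; last by rewrite (Ysub (j := 6)) 1?ltnW //; mem sF.
by apply: invF => //; rewrite invX (Ysub (j := 6)) //; mem sF.
Qed.

(** [F] stands for the localization of chart [i] at the centre of [T]. Each generator of chart [j]
    or its inverse is polynomial in elements already known to lie in [F], and [invF] handles the
    inverses. *)
Lemma separated i j : (i < 8)%N -> (j < 8)%N ->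
  (forall g, g \in chart i -> F g) -> (forall g, g \in chart j -> T g) ->
  forall g, g \in chart j -> F g.
Proof.
move=> hi hj; case: (chart_cases hi) => [li|->|->]; case: (chart_cases hj) => [lj|->|->].
- move=> /(chart_lowP F li) [h1 h2 h3] /(chart_lowP T lj) [h4 h5 h6].
  apply/(chart_lowP F lj).
  case: (ltngtP i j) => hij; last by subst j.
    by have [] := separated_up hij h1 h2 h5.
  by have [] := separated_down hij h1 h2 h4.
- move=> /(chart_lowP F li) [h1 h2 h3] /chart6P [h4 h5 h6]; apply/chart6P.
  have h7 := separated_rho li h1 h2 h3 h5; split=> //; first exact: (separated_sig li h1 h2 h3).
  by rewrite hom; have := mem_h sF h1 h2; mem sF.
- move=> /(chart_lowP F li) [h1 h2 h3] /chart7P [h4 h5]; apply/chart7P.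
  split; last exact: (separated_rho li h1 h2 h3 h5).
  by apply: invF => //; rewrite invtau; exact: (separated_sig li h1 h2 h3).
- move=> /chart6P [h1 h2 h3] /(chart_lowP T lj) [h4 h5 h6]; apply/(chart_lowP F lj).
  exact: separated_low.
- by [].
- move=> /chart6P [h1 h2 h3] /chart7P [h4 h5]; apply/chart7P; split=> //.
  by apply: invF => //; rewrite invtau.
- move=> /chart7P [h1 h2] /(chart_lowP T lj) [h4 h5 h6]; apply/(chart_lowP F lj).
  by apply: separated_low => //; rewrite hout; have := mem_u OF; mem sF.
- move=> /chart7P [h1 h2] /chart6P [h4 h5 h6]; apply/chart6P; split=> //.
    by apply: invF => //; rewrite invsig.
  by rewrite hout; have := mem_u OF; mem sF.
- by [].
Qed.
End Separated.

(** If [x^-1] lies in [V], so does [x = p * x^-1 + q]. *)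
Lemma valuation_integral (V : L -> Prop) x p q : valuation_ring V -> V p -> V q ->
  x ^+ 2 = p + q * x -> V x.
Proof.
move=> vV Vp Vq e; have [sV tV] := vV; case: (tV x) => // Vx.
have [->|x0] := eqVneq x 0; first exact: subring0.
have -> : x = p * x^-1 + q.
  by apply: (mulIf x0); rewrite mulrDl mulfVK // -expr2.
mem sV.
Qed.

(** The size of [r] against [u ^+ 3] decides. If [rho] is in [V], then [om] is integral by
    [om ^+ 2 = u * kap], where [kap] is linear in [om], and [tau] or [sig] selects chart 7 or 6.
    Otherwise [u] is a nonunit, [h] is integral, [U] is a unit and one of the low charts works. *)
Lemma covered (V : L -> Prop) : valuation_ring V -> sub_set O V ->
  exists2 i, (i < 8)%N & forall g, g \in chart i -> V g.
Proof.
move=> vV OV; have [sV tV] := vV; have lV := valuation_local vV.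
have Vu := mem_u OV; have Vr := mem_r OV; have Vc := mem_iota OV.
case: (classic (V rho)) => [Vrho|nrho].
  have Vom : V om.
    apply: (@valuation_integral V om
      (u * rho * (rho + iota b + u * (iota c0 * rho ^+ 2 * u ^+ 3 + iota del * rho * u)))
      (u * rho * u * iota eta)) => //; try by mem sV.
    have -> : om ^+ 2 = u * kap by rewrite expr2 {2}hosk mulrA -huos.
    rewrite hkap hs; ring.
  case: (tV tau) => ht.
    by exists 7 => //; apply/chart7P.
  by exists 6 => //; apply/chart6P; rewrite -invtau.
have nrv : nonunit V rho^-1 by apply: valuation_inv => //; exact: rho_neq0.
have nu : nonunit V u.
  case: (unit_or_nonunit Vu) => // uu; case: nrho.
  have [u0 _ Viu] := uu; have [Vrv _] := nrv.
  have -> : rho = r * u^-1 ^+ 3.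
    by rewrite hrr -mulrA -exprMn divff // expr1n mulr1.
  by mem sV.
pose th := 1 + (iota c0 * r * u + iota b * rho^-1 + iota del * u ^+ 2).
have uth : unit_of V th.
  apply: (unit_ofD lV (unit_of1 sV)).
  apply: (nonunitD lV); first apply: (nonunitD lV).
  - by apply: (nonunitMl sV) => //; mem sV.
  - exact: (nonunitMl sV).
  - by apply: (nonunitMl sV) => //; exact: (nonunitX sV).
(* This is [h ^+ 2 = u / U] with [U^-1] expanded by [hU]; the only term of [U^-1] containing [h]
   apart from [rho^-1] is linear, so [h] satisfies a monic quadratic equation over [V]. *)
have h2 : h ^+ 2 = u * th + iota eta * u ^+ 2 * h.
  have -> : u * th + iota eta * u ^+ 2 * h =
     h ^+ 2 * (U * (1 + (iota eta * u * h + iota c0 * r * u + iota b * (U ^+ 3 * X 5)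
                 + iota del * u ^+ 2))).
    rewrite mulrA -hu /th invrho; ring.
  by rewrite hU mulr1.
have [th0 Vth Vthv] := uth.
have Vh : V h by apply: (valuation_integral vV _ _ h2); mem sV.
have nh : nonunit V h.
  apply: (nonunit_expr sV (n := 2)) => //; rewrite h2; apply: (nonunitD lV).
    exact: (nonunitMr sV).
  apply: (nonunitMr sV) => //; apply: (nonunitMl sV) => //; exact: (nonunitX sV).
have uU : unit_of V U.
  rewrite -[U]invrK invU -invrho; apply: unit_ofV.
  have -> : 1 + (iota eta * u * h + iota c0 * r * u + iota b * rho^-1 + iota del * u ^+ 2)
     = th + iota eta * u * h by rewrite /th; ring.
  by apply: (unit_ofD lV) => //; apply: (nonunitMl sV) => //; mem sV.
have [_ VU VUv] := uU.
have VX5 : V (X 5).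
  have -> : X 5 = rho^-1 * U^-1 ^+ 3.
    by rewrite invrho mulrAC -exprMn divff ?U_neq0 // expr1n mul1r.
  by case: nrv => Vrv _; mem sV.
(* Start from [Y 0 = r]. If [Y n.+1] is not in [V], its inverse [X n] is, and chart [n] is found. If
   all [Y n] up to 5 are in [V], chart 5 works, since [X 5] is in [V] already. *)
have H n : (n <= 5)%N -> V (Y n) \/ exists2 i, (i < n)%N & V (X i) /\ V (Y i).
  elim: n => [|n IH] hn; first by left; rewrite hY0.
  case: (IH (ltnW hn)) => [VY|[i hi hXYi]]; last by right; exists i => //; rewrite ltnS ltnW.
  case: (tV (Y n.+1)); first by left.
  by rewrite invY => VX; right; exists n.
case: (H 5 isT) => [VY|[i hi [VX VY]]].
  by exists 5 => //; apply/chart_lowP.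
by exists i; [apply: leq_trans hi _ | apply/chart_lowP => //; exact: leq_trans hi _].
Qed.

(** Away from the origin the coordinates are fractions with invertible denominators: in a low chart
    [r] is a unit as soon as one of [r], [u], [W] is, and in charts 6 and 7 the same holds for
    [u]. *)
Lemma outside (F R : L -> Prop) i : (i < 8)%N -> subring F -> local_subring R -> sub_set O F -> sub_set F R ->
  (forall x, F x -> unit_of R x -> F x^-1) ->
  (forall x, R x -> F x^-1 -> F x) ->
  (forall g, g \in chart i -> R g) ->
  [\/ unit_of R r, unit_of R u | unit_of R W] ->
  forall g, g \in chart i -> F g.
Proof.
move=> hi sF lR OF FR unF invF; have sR := proj1 lR.
have Fr := mem_r OF; have Fu := mem_u OF; have FW := mem_W OF; have Fc := mem_iota OF.
have Ru := FR _ Fu; have Rr := FR _ Fr; have RW := FR _ FW.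
case: (chart_cases hi) => [li|->|->].
- move=> /(chart_lowP R li) [RX RY RU] hun; apply/(chart_lowP F li).
  have Rh := mem_h sR RX RY.
  have ur : unit_of R r.
    case: hun => // [uu|uW].
      have uh : unit_of R h.
        apply: (unit_of_expr sR (n := 1)) => //; apply: (unit_of_mull sR _ RU); first by mem sR.
        by rewrite -hu.
      have uY : unit_of R (Y i) by apply: (unit_of_mulr sR RX RY); rewrite hXY.
      rewrite -hY0 (Ysub (leq0n i)); apply: unit_ofM => //; exact: unit_ofX.
    by apply: (unit_of_mulr sR Rh) => //; rewrite -hW.
  have [r0 _ _] := ur; have Frv := unF _ Fr ur.
  have Fh : F h by rewrite -[h](mulfK r0) -hW; mem sF.
  have FU : F U.
    apply: invF => //; rewrite invU.
    have -> : U ^+ 3 * X 5 = u ^+ 3 * r^-1.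
      rewrite -invrho; apply: (mulfI rho_neq0); rewrite divff ?rho_neq0 //.
      by rewrite mulrA -hrr divff.
    by mem sF; exact: (subring1 sF).
  have h0 : h != 0.
    apply: contraNneq (X_neq0 1) => h0; by rewrite hXS h0 mul0r.
  have FX j : F (X j).
    have -> : X j = h ^+ j.+1 * r^-1.
      rewrite -hY0; apply: (mulIf (x := Y 0)); first by rewrite hY0.
      rewrite mulfVK ?hY0 // -hY0 (Xsub (leq0n j)) subn0 -mulrA hXY exprSr //.
    by mem sF.
  split=> //; case: i RY {li hi RX} => [|i] RY; first by rewrite hY0.
  by apply: invF => //; rewrite invY.
- move=> /chart6P [Rs Rrho Rom] hun; apply/chart6P.
  have uu : unit_of R u.
    apply: (unit_of_expr sR (n := 2)) => //; case: hun => [ur|uu|uW].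
    + by apply: (unit_of_mulr sR Rrho); [mem sR | rewrite -hrr].
    + exact: unit_ofX.
    + by apply: (unit_of_mulr sR Rom); [mem sR | rewrite -hWo].
  have [u0 _ _] := uu; have Fuv := unF _ Fu uu.
  have Fom : F om.
    have -> : om = W * u^-1 ^+ 3 by rewrite hWo -mulrA -exprMn divff // expr1n mulr1.
    by mem sF.
  split=> //.
    apply: invF => //; rewrite invsig.
    by have -> : tau = om * u^-1; [rewrite hout mulrC mulKf | mem sF].
  have -> : rho = r * u^-1 ^+ 3 by rewrite hrr -mulrA -exprMn divff // expr1n mulr1.
  by mem sF.
- move=> /chart7P [Rtau Rrho] hun; apply/chart7P.
  have Rom : R om by rewrite hout; mem sR.
  have uu : unit_of R u.
    apply: (unit_of_expr sR (n := 2)) => //; case: hun => [ur|uu|uW].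
    + by apply: (unit_of_mulr sR Rrho); [mem sR | rewrite -hrr].
    + exact: unit_ofX.
    + by apply: (unit_of_mulr sR Rom); [mem sR | rewrite -hWo].
  have [u0 _ _] := uu; have Fuv := unF _ Fu uu.
  split.
    have -> : tau = W * u^-1 ^+ 4.
      rewrite hWo hout.
      have -> : u * tau * u ^+ 3 * u^-1 ^+ 4 = tau * (u / u) ^+ 4 by ring.
      by rewrite divff // expr1n mulr1.
    by mem sF.
  have -> : rho = r * u^-1 ^+ 3 by rewrite hrr -mulrA -exprMn divff // expr1n mulr1.
  by mem sF.
Qed.

Local Notation pe P t := (map_poly iota P).[t].

(* The exceptional curve number n has the equation [cz n = 0], the local equation
   [eqn n] and the coordinate [par n] in the chart [mainc n]; its remaining point,
   [par n = oo], is the point [pari n = zi n = 0] of the chart [infc n], where [eqi n]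
   is a local equation and [pari n] the coordinate.  The curves 6 and 7 are [rho = 0] and
   [rho = - b] in chart 6, hence the values of [bet]. *)
Definition mainc (n : nat) := if (n < 5)%N then n.+1 else 6.
Definition eqn (n : nat) := if (n < 5)%N then X n.+1 else if n == 5 then sig else kap.
Definition par (n : nat) := if (n < 5)%N then Y n.+1 else if n == 5 then rho else sig.
Definition bet (n : nat) : k := if n == 6 then 0 else - b.
Definition cz (n : nat) := if (n < 5)%N then X n.+1 else if n == 5 then sig else rho - iota (bet n).
Definition infc (n : nat) := if (n < 6)%N then n else 7.
Definition eqi (n : nat) := if (n < 6)%N then Y n else u.
Definition pari (n : nat) := if (n < 5)%N then X n else if n == 5 then U ^+ 3 * X 5 else tau.
Definition zi (n : nat) := if (n < 6)%N then Y n else rho - iota (bet n).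

(** A single case distinction (chain, branching curve, two ends) replaces all eight functions of [n]
    at once. *)
Variant curve_index (n : nat) : nat -> L -> L -> L -> nat -> L -> L -> L -> Prop :=
  | CurveChain of (n < 5)%N : curve_index n n.+1 (X n.+1) (Y n.+1) (X n.+1) n (Y n) (X n) (Y n)
  | CurveNode of n = 5 : curve_index n 6 sig rho sig 5 (Y 5) (U ^+ 3 * X 5) (Y 5)
  | CurveEnd of (n == 6) || (n == 7) : curve_index n 6 kap sig (rho - iota (bet n)) 7 u tau
      (rho - iota (bet n)).

Lemma curve_indexP n : (n < 8)%N ->
  curve_index n (mainc n) (eqn n) (par n) (cz n) (infc n) (eqi n) (pari n) (zi n).
Proof.
rewrite /mainc /eqn /par /cz /infc /eqi /pari /zi => hn.
case: (ltnP n 5) => h5; first by rewrite ltnW //; constructor.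
have [->|h5'] := eqVneq n 5; first exact: CurveNode.
have : (n == 6) || (n == 7).
  by move: h5 h5' hn; case: n => [|[|[|[|[|[|[|[|n]]]]]]]].
by case/orP=> /eqP->; constructor.
Qed.

Definition over_point (T : L -> Prop) : Prop := [/\ local_subring T, sub_set O T &
  [/\ nonunit T r, nonunit T u & nonunit T W]].
Definition contains (T : L -> Prop) i : Prop := forall g, g \in chart i -> T g.

Lemma contains_low (T : L -> Prop) i : (i < 6)%N ->
  contains T i <-> [/\ T (X i), T (Y i) & T U].
Proof. exact: chart_lowP. Qed.

(** * Congruences modulo the local equations of the curves *)

Section Ideals.
Variables (T : L -> Prop) (e : L).
Hypothesis oT : over_point T.
Let lT : local_subring T. Proof. by case: oT. Qed.
Let sT : subring T. Proof. by case: lT. Qed.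
Let OT : sub_set O T. Proof. by case: oT. Qed.
Let Tc c : T (iota c). Proof. exact: OT. Qed.
Let Tr : T r. Proof. exact: mem_r. Qed.
Let Tu : T u. Proof. exact: mem_u. Qed.
Let nu : nonunit T u. Proof. by case: oT => _ _ []. Qed.

(** [d] is the restriction of [X 5] to the curve: 0 along the chain, [X 5] itself along curve 5.
    Everything else in [hU] contains [h] or [u], so that equation becomes [(1 + b U^3 d) U = 1]. *)
Lemma ideal_low i d : (i < 6)%N -> contains T i -> in_ideal T e h ->
  in_ideal T e (X 5 - d) -> T d ->
  [/\ in_ideal T e u, in_ideal T e W &
      in_ideal T e ((1 + iota b * (U ^+ 3 * d)) * U - 1)].
Proof.
move=> li /(contains_low _ li) [TX TY TU] eh eX5 Td.
have eu : in_ideal T e u.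
  by rewrite hu expr2 -mulrA; apply: in_idealMr => //; apply: subringM => //; exact: mem_h TX TY.
have eW : in_ideal T e W by rewrite hW; exact: in_idealMr.
split=> //.
have -> : (1 + iota b * (U ^+ 3 * d)) * U - 1 =
  - U * (iota eta * u * h + iota c0 * r * u + iota b * U ^+ 3 * (X 5 - d) + iota del * u ^+ 2)
  by rewrite -[X in _ - X]hU; ring.
apply: in_idealMl => //; first exact: subringN.
apply: (in_idealD sT); first apply: (in_idealD sT); first apply: (in_idealD sT).
- by apply: in_idealMl => //; mem sT.
- by apply: in_idealMl => //; mem sT.
- by apply: in_idealMl => //; mem sT.
- by apply: in_idealMl => //; rewrite expr2; apply: in_idealMr.
Qed.

Lemma ideal_s : in_ideal T e u -> T om -> T rho -> in_ideal T e s.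
Proof. by move=> eu To Tr'; rewrite hs; apply: in_idealMr => //; mem sT. Qed.

Lemma nonunit_s : T om -> T rho -> nonunit T s.
Proof. by move=> To Tr'; rewrite hs; apply: nonunitMr => //; mem sT. Qed.

(** In [kap = rho * (rho + b + s)] the term [s] is a multiple of [u], and near [rho = bet n] the
    other factor is a unit because [b] is nonzero. So [kap] can replace [rho - bet n] as local
    equation. *)
Lemma ideal_rho n : (n == 6) || (n == 7) -> T om -> T rho -> nonunit T (rho - iota (bet n)) ->
  in_ideal T e u -> in_ideal T e kap -> in_ideal T e (rho - iota (bet n)).
Proof.
move=> hn To Tr' nz eu ek; have ns := nonunit_s To Tr'; have es := ideal_s eu To Tr'.
have Ts : T s by case: ns.
case/orP: hn nz => /eqP->; rewrite /bet /=.
  rewrite rmorph0 subr0 => nz; apply: (in_ideal_div sT (v := rho + iota b + s)); last first.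
    by rewrite mulrC -hkap.
  rewrite (addrC rho) -addrA; apply: (unit_ofD lT) => //; first exact: unit_iota.
  exact: nonunitD.
rewrite rmorphN opprK => nz.
have ur : unit_of T rho.
  apply: (unit_congr lT (y := - iota b)); first by rewrite opprK.
  by apply: unit_ofN => //; exact: unit_iota.
rewrite -(addrK s (rho + iota b)); apply: in_idealB => //.
by apply: (in_ideal_div sT ur); rewrite -hkap.
Qed.
End Ideals.

(** [T] lies over the origin, in the main chart, and on curve [n]. Closed points and the generic
    point are treated together; [cond_inf] is the analogue in the second chart. *)
Definition cond_main n T := [/\ over_point T, contains T (mainc n) & nonunit T (cz n)].
Definition cond_inf n T := [/\ over_point T, contains T (infc n) & nonunit T (zi n)].

Lemma over_local T : over_point T -> local_subring T. Proof. by case. Qed.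
Lemma over_iota T c : over_point T -> T (iota c). Proof. by case=> _ OT _; exact: OT. Qed.

Lemma ideal_main T n : (n < 8)%N -> cond_main n T ->
  [/\ T (par n), nonunit T (eqn n), in_ideal T (eqn n) r, in_ideal T (eqn n) u &
      in_ideal T (eqn n) W] /\ in_ideal T (eqn n) (cz n).
Proof.
rewrite /cond_main => hn; case: (curve_indexP hn) => [h5|n5|hn'] [oT hc nz];
  have lT := over_local oT; have sT := proj1 lT; have [_ OT [nr nu nW]] := oT.
- have /contains_low [//|TX TY TU] := hc; have Th := mem_h sT TX TY.
  have eh : in_ideal T (X n.+1) h by exists (Y n.+1).
  have eX5 : in_ideal T (X n.+1) (X 5 - 0).
    by rewrite subr0 (Xsub h5) mulrC; apply: in_idealMr; [|exact: in_ideal_self|mem sT].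
  have [//|eu eW _] := ideal_low oT _ hc eh eX5 (subring0 sT).
  split=> //; last exact: in_ideal_self.
  split=> //; rewrite -hY0 (Ysub (leq0n n.+1)) subn0 exprS -mulrA; apply: in_idealMr => //.
  mem sT.
- move/chart6P: hc => [Ts Tr To].
  have eu : in_ideal T sig u by exists om => //; rewrite mulrC.
  have eu3 : in_ideal T sig (u ^+ 3).
    by rewrite exprS; apply: in_idealMr => //; apply: subringX => //; case: nu.
  split; last exact: in_ideal_self.
  by split=> //; [rewrite hrr | rewrite hWo]; apply: in_idealMl.
- move/chart6P: hc => [Ts Tr To]; have Tc := mem_iota OT.
  have Tss : T s by exact: (mem_s sT OT).
  have Tk : T kap by rewrite hkap; mem sT.
  have eo : in_ideal T kap om by exists sig => //; rewrite mulrC.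
  have eu : in_ideal T kap u by rewrite huos; exact: in_idealMr.
  have ek : in_ideal T kap kap by exact: in_ideal_self.
  have eu3 : in_ideal T kap (u ^+ 3).
    by rewrite exprS; apply: in_idealMr => //; apply: subringX => //; case: nu.
  have ez := ideal_rho oT hn' To Tr nz eu ek.
  split=> //; split=> //; try by [rewrite hrr; apply: in_idealMl | rewrite hWo; apply: in_idealMl].
  have ns := nonunit_s oT To Tr.
  case/orP: hn' nz => /eqP->; rewrite /bet /= ?rmorph0 ?subr0 ?rmorphN ?opprK => nz; rewrite hkap.
    by apply: nonunitMr => //; mem sT.
  by apply: nonunitMl => //; exact: nonunitD.
Qed.

(** [P] is the restriction of [g] to the curve, for instance 1 for [U] on the chain and [bet n] for
    [rho] on an end curve. It does not depend on [T], which allows two local rings to be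
    compared. *)
Lemma congr_main n g : (n < 8)%N -> g \in chart (mainc n) ->
  exists P, forall T, cond_main n T -> in_ideal T (eqn n) (g - pe P (par n)).
Proof.
move=> hn; rewrite /cond_main.
have H T : cond_main n T -> _ := ideal_main hn.
move: H; rewrite /cond_main; case: (curve_indexP hn) => [h5|n5|hn'] H.
- rewrite {1}/chart ltnS h5 !inE => /or3P [] /eqP->.
  + exists 0 => T /H [[_ _ _ _ _] e]; by rewrite pe0 subr0.
  + by exists 'X => T [oT _ _]; rewrite peX subrr; apply: in_ideal0; case: oT => [[]].
  + exists 1 => T [oT hc nz]; rewrite pe1.
    have lT := over_local oT; have sT := proj1 lT.
    have /contains_low [//|TX TY TU] := hc; have Th := mem_h sT TX TY.
    have eh : in_ideal T (X n.+1) h by exists (Y n.+1).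
    have eX5 : in_ideal T (X n.+1) (X 5 - 0).
      by rewrite subr0 (Xsub h5) mulrC; apply: in_idealMr; [|exact: in_ideal_self|mem sT].
    have [//|_ _] := ideal_low oT _ hc eh eX5 (subring0 sT).
    by rewrite !mulr0 addr0 mul1r.
- rewrite /chart /= !inE => /or3P [] /eqP->.
  + exists 0 => T /H [[_ _ _ _ _] e]; by rewrite pe0 subr0.
  + by exists 'X => T [oT _ _]; rewrite peX subrr; apply: in_ideal0; case: oT => [[]].
  + exists 0 => T [oT /chart6P [Ts Tr To] nz]; rewrite pe0 subr0.
    have lT := over_local oT; have sT := proj1 lT; have [_ OT _] := oT.
    have Tc := mem_iota OT; have Tss : T s by exact: (mem_s sT OT).
    by exists kap => //; rewrite hkap; mem sT.
- rewrite /chart /= !inE => /or3P [] /eqP->.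
  + by exists 'X => T [oT _ _]; rewrite peX subrr; apply: in_ideal0; case: oT => [[]].
  + exists (bet n)%:P => T /H [[_ _ _ _ _] e]; by rewrite peC.
  + exists 0 => T [oT /chart6P [Ts Tr To] nz]; rewrite pe0 subr0.
    by exists sig => //; rewrite mulrC.
Qed.

Lemma ideal_inf T n : (n < 8)%N -> cond_inf n T ->
  [/\ T (pari n), nonunit T (eqi n), in_ideal T (eqi n) r, in_ideal T (eqi n) u &
      in_ideal T (eqi n) W].
Proof.
rewrite /cond_inf => hn; case: (curve_indexP hn) => [h5|n5|hn'] [oT hc nz];
  have lT := over_local oT; have sT := proj1 lT; have [_ OT [nr nu nW]] := oT.
- have /contains_low [|TX TY TU] := hc; first by exact: ltnW.
  have Th := mem_h sT TX TY.
  have eh : in_ideal T (Y n) h by exists (X n) => //; rewrite mulrC.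
  have eX5 : in_ideal T (Y n) (X 5 - 0).
    rewrite subr0 (Xsub (ltnW h5)) -(subnKC h5) addSn -addnS addKn exprS -mulrA.
    by apply: in_idealMr => //; mem sT.
  have [|eu eW _] := ideal_low oT _ hc eh eX5 (subring0 sT); first exact: ltnW.
  split=> //; rewrite -hY0 (Ysub (leq0n n)); apply: in_idealMl => //; [mem sT|exact: in_ideal_self].
- have /contains_low [//|TX TY TU] := hc; have Th := mem_h sT TX TY.
  have eh : in_ideal T (Y 5) h by exists (X 5) => //; rewrite mulrC.
  have eX5 : in_ideal T (Y 5) (X 5 - X 5) by rewrite subrr; exact: in_ideal0.
  have [//|eu eW _] := ideal_low oT _ hc eh eX5 TX.
  split=> //; first by mem sT.
  by rewrite -hY0 (Ysub (leq0n 5)); apply: in_idealMl => //; [mem sT|exact: in_ideal_self].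
- move/chart7P: hc => [Tt Tr]; have eu : in_ideal T u u by exact: in_ideal_self.
  have eu3 : in_ideal T u (u ^+ 3).
    by rewrite exprS; apply: in_idealMr => //; apply: subringX => //; case: nu.
  have To : T om by rewrite hout; apply: subringM => //; case: nu.
  by split=> //; [rewrite hrr | rewrite hWo]; apply: in_idealMl.
Qed.

(** The normalization [a.[0] = 1] makes the denominator a unit at the only point that is taken from
    this chart, [pari n = 0], as well as at the generic point. *)
Lemma congr_inf n g : (n < 8)%N -> g \in chart (infc n) ->
  exists a b : {poly k}, a.[0] = 1 /\
  forall T, cond_inf n T -> in_ideal T (eqi n) (pe a (pari n) * g - pe b (pari n)).
Proof.
move=> hn; rewrite /cond_inf.
have one : (1 : {poly k}).[0] = 1 by rewrite hornerC.
case: (curve_indexP hn) => [h5|n5|hn'].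
- rewrite {1}/chart leqW // !inE => /or3P [] /eqP->.
  + exists 1, 'X; split=> // T [oT _ _]; rewrite pe1 mul1r peX subrr.
    by apply: in_ideal0; case: oT => [[]].
  + exists 1, 0; split=> // T [oT _ _]; rewrite pe1 mul1r pe0 subr0.
    by apply: in_ideal_self; case: oT => [[]].
  + exists 1, 1; split=> // T [oT hc nz]; rewrite pe1 mul1r.
    have lT := over_local oT; have sT := proj1 lT.
    have /contains_low [|TX TY TU] := hc; first by exact: ltnW.
    have Th := mem_h sT TX TY.
    have eh : in_ideal T (Y n) h by exists (X n) => //; rewrite mulrC.
    have eX5 : in_ideal T (Y n) (X 5 - 0).
      rewrite subr0 (Xsub (ltnW h5)) -(subnKC h5) addSn -addnS addKn exprS -mulrA.
      by apply: in_idealMr => //; mem sT.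
    have [|_ _] := ideal_low oT _ hc eh eX5 (subring0 sT); first exact: ltnW.
    by rewrite !mulr0 addr0 mul1r.
- have key T : over_point T -> contains T 5 ->
    in_ideal T (Y 5) ((1 + iota b * (U ^+ 3 * X 5)) * U - 1).
    move=> oT hc; have lT := over_local oT; have sT := proj1 lT.
    have /contains_low [//|TX TY TU] := hc.
    have eh : in_ideal T (Y 5) h by exists (X 5) => //; rewrite mulrC.
    have eX5 : in_ideal T (Y 5) (X 5 - X 5) by rewrite subrr; exact: in_ideal0.
    by have [//|_ _] := ideal_low oT _ hc eh eX5 TX.
  rewrite {1}/chart /= !inE => /or3P [] /eqP->.
  (* With [t = U ^+ 3 * X 5] the curve satisfies [(1 + b t) U = 1], hence
     [X 5 = t * (1 + b t)^3]. *)
  + exists 1, ('X * (1 + b%:P * 'X) * (1 + b%:P * 'X) * (1 + b%:P * 'X)); split=> // T [oT hc nz].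
    have lT := over_local oT; have sT := proj1 lT; have Tc c : T (iota c) by exact: over_iota.
    have /contains_low [//|TX TY TU] := hc; have Th := mem_h sT TX TY.
    rewrite pe1 mul1r !peM !peD pe1 peM peC peX.
    have TUv : T U^-1.
      by have [_ OT _] := oT; have := mem_u OT; have := mem_r OT; rewrite invU; mem sT.
    set q := 1 + iota b * _.
    have -> : X 5 - U ^+ 3 * X 5 * q * q * q = - (U ^+ 3 * X 5 * U^-1 *
       (U^-1 ^+ 2 + q * U^-1 + q ^+ 2) * (q * U - 1)) by field; exact: U_neq0.
    apply: in_idealN => //; apply: in_idealMl => //; last exact: key.
    by rewrite /q; mem sT.
  + exists 1, 0; split=> // T [oT _ _]; rewrite pe1 mul1r pe0 subr0.
    by apply: in_ideal_self; case: oT => [[]].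
  + exists (1 + b%:P * 'X), 1; split; first by rewrite hornerD hornerM hornerX mulr0 addr0 one.
    move=> T [oT hc nz]; rewrite peD pe1 peM peC peX; exact: key.
- rewrite {1}/chart /= !inE => /orP [] /eqP->.
  + exists 1, 'X; split=> // T [oT _ _]; rewrite pe1 mul1r peX subrr.
    by apply: in_ideal0; case: oT => [[]].
  + exists 1, (bet n)%:P; split=> // T [oT hc nz]; rewrite pe1 mul1r peC.
    have lT := over_local oT; have sT := proj1 lT; have [_ OT [nr nu nW]] := oT.
    have Tu := mem_u OT; move/chart7P: hc => [Tt Tr].
    have eu : in_ideal T u u by exact: in_ideal_self.
    apply: ideal_rho => //; first by rewrite hout; mem sT.
    by rewrite hkt; apply: in_idealMr => //; mem sT.
Qed.

(** * Points of the model: properness, regularity, isomorphism away from the origin *)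

Hypothesis Om : forall x, O x -> exists c a1 a2 a3,
  [/\ O a1, O a2, O a3 & x = iota c + (r * a1 + u * a2 + W * a3)].

Let cA i := adjoin O (chart i).
Let A (i : 'I_8) := cA i.

Lemma chart_sub (T : L -> Prop) i : subring T -> sub_set O T -> contains T i -> sub_set (cA i) T.
Proof. exact: adjoin_min. Qed.

Lemma sub_chart (T : L -> Prop) i : sub_set (cA i) T -> sub_set O T /\ contains T i.
Proof.
by move=> hAT; split=> x hx; apply: hAT; [exact: adjoin_base | exact: adjoin_gen].
Qed.

Lemma over_sub (T : L -> Prop) i : over_point T -> contains T i -> sub_set (cA i) T.
Proof. by case=> lT OT _; apply: chart_sub => //; case: lT. Qed.

(** [separated] puts the generators of chart [j] into the localization of chart [i], where the
    denominators are invertible since they are units of [T]. By symmetry the local ring at the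
    centre of [T] is the same in all charts. *)
Lemma fracs_chart_sub T i j : (i < 8)%N -> (j < 8)%N -> local_subring T -> sub_set O T ->
  contains T i -> contains T j -> sub_set (fracs (cA j) T) (fracs (cA i) T).
Proof.
move=> hi hj lT OT ci cj; have sT := proj1 lT.
have siT := chart_sub sT OT ci; have sA : subring (cA i) by exact: adjoin_subring.
have sF : subring (fracs (cA i) T) by exact: fracs_subring.
have AF : sub_set (cA i) (fracs (cA i) T) by exact: fracs_base.
have OF : sub_set O (fracs (cA i) T) by move=> x Ox; apply: AF; exact: adjoin_base.
have FT : sub_set (fracs (cA i) T) T by exact: fracs_sub.
have AjF : sub_set (cA j) (fracs (cA i) T).
  apply: adjoin_min => //; apply: (separated sF OF sT _ hi hj) => //.
    by move=> x Tx; exact: fracs_inv.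
  by move=> g hg; apply: AF; exact: adjoin_gen.
move=> _ [x [y [Ax Ay uy ->]]]; apply: subringM => //; first exact: AjF.
by have [] := unit_ofV (fracs_unit lT siT (AjF _ Ay) uy).
Qed.

Lemma fracs_chart_eq T i j : (i < 8)%N -> (j < 8)%N -> local_subring T -> sub_set O T ->
  contains T i -> contains T j -> fracs (cA i) T = fracs (cA j) T.
Proof.
by move=> hi hj lT OT ci cj; apply: same_setE => x; split; apply: fracs_chart_sub.
Qed.

Lemma ptP R : pt A R -> [/\ local_subring R, sub_set O R &
  exists i, [/\ (i < 8)%N, contains R i & R = fracs (cA i) R]].
Proof.
move=> [i [p [pp /same_setE ->]]].
have sA : subring (cA i) by exact: adjoin_subring.
have /sub_chart [OR ci] : sub_set (cA i) (localization (cA i) p) by exact: localization_base.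
split=> //; first exact: localization_local.
by exists i; split=> //; exact: localization_fracs.
Qed.

Lemma fracs_pt T i : (i < 8)%N -> local_subring T -> sub_set O T -> contains T i ->
  pt A (fracs (cA i) T).
Proof.
move=> hi lT OT ci; exists (Ordinal hi), (fun x => cA i x /\ nonunit T x).
have siT := chart_sub (proj1 lT) OT ci; have sA : subring (cA i) by exact: adjoin_subring.
by split; [exact: fracs_prime | exact: fracs_localization].
Qed.

Lemma pt_fracs R i : (i < 8)%N -> pt A R -> contains R i -> R = fracs (cA i) R.
Proof.
move=> hi /ptP [lR OR [j [hj cj e]]] ci; rewrite {1}e; exact: fracs_chart_eq.
Qed.

Lemma charts_proper : proper_separated O A.
Proof.
move=> V vV OV; have lV := valuation_local vV; have sV := proj1 lV; split.
  have [i hi ci] := covered vV OV; exists (fracs (cA i) V); first exact: fracs_pt.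
  by apply: fracs_dominated => //; exact: chart_sub.
have key R : pt A R -> dominates V R -> exists2 i, (i < 8)%N /\ contains V i & R = fracs (cA i) V.
  move=> /ptP [lR OR [i [hi ci e]]] dR; have [RV _] := dR.
  have siR := chart_sub (proj1 lR) OR ci.
  exists i; first by split=> // g hg; apply: RV; exact: ci.
  rewrite {1}e; apply: same_setE => x; split=> -[y [z [Ay Az uz ->]]]; exists y, z; split=> //.
    exact: unit_of_sub uz.
  by apply: (dominates_unit dR) => //; exact: siR.
move=> R R' /key kR /key kR' /kR [i [hi ci] ->] /kR' [j [hj cj] ->].
by rewrite (fracs_chart_eq hi hj).
Qed.

(** A point that does not dominate [O] has [r], [u] or [W] invertible by [dominatesP]; then
    [outside] places its chart inside the localization of [O] at the trace of that point. *)
Lemma charts_iso : iso_outside O A.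
Proof.
move=> R pR nd; have [lR OR [i [hi ci e]]] := ptP pR; have sR := proj1 lR.
have sO := proj1 lO; exists (fun x => O x /\ nonunit R x).
split; first exact: fracs_prime.
rewrite -(same_setE (fracs_localization OR)).
suff RF : sub_set R (fracs O R) by move=> x; split; [exact: RF | exact: fracs_sub].
have sF : subring (fracs O R) by exact: fracs_subring.
have OF : sub_set O (fracs O R) by exact: fracs_base.
have AF : sub_set (cA i) (fracs O R).
  apply: adjoin_min => //; apply: (outside hi sF lR OF _ _ _ ci).
  - exact: fracs_sub.
  - by move=> x Fx ux; have [] := unit_ofV (fracs_unit lR OR Fx ux).
  - by move=> x Rx; exact: fracs_inv.
  - have [||nr] := @unit_or_nonunit _ R r; [by apply: OR; case: Or | by constructor 1 |].
    have [||nu] := @unit_or_nonunit _ R u; [by apply: OR; case: Ou | by constructor 2 |].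
    have [||nW] := @unit_or_nonunit _ R W; [by apply: OR; case: OW | by constructor 3 |].
    by case: nd; apply/(dominatesP lO Oc Or Ou OW Om).
rewrite {1}e => _ [x [y [Ax Ay uy ->]]]; apply: subringM => //; first exact: AF.
by have [] := unit_ofV (fracs_unit lR OR (AF _ Ay) uy).
Qed.

Lemma over_dominates T : over_point T <-> local_subring T /\ dominates T O.
Proof.
split=> [[lT OT nO]|[lT dT]]; first by split=> //; apply/(dominatesP lO Oc Or Ou OW Om).
by have [OT _] := dT; split=> //; apply/(dominatesP lO Oc Or Ou OW Om).
Qed.

(** For [x] in the maximal ideal of [O] some [x - iota c] is a nonunit of [R]; but it is a unit of
    [O] unless [c = 0], so [x] itself is a nonunit of [R]. *)
Lemma closed_over R : closed_pt iota A R -> over_point R.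
Proof.
move=> [/ptP [lR OR _] res].
have key x : nonunit O x -> nonunit R x.
  move=> nx; have [c nc] := res x (OR _ (proj1 nx)).
  have [cE|cN] := eqVneq c 0; first by move: nc; rewrite cE rmorph0 subr0.
  case: nc => _; case; apply: (unit_of_sub OR); rewrite -opprB; apply: unit_ofN; first by case: lO.
  by apply: (unit_ofD lO); [exact: unit_iota | apply: nonunitN => //; case: lO].
by split=> //; split; apply: key.
Qed.

(** The charts overlap; this selects a preferred one. A point with [X i] invertible is moved on to
    chart [i.+1], or to chart 6 when [i = 5], and a point of chart 7 with [tau] invertible is moved
    to chart 6. *)
Definition normal_chart (T : L -> Prop) (i : nat) : Prop := [/\ contains T i,
  (i < 6)%N -> nonunit T (X i) & i = 7 -> nonunit T tau].

Lemma normal_chart_exists T i : over_point T -> (i < 8)%N -> contains T i ->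
  exists2 j, (j < 8)%N & normal_chart T j.
Proof.
move=> oT; have lT := over_local oT; have sT := proj1 lT; have [_ OT _] := oT.
move=> hi ci; have [li|e|e] := chart_cases hi; last 2 first.
- by exists 6 => //; rewrite e in ci.
- subst i; have /chart7P [Tt Tr] := ci; have Tu := mem_u OT.
  case: (unit_or_nonunit Tt) => [ut|nt]; last by exists 7.
  exists 6 => //; split=> //; apply/chart6P; split=> //.
    by rewrite -invtau; case: ut.
  by rewrite hout; mem sT.
(* Induction on the distance to chart 5: if [X i] is a unit, its inverse [Y i.+1] lies in [T]. At
   chart 5 the element [rho = U^-1 ^+ 3 * (X 5)^-1] lies in [T], which leads to chart 6. *)
have [d hd] : exists d, d = (5 - i)%N by exists (5 - i)%N.
elim: d i hi ci li hd => [|d IH] i hi ci li hd; have /(contains_low _ li) [TX TY TU] := ci;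
  have Th := mem_h sT TX TY; case: (unit_or_nonunit TX) => [ux|nx];
  try by exists i => //; split=> // ei; rewrite ei in li.
- have i5 : i = 5 by apply/eqP; rewrite eqn_leq -ltnS li -subn_eq0 -hd.
  subst i; have [_ _ TXv] := ux.
  have Tc := mem_iota OT; have Tr := mem_r OT; have Tu := mem_u OT.
  have TUv : T U^-1 by rewrite invU; mem sT.
  have Trho : T rho.
    have -> : rho = U^-1 ^+ 3 * (X 5)^-1.
      by apply: (mulIf (x := U ^+ 3 * X 5)); rewrite ?hrho ?mulf_neq0 ?expf_neq0 ?U_neq0 ?X_neq0 //; field; rewrite U_neq0 X_neq0.
    by mem sT.
  exists 6 => //; split=> //; apply/chart6P; rewrite hsig hom; split=> //; mem sT.
- have i5 : (i < 5)%N by rewrite -subn_gt0 -hd.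
  have i8 : (i.+1 < 8)%N by apply: (leq_trans (n := 6)).
  apply: (IH i.+1) => //; last by rewrite subnS -hd.
  apply/(@contains_low T i.+1 i5); split=> //; first by rewrite hXS; mem sT.
  by rewrite -invX; case: ux.
Qed.

Lemma nonunit_kap T : over_point T -> T rho -> T om -> nonunit T kap ->
  exists2 n : nat, (n == 6) || (n == 7) & nonunit T (rho - iota (bet n)).
Proof.
move=> oT Tr To nk; have lT := over_local oT; have sT := proj1 lT; have [_ OT _] := oT.
have ns := nonunit_s oT To Tr; have Ts : T s by case: ns.
have Tc := mem_iota OT.
have Tz : T (rho + iota b + s) by mem sT.
rewrite hkap in nk; case: (nonunitM_or sT Tr Tz nk) => nz.
  by exists 6 => //; rewrite /bet /= rmorph0 subr0.
by exists 7 => //; rewrite /bet /= rmorphN opprK -(addrK s (rho + iota b)); exact: nonunitB.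
Qed.

Lemma normal_chart_cases T i : over_point T -> (i < 8)%N -> normal_chart T i ->
  exists2 n, (n < 8)%N & (mainc n = i /\ cond_main n T) \/
    [/\ infc n = i, cond_inf n T & nonunit T (pari n)].
Proof.
move=> oT hi [ci nx nt]; have lT := over_local oT; have sT := proj1 lT; have [_ OT [nr nu nW]] := oT.
have [li|e|e] := chart_cases hi.
- have nX := nx li; case: i hi ci nx nt li nX => [|i] hi ci nx nt li nX.
    (* In chart 0 the element [Y 0 = r] is a nonunit, so the only point with [X 0] vanishing is the
       point at infinity of curve 0. *)
    exists 0 => //; right; split=> //; split=> //.
    by rewrite /zi /= hY0.
  have hi' : (i < 8)%N by exact: ltnW.
  exists i => //; left; rewrite /cond_main /mainc /cz -ltnS li; split=> //.
- subst i; have /chart6P [Ts Tr To] := ci; have Tc := mem_iota OT.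
  have Tss : T s by exact: (mem_s sT OT).
  have Tk : T kap by rewrite hkap; mem sT.
  (* From [om ^+ 2 = u * kap]. Since also [om = sig * kap], the point lies on [sig = 0], which is
     curve 5, or on [kap = 0], which is one of the two ends. *)
  have no : nonunit T om.
    apply: (nonunit_expr sT (n := 2)) => //; rewrite expr2 {2}hosk mulrA -huos.
    exact: nonunitMr.
  rewrite hosk in no; case: (nonunitM_or sT Ts Tk no) => [nsig|nk].
    by exists 5 => //; left; split.
  have [n hn nz] := nonunit_kap oT Tr To nk.
  exists n; first by case/orP: hn => /eqP->.
  left; rewrite /cond_main.
  by case/orP: hn nz => /eqP-> nz; split.
- subst i; have ntau := nt erefl; have /chart7P [Tt Tr] := ci.
  have Tu := mem_u OT.
  have To : T om by rewrite hout; mem sT.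
  have nk : nonunit T kap by rewrite hkt; apply: nonunitMr => //; mem sT.
  have [n hn nz] := nonunit_kap oT Tr To nk.
  exists n; first by case/orP: hn => /eqP->.
  by right; case/orP: hn nz => /eqP-> nz; split.
Qed.

Section Reducing.
Variables (T : L -> Prop) (n : nat).
Hypothesis hn : (n < 8)%N.

Lemma mainc_lt : (mainc n < 8)%N.
Proof. by rewrite /mainc; case: ifP => // hlt; rewrite ltnS ltnW // ltnW. Qed.
Lemma infc_lt : (infc n < 8)%N.
Proof. by rewrite /infc; case: ifP => // hlt; rewrite ltnW // ltnW. Qed.

Lemma reduces_main : cond_main n T ->
  forall g, g \in chart (mainc n) -> reduces iota T (eqn n) (par n) g.
Proof.
move=> cT g /(congr_main hn) [P /(_ T cT) hP]; exists 1, P; rewrite pe1 mul1r; split=> //.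
by apply: unit_of1; case: cT => [[[]]].
Qed.

Lemma reduces_inf : cond_inf n T -> nonunit T (pari n) \/ transcendental iota T (pari n) ->
  forall g, g \in chart (infc n) -> reduces iota T (eqi n) (pari n) g.
Proof.
move=> cT ht g /(congr_inf hn) [a [q [a0 /(_ T cT) hP]]]; exists a, q; split=> //.
case: cT => oT _ _; have lT := over_local oT; have sT := proj1 lT.
have Tc c : T (iota c) by exact: over_iota.
case: ht => [nt|]; last first.
  by apply; apply: contraTneq isT => e; move: a0; rewrite e horner0 => /esym/eqP; rewrite oner_eq0.
have [Q eQ] := pe_root iota a 0 (pari n).
apply: (unit_congr lT (y := iota a.[0])); last by rewrite a0 rmorph1; exact: unit_of1.
rewrite eQ rmorph0 subr0; apply: nonunitMr => //; apply: pe_closed => //; by case: nt.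
Qed.
End Reducing.

Definition is_curve (n : nat) E := [/\ cond_main n E, E = fracs (cA (mainc n)) E &
  transcendental iota E (par n)].

Lemma residue_iff T T' t c : over_point T -> over_point T' ->
  nonunit T (t - iota c) -> nonunit T' (t - iota c) ->
  forall P, nonunit T (pe P t) <-> nonunit T' (pe P t).
Proof.
have key S P : over_point S -> nonunit S (t - iota c) -> nonunit S (pe P t) <-> P.[c] = 0.
  move=> oS nt; have lS := over_local oS; have sS := proj1 lS.
  have Sc c' : S (iota c') by exact: over_iota.
  have St : S t by rewrite -(subrK (iota c) t); apply: subringD => //; case: nt.
  have [Q eQ] := pe_root iota P c t.
  have nQ : nonunit S (pe P t - iota P.[c]) by rewrite eQ; apply: nonunitMr => //; exact: pe_closed.
  split=> [nP|e]; last by move: nQ; rewrite e rmorph0 subr0.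
  apply: (nonunit_iota Sc); rewrite -(subKr (pe P t) (iota _)); exact: nonunitB.
by move=> oT oT' nt nt' P; rewrite !key.
Qed.

Lemma transcendental_iff T T' t : transcendental iota T t -> transcendental iota T' t ->
  subring T -> subring T' ->
  forall P, nonunit T (pe P t) <-> nonunit T' (pe P t).
Proof.
move=> tr tr' sT sT' P; have [->|P0] := eqVneq P 0.
  by rewrite pe0; split=> _; exact: nonunit0.
by split=> -[_]; [have := tr P P0 | have := tr' P P0].
Qed.

Lemma main_unique T T' n : (n < 8)%N -> cond_main n T -> cond_main n T' ->
  T = fracs (cA (mainc n)) T -> T' = fracs (cA (mainc n)) T' ->
  (forall P, nonunit T (pe P (par n)) <-> nonunit T' (pe P (par n))) -> T = T'.
Proof.
move=> hn cT cT' fT fT' ht.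
have [oT con _] := cT; have [oT' con' _] := cT'.
have [[Tt ne _ _ _] _] := ideal_main hn cT; have [[Tt' ne' _ _ _] _] := ideal_main hn cT'.
have [lT dT] : local_subring T /\ dominates T O by apply/over_dominates.
have [lT' dT'] : local_subring T' /\ dominates T' O by apply/over_dominates.
apply: (local_ring_unique lO Oc Or Ou OW Om lT _ fT lT' _ fT' dT dT' Tt Tt' _ ht);
  try exact: over_sub.
move=> g hg; have [P hP] := congr_main hn hg; exists 1, P; rewrite pe1 mul1r.
split; try by [apply: unit_of1; case: lT | apply: unit_of1; case: lT'].
  by apply: in_ideal_nonunit (hP _ cT) => //; case: lT.
by apply: in_ideal_nonunit (hP _ cT') => //; case: lT'.
Qed.

Lemma curve_unique E E' n : (n < 8)%N -> is_curve n E -> is_curve n E' -> E = E'.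
Proof.
move=> hn [cE fE tE] [cE' fE' tE']; apply: (main_unique hn) => //.
by apply: transcendental_iff => //; [case: cE => [[[]]] | case: cE' => [[[]]]].
Qed.

Lemma inf_unique T T' n : (n < 8)%N -> cond_inf n T -> cond_inf n T' ->
  T = fracs (cA (infc n)) T -> T' = fracs (cA (infc n)) T' ->
  nonunit T (pari n) -> nonunit T' (pari n) -> T = T'.
Proof.
move=> hn cT cT' fT fT' nt nt'.
have [oT con _] := cT; have [oT' con' _] := cT'.
have [Tt ne _ _ _] := ideal_inf hn cT; have [Tt' ne' _ _ _] := ideal_inf hn cT'.
have [lT dT] : local_subring T /\ dominates T O by apply/over_dominates.
have [lT' dT'] : local_subring T' /\ dominates T' O by apply/over_dominates.
have nt0 : nonunit T (pari n - iota 0) by rewrite rmorph0 subr0.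
have nt0' : nonunit T' (pari n - iota 0) by rewrite rmorph0 subr0.
have ht := residue_iff oT oT' nt0 nt0'.
apply: (local_ring_unique lO Oc Or Ou OW Om lT _ fT lT' _ fT' dT dT' Tt Tt' _ ht);
  try exact: over_sub.
move=> g hg; have [a [q [a0 hP]]] := congr_inf hn hg; exists a, q.
have ut : unit_of T (pe a (pari n)).
  case: (@unit_or_nonunit _ T (pe a (pari n))) => //.
    by apply: pe_closed => //; [case: lT | move=> c; exact: over_iota].
  move=> na; exfalso.
  have sT := proj1 lT; have Tc c : T (iota c) by exact: over_iota.
  have [Q eQ] := pe_root iota a 0 (pari n).
  have : nonunit T (iota a.[0]).
    rewrite -(subKr (pe a (pari n)) (iota _)) eQ; apply: nonunitB => //.
    by apply: nonunitMr => //; exact: pe_closed.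
  by rewrite a0 rmorph1; exact: nonunit1.
have ut' : unit_of T' (pe a (pari n)).
  case: (@unit_or_nonunit _ T' (pe a (pari n))) => //.
    by apply: pe_closed => //; [case: lT' | move=> c; exact: over_iota].
  by move/(ht a) => [].
split=> //.
  by apply: in_ideal_nonunit (hP _ cT) => //; case: lT.
by apply: in_ideal_nonunit (hP _ cT') => //; case: lT'.
Qed.

Lemma main_residue R n c x : (n < 8)%N -> cond_main n R -> R = fracs (cA (mainc n)) R ->
  nonunit R (par n - iota c) -> R x -> exists c', nonunit R (x - iota c').
Proof.
move=> hn cR fR nt Rx; have [[Rt ne er eu eW] _] := ideal_main hn cR.
have [oR con _] := cR.
apply: (closed_residue Oc Om (over_local oR) (over_sub oR con) Rt fR ne er eu eW
  (reduces_main hn cR) nt Rx).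
Qed.

Lemma inf_residue R n x : (n < 8)%N -> cond_inf n R -> R = fracs (cA (infc n)) R ->
  nonunit R (pari n) -> R x -> exists c', nonunit R (x - iota c').
Proof.
move=> hn cR fR nt Rx; have [Rt ne er eu eW] := ideal_inf hn cR.
have [oR con _] := cR.
have nt0 : nonunit R (pari n - iota 0) by rewrite rmorph0 subr0.
apply: (closed_residue Oc Om (over_local oR) (over_sub oR con) Rt fR ne er eu eW
  (reduces_inf hn cR (or_introl nt)) nt0 Rx).
Qed.

Lemma main_generated2 R n c : (n < 8)%N -> cond_main n R -> R = fracs (cA (mainc n)) R ->
  nonunit R (par n - iota c) -> generated2 R (nonunit R) (eqn n) (par n - iota c).
Proof.
move=> hn cR fR nt; have [[Rt ne er eu eW] _] := ideal_main hn cR.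
have [oR con _] := cR.
apply: (closed_generated2 Oc Om (over_local oR) (over_sub oR con) Rt fR ne er eu eW
  (reduces_main hn cR) nt).
Qed.

Lemma inf_generated2 R n : (n < 8)%N -> cond_inf n R -> R = fracs (cA (infc n)) R ->
  nonunit R (pari n) -> generated2 R (nonunit R) (eqi n) (pari n).
Proof.
move=> hn cR fR nt; have [Rt ne er eu eW] := ideal_inf hn cR.
have [oR con _] := cR.
have nt0 : nonunit R (pari n - iota 0) by rewrite rmorph0 subr0.
have := closed_generated2 Oc Om (over_local oR) (over_sub oR con) Rt fR ne er eu eW
  (reduces_inf hn cR (or_introl nt)) nt0.
by rewrite rmorph0 subr0.
Qed.

Lemma over_pt R : pt A R -> dominates R O -> over_point R.
Proof. by move=> /ptP [lR _ _] dR; apply/over_dominates. Qed.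

Lemma pt_cases R : pt A R -> over_point R -> exists2 n, (n < 8)%N &
    (cond_main n R /\ R = fracs (cA (mainc n)) R) \/
    [/\ cond_inf n R, R = fracs (cA (infc n)) R & nonunit R (pari n)].
Proof.
move=> pR oR; have [lR OR [i [hi ci _]]] := ptP pR.
have [j hj nj] := normal_chart_exists oR hi ci.
have [n hn [[_ cR]|[_ cR nt]]] := normal_chart_cases oR hj nj; exists n => //.
  by left; split=> //; apply: pt_fracs => //; [exact: mainc_lt | case: cR].
by right; split=> //; apply: pt_fracs => //; [exact: infc_lt | case: cR].
Qed.

Lemma charts_regular : regular iota A.
Proof.
move=> R cpR; have oR := closed_over cpR; have [pR res] := cpR.
have [n hn [[cR fR]|[cR fR nt]]] := pt_cases pR oR.
  have [[Rt _ _ _ _] _] := ideal_main hn cR.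
  have [c nt] := res _ Rt.
  by exists (eqn n), (par n - iota c); exact: main_generated2.
by exists (eqi n), (pari n); exact: inf_generated2.
Qed.

Lemma charts_resolution : resolution iota O A.
Proof.
split; [|exact: charts_proper|exact: charts_regular|exact: charts_iso].
by move=> i; exists (chart i) => x.
Qed.

(** * The exceptional curves and their self-intersection *)

Lemma curve_low n E : (n < 6)%N -> is_curve n E ->
  [/\ unit_of E (Y n.+1), unit_of E U & nonunit E h].
Proof.
move=> hn6 [[oE con nz] _ tr]; have hn : (n < 8)%N by exact: (ltn_trans hn6).
have lE := over_local oE; have sE := proj1 lE; have [_ OE [nr nu nW]] := oE.
have Ec := mem_iota OE; have Er := mem_r OE; have Eu := mem_u OE.
move: con nz tr; rewrite /cond_main; case: (curve_indexP hn) => [h5|n5|hn'] con nz tr.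
- have /contains_low [//|EX EY EU] := con.
  have Eh := mem_h sE EX EY.
  split; first exact: transcendental_unit tr; last first.
    by rewrite -(hXY n.+1); exact: nonunitMr.
  have EX5 := mem_X5 sE (h5 : (n.+1 < 6)%N) EX EY.
  by apply: (unit_of_mul1 sE EU _ hU); mem sE.
- have /chart6P [Es Erho Eo] := con; have ur := transcendental_unit tr.
  have ns' := nonunit_s oE Eo Erho; have Ess : E s by case: ns'.
  have Ek : E kap by rewrite hkap; mem sE.
  have no : nonunit E om by rewrite hosk; exact: nonunitMr.
  have urb : unit_of E (rho + iota b + s).
    apply: (unit_ofD lE) => //; move: (tr ('X + b%:P)); rewrite peD peX peC; apply.
    by rewrite -size_poly_eq0 size_XaddC.
  have uU : unit_of E U.
    have [n0 _ _] := urb; have -> : U = rho * (rho + iota b + s)^-1 by exact: (canRL (mulfK n0) hUr).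
    by apply: (unit_ofM sE) => //; exact: unit_ofV.
  rewrite n5; split=> //.
    have -> : Y 6 = U ^+ 3 * rho.
      rewrite -invX; apply: mul1_inv; rewrite -hrho; ring.
    by apply: unit_ofM => //; exact: unit_ofX.
  have -> : h = om * rho^-1 by rewrite hom mulfK // rho_neq0.
  by apply: (nonunitMr sE no); case: ur.
- by case/orP: hn' hn6 => /eqP->.
Qed.

Lemma nonunit_rho_bet T n : (n == 6) || (n == 7) -> over_point T -> T rho -> T om ->
  nonunit T (rho - iota (bet n)) -> nonunit T (rho * (rho + iota b + s)).
Proof.
move=> hn oT Tr To nz; have lT := over_local oT; have sT := proj1 lT; have [_ OT _] := oT.
have ns := nonunit_s oT To Tr; have Ts : T s by case: ns.
have Tc := mem_iota OT.
case/orP: hn nz => /eqP->; rewrite /bet /= ?rmorph0 ?subr0 ?rmorphN ?opprK => nz.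
  by apply: nonunitMr => //; mem sT.
by apply: nonunitMl => //; exact: nonunitD.
Qed.

(** Only two charts meet a given curve: in any other one, relations such as [X i * Y i.+1 = 1],
    [hrho] or [hst] would make some function both a unit and zero along the curve. *)
Lemma curve_contains n E i : (n < 8)%N -> (i < 8)%N -> is_curve n E -> contains E i ->
  (i == mainc n) || (i == infc n).
Proof.
move=> hn hi cE con; have [[oE cm nz] _ tr] := cE.
have lE := over_local oE; have sE := proj1 lE; have [_ OE [nr nu nW]] := oE.
have Ec := mem_iota OE; have Er := mem_r OE; have Eu := mem_u OE.
have no1 x : nonunit E x -> x = 1 -> False by move=> nx x1; move: nx; rewrite x1; exact: nonunit1.
case: (ltnP n 6) => hn6.
  have [uY uU nh] := curve_low hn6 cE; have [_ EU _] := uU; have [_ EY _] := uY.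
  case: (chart_cases hi) => [li|e|e]; last 2 first.
  - subst i; case: (ltnP n 5) => h5; last first.
      have n5 : n = 5 by apply/eqP; rewrite eqn_leq h5 -ltnS hn6.
      by rewrite n5.
    have [_ Erho _] : [/\ E sig, E rho & E om] by apply/chart6P.
    exfalso; apply: (no1 _ _ hrho); apply: (nonunitMl sE) => //; apply: (nonunitMl sE); first by mem sE.
    move: cm nz tr; rewrite /mainc /cz /par h5 => cm nz tr.
    have /contains_low [//|EX' EY' EU'] := cm.
    by rewrite (Xsub (i := n.+1)) //; apply: (nonunitMl sE) => //; have Eh := mem_h sE EX' EY'; mem sE.
  - subst i; have [Et Erho] : E tau /\ E rho by apply/chart7P.
    exfalso; case: (ltnP n 5) => h5.
      apply: (no1 _ _ hrho); apply: (nonunitMl sE) => //; apply: (nonunitMl sE); first by mem sE.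
      move: cm nz tr; rewrite /mainc /cz /par h5 => cm nz tr.
      have /contains_low [//|EX' EY' EU'] := cm.
      by rewrite (Xsub (i := n.+1)) //; apply: (nonunitMl sE) => //; have Eh := mem_h sE EX' EY'; mem sE.
    have n5 : n = 5 by apply/eqP; rewrite eqn_leq h5 -ltnS hn6.
    by apply: (no1 _ _ hst); apply: nonunitMr => //; move: nz; rewrite n5.
  - have /contains_low [//|EXi EYi _] := con.
    rewrite /mainc /infc hn6; apply: contraT; rewrite negb_or => /andP [m1 m2].
    have m1' : i != n.+1.
      case: (ltnP n 5) m1 => h5 // _; apply/eqP => e; move: li; rewrite e ltnS ltnNge => /negP; exact.
    exfalso; case: (ltngtP i n) => hin; last by rewrite hin eqxx in m2.
      apply: (no1 _ _ (hXY1 i)); apply: (nonunitMl sE) => //.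
      rewrite (Ysub (j := n.+1)) 1?ltnW // subSS.
      apply: nonunitMr => //; rewrite -(subnKC hin) addSn -addnS addKn; exact: nonunitX.
    have hin' : (n.+1 < i)%N by rewrite ltn_neqAle eq_sym m1'.
    have [_] : nonunit E (Y n.+1); last exact.
    rewrite (Ysub (ltnW hin')); apply: nonunitMr => //.
    by rewrite -(subnKC hin') addSn -addnS addKn; exact: nonunitX.
have hn' : (n == 6) || (n == 7).
  by move: hn6 hn; clear; do 8!case: n => [|n] //.
have [emc einf ecz] : [/\ mainc n = 6, infc n = 7 & cz n = rho - iota (bet n)].
  by case/orP: hn' => /eqP->.
rewrite emc einf; case: (chart_cases hi) => [li|->|->] //.
rewrite emc in cm; have /chart6P [Es Erho Eo] := cm.
have ns := nonunit_s oE Eo Erho; have Ess : E s by case: ns.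
have /contains_low [//|EXi EYi EU] := con.
have EX5 := mem_X5 sE li EXi EYi.
have ur : unit_of E rho by apply: (unit_of_mul1 sE Erho _ hrho); mem sE.
have urb : unit_of E (rho + iota b + s).
  by apply: (unit_of_mulr sE EU); [mem sE | rewrite hUr].
rewrite ecz in nz; have [_ []] := nonunit_rho_bet hn' oE Erho Eo nz.
exact: unit_ofM.
Qed.

(** If [t^-1] had residue [c], the nonzero polynomial [1 - c t] would be a nonunit. Hence the
    coordinate at infinity also parametrizes the curve. *)
Lemma transcendental_inv T t : local_subring T -> (forall c, T (iota c)) ->
  transcendental iota T t -> transcendental iota T t^-1.
Proof.
move=> lT Tc tr; have sT := proj1 lT; have [t0 Tt Ttv] := transcendental_unit tr.
case: (residue_dichotomy lT Tc Ttv) => // -[c nc]; exfalso.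
have [_] : nonunit T (pe (1 - c%:P * 'X) t).
  rewrite peB pe1 peM peC peX.
  have -> : 1 - iota c * t = t * (t^-1 - iota c) by field.
  exact: nonunitMl.
apply; apply: tr; apply: contraTneq isT => /(congr1 (fun P => P.[0])).
by rewrite hornerD hornerN hornerM hornerX mulr0 subr0 hornerC horner0 => /eqP; rewrite oner_eq0.
Qed.

Lemma curve_inf n E : (n < 8)%N -> is_curve n E ->
  cond_inf n E /\ transcendental iota E (pari n).
Proof.
move=> hn cE; have [[oE cm nz] _ tr] := cE.
have lE := over_local oE; have sE := proj1 lE; have [_ OE [nr nu nW]] := oE.
have Ec := mem_iota OE; have Eu := mem_u OE.
have -> : pari n = (par n)^-1.
  case: (curve_indexP hn) => [_|_|_]; last by rewrite invsig.
    by rewrite invY.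
  by rewrite invrho.
split; last exact: transcendental_inv.
split=> //.
  case: (ltnP n 6) => hn6.
    have [[Y0 EY _] [U0 EU _] [Eh _]] := curve_low hn6 cE.
    rewrite /infc hn6; apply/contains_low => //; split=> //; last by rewrite hYS; mem sE.
    case: (ltnP n 5) => h5.
      move: tr; rewrite /par h5 => tr; rewrite -invY.
      by have [_ _] := transcendental_unit tr.
    have n5 : n = 5 by apply/eqP; rewrite eqn_leq h5 -ltnS hn6.
    move: EY; rewrite n5 -[X 5]invrK invX => _.
    have [_ _] := transcendental_unit tr; rewrite n5 /par /= invrho => EX.
    have -> : ((Y 6)^-1) = U^-1 ^+ 3 * (U ^+ 3 * X 5).
      by rewrite invY mulrA -exprMn mulVf ?U_neq0 // expr1n mul1r.
    apply: (subringM sE) => //; apply: (subringX sE).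
    by have := curve_low hn6 cE; rewrite n5 => -[_ []].
  have hn' : (n == 6) || (n == 7).
    by move: hn6 hn; clear; do 8!case: n => [|n] //.
  have emc : mainc n = 6 by case/orP: hn' => /eqP->.
  have einf : infc n = 7 by case/orP: hn' => /eqP->.
  have epar : par n = sig by case/orP: hn' => /eqP->.
  rewrite einf; apply/chart7P; rewrite emc in cm; have /chart6P [Es Erho Eo] := cm.
  by split=> //; rewrite -invsig -epar; have [_ _] := transcendental_unit tr.
rewrite /zi; case: (ltnP n 6) => hn6.
  have [[Y0 EY _] _ nh] := curve_low hn6 cE.
  by rewrite hYS; exact: nonunitMr.
move: nz; rewrite /cz.
have hn' : (n == 6) || (n == 7).
  by move: hn6 hn; clear; do 8!case: n => [|n] //.
by case/orP: hn' => /eqP->.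
Qed.

(** The exponent 2 is the degree of the conormal bundle. On the chain [X n.+1 = Y n * X n ^+ 2]; on
    curve 5 the unit [U^-1 ^+ 2] appears; on the ends the relation is [kap = u * tau ^+ 2], exact
    because [kap] was taken as local equation instead of [rho - bet n]. *)
Lemma eqn_ratio n : (n < 8)%N -> exists v, eqn n = eqi n * v * pari n ^+ 2 /\
  forall T, over_point T -> contains T (infc n) -> unit_of T v.
Proof.
move=> hn; case: (curve_indexP hn) => [h5|n5|hn'].
- exists 1; split; last by move=> T [[sT _] _ _] _; exact: unit_of1.
  by rewrite hXS -(hXY n); ring.
- exists (U^-1 ^+ 2); split.
    by rewrite hsig -(hXY 5); field; exact: U_neq0.
  move=> T oT con; have lT := over_local oT; have sT := proj1 lT; have [_ OT _] := oT.
  have Tc := mem_iota OT; have Tr := mem_r OT; have Tu := mem_u OT.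
  have /contains_low [//|TX TY TU] := con; have Th := mem_h sT TX TY.
  apply: (unit_ofX sT); apply: (unit_ofV); apply: (unit_of_mul1 sT TU _ hU); mem sT.
- exists 1; split; last by move=> T [[sT _] _ _] _; exact: unit_of1.
  by rewrite mulr1.
Qed.

Lemma eqn_neq0 n : eqn n != 0.
Proof. by rewrite /eqn; case: ifP => _; [exact: X_neq0 | case: ifP => _; [exact: sig_neq0 | exact: kap_neq0]]. Qed.

Lemma over_curve n E : is_curve n E -> over_point E.
Proof. by case=> [[]]. Qed.

(** The preferred chart of [R] also contains [E], so by [curve_contains] it is one of the two charts
    of the curve. In the second one, the normalization of the chart forces [pari n = 0]. *)
Lemma on_curve_cases n E R : (n < 8)%N -> is_curve n E -> on_curve iota A R E ->
  over_point R /\ ([/\ cond_main n R, R = fracs (cA (mainc n)) R &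
                 exists c, nonunit R (par n - iota c)] \/
             [/\ cond_inf n R, R = fracs (cA (infc n)) R & nonunit R (pari n)]).
Proof.
move=> hn cE [cpR RE]; have oR := closed_over cpR; have [pR res] := cpR; split=> //.
have lR := over_local oR; have sR := proj1 lR; have [_ OR [nr nu nW]] := oR.
have [lR' OR' [i [hi ci _]]] := ptP pR.
have [j hj [cj nx nt]] := normal_chart_exists oR hi ci.
have cEj : contains E j by move=> g hg; apply: RE; exact: cj.
have [ciE _] := curve_inf hn cE; have [_ conE nz] := ciE.
have [[oE cmE nzm] _ _] := cE.
case/orP: (curve_contains hn hj cE cEj) => /eqP ej; subst j; [left | ].
  have cR : cond_main n R.
    split=> //; apply: (nonunit_of_sub RE) => //.
    have sR' := over_sub oR cj.
    case: (curve_indexP hn) (cj) => [h5|n5|hn'] c'.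
    - by have /contains_low [] := c'.
    - by have /chart6P [] := c'.
    - have /chart6P [_ Rr _] := c'; apply: (subringB sR) => //; exact: over_iota.
  split=> //; first by apply: pt_fracs => //; exact: mainc_lt.
  by apply: res; have [[]] := ideal_main hn cR.
have key : nonunit R (pari n) -> [/\ cond_inf n R, R = fracs (cA (infc n)) R & nonunit R (pari n)].
  move=> np; split=> //; last by apply: pt_fracs => //; exact: infc_lt.
  split=> //; apply: (nonunit_of_sub RE) => //.
  case: (curve_indexP hn) (cj) => [h5|n5|hn'] c'.
  - by have /contains_low [|] := c'; first exact: ltnW.
  - by have /contains_low [] := c'.
  - have /chart7P [_ Rr] := c'; apply: (subringB sR) => //; exact: over_iota.
right; apply: key; move: nx nt cj; case: (curve_indexP hn) => [h5|n5|hn'] nx nt cj.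
- by apply: nx; exact: ltnW.
- apply: nonunitMl => //; last exact: nx.
  by have /contains_low [//|_ _ RU] := cj; exact: subringX.
- exact: nt.
Qed.

Lemma main_parameters n E R c : (n < 8)%N -> is_curve n E -> sub_set R E ->
  cond_main n R -> R = fracs (cA (mainc n)) R -> nonunit R (par n - iota c) ->
  curve_parameters R E (eqn n) (par n - iota c).
Proof.
move=> hn cE RE cR fR nt; split; first exact: main_generated2.
have [cmE fE tr] := cE; have [[_ neE _ _ _] _] := ideal_main hn cmE.
have [[Rt ne er eu eW] _] := ideal_main hn cR; have [oR con _] := cR.
apply: (curve_generated1 Oc Om (over_local oR) (over_sub oR con) Rt fR ne er eu eW
  (reduces_main hn cR)) => //.
exact: over_local (over_curve cE).
Qed.

Lemma inf_parameters n E R : (n < 8)%N -> is_curve n E -> sub_set R E ->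
  cond_inf n R -> R = fracs (cA (infc n)) R -> nonunit R (pari n) ->
  curve_parameters R E (eqi n) (pari n).
Proof.
move=> hn cE RE cR fR nt; split; first exact: inf_generated2.
have [ciE tr] := curve_inf hn cE; have [_ neE _ _ _] := ideal_inf hn ciE.
have [Rt ne er eu eW] := ideal_inf hn cR; have [oR con _] := cR.
apply: (curve_generated1 Oc Om (over_local oR) (over_sub oR con) Rt fR ne er eu eW
  (reduces_inf hn cR (or_introl nt))) => //.
exact: over_local (over_curve cE).
Qed.

Lemma curve_generated n E : (n < 8)%N -> is_curve n E -> generated1 E (nonunit E) (eqn n).
Proof.
move=> hn [cE fE tr]; have [[Et ne er eu eW] _] := ideal_main hn cE.
have [oE con _] := cE.
exact: (generic_generated1 Oc Om (over_local oE) (over_sub oE con) Et fE ne er eu eW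
  (reduces_main hn cE)).
Qed.

Lemma curve_rational n E : (n < 8)%N -> is_curve n E -> rational_curve iota E.
Proof.
move=> hn [cE fE tr]; have [[Et ne er eu eW] _] := ideal_main hn cE.
have [oE con _] := cE.
exact: (generic_rational Oc Om (over_local oE) (over_sub oE con) Et fE ne er eu eW
  (reduces_main hn cE)).
Qed.

Lemma curve_smooth n E : (n < 8)%N -> is_curve n E -> smooth_curve iota A E.
Proof.
move=> hn cE R oc; have [oR [[cR fR [c nt]]|[cR fR nt]]] := on_curve_cases hn cE oc;
  have [_ RE] := oc.
  by exists (eqn n), (par n - iota c); exact: main_parameters.
by exists (eqi n), (pari n); exact: inf_parameters.
Qed.

Lemma main_point n E c : (n < 8)%N -> is_curve n E -> exists R,
  [/\ on_curve iota A R E, cond_main n R, R = fracs (cA (mainc n)) R &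
      nonunit R (par n - iota c)].
Proof.
move=> hn cE; have [cmE fE tr] := cE; have [oE con nz] := cmE.
have [lE dE] : local_subring E /\ dominates E O by apply/over_dominates.
have [[Et ne er eu eW] _] := ideal_main hn cmE.
have At : cA (mainc n) (par n).
  apply: adjoin_gen; case: (curve_indexP hn) => [h5|n5|hn'].
  - by rewrite /chart ltnS h5 !inE eqxx orbT.
  - by rewrite /chart /= !inE eqxx orbT.
  - by rewrite /chart /= !inE eqxx.
have hg g : g \in chart (mainc n) -> exists a q : {poly k},
    a.[c] != 0 /\ nonunit E (pe a (par n) * g - pe q (par n)).
  move=> /(congr_main hn) [P hP]; exists 1, P; rewrite hornerC oner_neq0 pe1 mul1r; split=> //.
  by apply: in_ideal_nonunit (hP _ cmE) => //; case: lE.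
have [R [[lR AR fR RE] [nt mR res]]] := closed_point_exists lO Oc Or Ou OW Om lE
  (over_sub oE con) dE At tr hg.
have [OR cR] := sub_chart AR.
have oR : over_point R.
  by split=> //; split; apply: mR => //; try (by case: oE => _ _ []); apply: adjoin_base;
    [case: Or | case: Ou | case: OW].
exists R; split=> //.
  split=> //; split; last exact: res.
  by rewrite fR; apply: fracs_pt => //; exact: mainc_lt.
split=> //; apply: mR => //.
case: (curve_indexP hn) => [h5|n5|hn'].
- by apply: adjoin_gen; rewrite /chart ltnS h5 !inE eqxx.
- by apply: adjoin_gen; rewrite /chart /= !inE eqxx.
- apply: (subringB (adjoin_subring _ _)); last by apply: adjoin_base; exact: Oc.
  by apply: adjoin_gen; rewrite /chart /= !inE eqxx orbT.
Qed.

Lemma inf_point n E : (n < 8)%N -> is_curve n E -> exists R,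
  [/\ on_curve iota A R E, cond_inf n R, R = fracs (cA (infc n)) R & nonunit R (pari n)].
Proof.
move=> hn cE; have [ciE tr] := curve_inf hn cE; have [oE con nz] := ciE.
have [lE dE] : local_subring E /\ dominates E O by apply/over_dominates.
have [Et ne er eu eW] := ideal_inf hn ciE.
have At : cA (infc n) (pari n).
  case: (curve_indexP hn) => [h5|n5|hn'].
  - by apply: adjoin_gen; rewrite /chart leqW // !inE eqxx.
  - apply: (subringM (adjoin_subring _ _)); [apply: (subringX (adjoin_subring _ _)) |];
      by apply: adjoin_gen; rewrite /chart /= !inE eqxx ?orbT.
  - by apply: adjoin_gen; rewrite /chart /= !inE eqxx.
have hg g : g \in chart (infc n) -> exists a q : {poly k},
    a.[0] != 0 /\ nonunit E (pe a (pari n) * g - pe q (pari n)).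
  move=> /(congr_inf hn) [a [q [a0 hP]]]; exists a, q; rewrite a0 oner_neq0; split=> //.
  by apply: in_ideal_nonunit (hP _ ciE) => //; case: lE.
have [R [[lR AR fR RE] [nt mR res]]] := closed_point_exists lO Oc Or Ou OW Om lE
  (over_sub oE con) dE At tr hg.
rewrite rmorph0 subr0 in nt.
have [OR cR] := sub_chart AR.
have oR : over_point R.
  by split=> //; split; apply: mR => //; try (by case: oE => _ _ []); apply: adjoin_base;
    [case: Or | case: Ou | case: OW].
exists R; split=> //.
  split=> //; split; last exact: res.
  by rewrite fR; apply: fracs_pt => //; exact: infc_lt.
split=> //; apply: mR => //.
case: (curve_indexP hn) => [h5|n5|hn'].
- by apply: adjoin_gen; rewrite /chart leqW // !inE eqxx orbT.
- by apply: adjoin_gen; rewrite /chart /= !inE eqxx orbT.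
- apply: (subringB (adjoin_subring _ _)); last by apply: adjoin_base; exact: Oc.
  by apply: adjoin_gen; rewrite /chart /= !inE eqxx orbT.
Qed.

(** As section of the conormal sheaf, [eqn n] is a local generator at all points of finite
    coordinate, and by [eqn_ratio] it vanishes to order 2 at the point at infinity. *)
Lemma curve_self_intersection n E : (n < 8)%N -> is_curve n E ->
  self_intersection iota A E (- 2%:Z).
Proof.
move=> hn cE; exists (eqn n); first exact: curve_generated.
have [R [oc cR fR nt]] := inf_point hn cE.
have [v [ev uv]] := eqn_ratio hn.
exists 1%N, (fun=> R), (fun=> 2%:Z); split.
- by move=> i j _; rewrite !ord1.
- move=> _; split=> //; exists (eqi n), (pari n), v; split.
  + by case: oc => _ RE; exact: inf_parameters.
  + by apply: uv; case: cR.
  + rewrite ev.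
    have [ciE tr] := curve_inf hn cE; have [oE con nz] := ciE.
    have e0 : eqi n != 0.
      by apply: contraNneq (eqn_neq0 n) => e0; rewrite ev e0 !mul0r.
    have -> : eqi n * v * pari n ^+ 2 / eqi n - v * pari n ^ 2%:Z = 0.
      by rewrite -exprnP; field.
    by apply: nonunit0; case: oE => [[]].
- move=> R' oc' nR; have [oR' [[cR' fR' [c nt']]|[cR' fR' nt']]] := on_curve_cases hn cE oc'.
    exists (eqn n), (par n - iota c), 1; split.
    + by case: oc' => _ RE'; exact: main_parameters.
    + by apply: unit_of1; case: oR' => [[]].
    + have [[oE con nz] _ _] := cE.
      have e0 := eqn_neq0 n.
      have -> : eqn n / eqn n - 1 * (par n - iota c) ^ 0 = 0.
        by rewrite divff // expr0z mulr1 subrr.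
      by apply: nonunit0; case: oE => [[]].
  by case: (nR ord0); rewrite (inf_unique hn cR cR' fR fR' nt nt').
- by rewrite big_ord1.
Qed.

Lemma curve_exceptional n E : (n < 8)%N -> is_curve n E -> exceptional_curve iota O A E.
Proof.
move=> hn cE; have [[oE con nz] fE tr] := cE.
have [lE dE] : local_subring E /\ dominates E O by apply/over_dominates.
split=> //; first by rewrite fE; apply: fracs_pt => //; [exact: mainc_lt | case: dE].
move=> [_ res]; have [_ Et _] := transcendental_unit tr.
by have [c /(transcendental_neq tr)] := res _ Et.
Qed.

(** By [residue_dichotomy] the coordinate either has a residue in [k] or is transcendental; the
    first alternative, like the point at infinity, makes [E] a closed point. *)
Lemma exceptional_is_curve E : exceptional_curve iota O A E ->
  exists2 n, (n < 8)%N & is_curve n E.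
Proof.
move=> [pE dE nE]; have oE := over_pt pE dE.
have [n hn [[cR fR]|[cR fR nt]]] := pt_cases pE oE; last first.
  by case: nE; split=> // x; exact: (inf_residue hn cR fR nt).
exists n => //; split=> //.
have [[Rt _ _ _ _] _] := ideal_main hn cR.
have Ec c : E (iota c) by exact: over_iota.
case: (residue_dichotomy (over_local oE) Ec Rt) => // -[c nt].
by case: nE; split=> // x; exact: (main_residue hn cR fR nt).
Qed.

Lemma curve_minus_two n E : (n < 8)%N -> is_curve n E -> minus_two_curve iota A E.
Proof.
by move=> hn cE; split; [exact: curve_smooth cE | exact: curve_rational cE |
  exact: curve_self_intersection cE].
Qed.

(** A curve is recognized by its pair of charts, except that curves 6 and 7 share theirs; these two
    differ by the value 0 or [- b] of [rho]. *)
Lemma curve_contains_both n m E : (n < 8)%N -> (m < 8)%N -> is_curve n E -> is_curve m E ->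
  n = m.
Proof.
move=> hn hm cn cm; have [cin _] := curve_inf hn cn; have [cim _] := curve_inf hm cm.
have [[oE con nzn] _ _] := cn; have [[_ com nzm] _ _] := cm.
have [_ iE _] := cin; have [_ jE _] := cim.
have h1 := curve_contains hn (mainc_lt m) cn com.
have h2 := curve_contains hn (infc_lt hm) cn jE.
have h3 := curve_contains hm (mainc_lt n) cm con.
have h4 := curve_contains hm (infc_lt hn) cm iE.
have Ec c : E (iota c) by exact: over_iota.
have lE := over_local oE.
move: nzn nzm; rewrite /cz /bet.
move: h1 h2 h3 h4 hn hm; rewrite /mainc /infc; clear - lE Ec b0.
have no : nonunit E (rho - iota 0) -> nonunit E (rho - iota (- b)) -> False.
  move=> n1 n2; have := nonunitB lE n2 n1.
  rewrite rmorph0 subr0 rmorphN opprK addrAC subrr add0r => /(nonunit_iota Ec) /eqP.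
  by rewrite (negbTE b0).
by do 8?[case: n => [|n] //]; do 8?[case: m => [|m] //] => /= *; exfalso; apply: no.
Qed.

(** * Intersections of the exceptional curves *)

Lemma on_curve_chart n E R : (n < 8)%N -> is_curve n E -> on_curve iota A R E ->
  contains R (mainc n) \/ contains R (infc n).
Proof.
move=> hn cE oc; have [_ [[[_ c _] _ _]|[[_ c _] _ _]]] := on_curve_cases hn cE oc; by [left | right].
Qed.

Lemma on_curve_contains n E R i : (n < 8)%N -> is_curve n E -> on_curve iota A R E ->
  (i < 8)%N -> contains R i -> (i == mainc n) || (i == infc n).
Proof.
move=> hn cE [_ RE] hi ci; apply: (curve_contains hn hi cE) => g hg; apply: RE; exact: ci.
Qed.

Lemma curves_disjoint n m E E' : (n < 8)%N -> (m < 8)%N -> is_curve n E -> is_curve m E' ->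
  ~~ [|| mainc n == mainc m, mainc n == infc m, infc n == mainc m | infc n == infc m] ->
  disjoint_curves iota A E E'.
Proof.
move=> hn hm cE cE' hne R [oc oc']; apply: (negP hne).
case: (on_curve_chart hn cE oc) => c.
  by case/orP: (on_curve_contains hm cE' oc' (mainc_lt n) c) => /eqP->; rewrite eqxx ?orbT.
by case/orP: (on_curve_contains hm cE' oc' (infc_lt hn) c) => /eqP->; rewrite eqxx ?orbT.
Qed.

Lemma ends_disjoint E E' : is_curve 6 E -> is_curve 7 E' -> disjoint_curves iota A E E'.
Proof.
move=> cE cE' R [oc oc'].
have [oR hR] := on_curve_cases (isT : (6 < 8)%N) cE oc; have [_ hR'] := on_curve_cases (isT : (7 < 8)%N) cE' oc'.
have lR := over_local oR; have Rc c : R (iota c) by exact: over_iota.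
have n1 : nonunit R (rho - iota 0) by case: hR => -[[_ _ nz] _ _].
have n2 : nonunit R (rho - iota (- b)) by case: hR' => -[[_ _ nz] _ _].
have := nonunitB lR n2 n1.
rewrite rmorph0 subr0 rmorphN opprK addrAC subrr add0r => /(nonunit_iota Rc) /eqP.
by rewrite (negbTE b0).
Qed.

Lemma meet_sym E E' : meet_transversally_once iota A E E' -> meet_transversally_once iota A E' E.
Proof.
move=> [R [oc oc'] [[e [e' [cp cp']]] uniq]]; exists R; split=> //; first by exists e', e.
by move=> R' h1 h2; exact: uniq.
Qed.

Lemma generated2C R (I : L -> Prop) (x y : L) : generated2 R I x y -> generated2 R I y x.
Proof.
move=> [Rx Ry hI]; split=> // z; rewrite hI.
by split=> -[a [a' [Ra Ra' ->]]]; exists a', a; split=> //; rewrite addrC.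
Qed.

(** The curves are the two axes [X n.+1 = 0] and [Y n.+1 = 0] of chart [n.+1], the main chart of one
    and the chart at infinity of the other. The coordinate on the first is the local equation of the
    second. *)
Lemma chain_meet n E E' : (n < 5)%N -> is_curve n E -> is_curve n.+1 E' ->
  meet_transversally_once iota A E E'.
Proof.
move=> h5 cE cE'; have hn : (n < 8)%N := ltn_trans h5 (isT : (5 < 8)%N).
have hn1 : (n.+1 < 8)%N := leq_ltn_trans h5 (isT : (5 < 8)%N).
have emc : mainc n = infc n.+1 by rewrite /mainc /infc h5 ltnS h5.
have ez : zi n.+1 = par n by rewrite /zi /par h5 ltnS h5.
have ei : eqi n.+1 = par n by rewrite /eqi /par h5 ltnS h5.
have npar0 R : nonunit R (par n) <-> nonunit R (par n - iota 0) by rewrite rmorph0 subr0.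
have npari R : cond_main n R -> nonunit R (pari n.+1).
  move=> [oR con nz]; have sR := proj1 (over_local oR).
  move: nz con; rewrite /cz /pari /mainc h5 => nz con; case: ifP => h4 //.
  have n4 : n = 4 by move: h5 h4; clear; do 5!case: n => [|n] //.
  rewrite n4 /= in nz con *; apply: nonunitMl => //.
  by have /contains_low [//|_ _ RU] := con; exact: subringX.
have toinf R : cond_main n R -> nonunit R (par n) -> cond_inf n.+1 R.
  by move=> [oR con nz] nt; split=> //; rewrite -?emc ?ez.
have [R1 [oc1 cR1 fR1 nt1]] := main_point 0 hn cE.
have [R2 [oc2 cR2 fR2 nt2]] := inf_point hn1 cE'.
have nt1' : nonunit R1 (par n) by apply/npar0.
have fR1' : R1 = fracs (cA (infc n.+1)) R1 by rewrite -emc.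
have e12 : R1 = R2 := inf_unique hn1 (toinf _ cR1 nt1') cR2 fR1' fR2 (npari _ cR1) nt2.
subst R2; exists R1; first by split.
have cp1 : curve_parameters R1 E (eqn n) (par n).
  by have := main_parameters hn cE (proj2 oc1) cR1 fR1 nt1; rewrite rmorph0 subr0.
have cp2 := inf_parameters hn1 cE' (proj2 oc2) cR2 fR2 nt2.
split.
  exists (eqn n), (par n); split=> //; split; first by apply: generated2C; case: cp1.
  by rewrite -ei; case: cp2.
move=> R' oc oc'; have [oR' hR'] := on_curve_cases hn1 cE' oc'.
have [_ hR] := on_curve_cases hn cE oc.
(* The main chart of curve [n.+1] does not meet curve [n], so a common point can only be the point
   at infinity of curve [n.+1], which is unique. *)
case: hR' => -[cR' fR' nt'].
  exfalso; have con' : contains R' (mainc n.+1) by case: cR'.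
  have := on_curve_contains hn cE oc (mainc_lt n.+1) con'.
  by rewrite /mainc /infc; move: h5; clear; do 5!case: n => [|n] //.
by move=> x; rewrite -(inf_unique hn1 cR' cR2 fR' fR2 nt' nt2).
Qed.

(** The common point is [sig = 0], [rho = bet m] in chart 6, the only chart shared by the two
    curves. There [sig] is the equation of curve 5 and the coordinate of curve [m]. *)
Lemma node_meet m E E' : (m == 6) || (m == 7) -> is_curve 5 E -> is_curve m E' ->
  meet_transversally_once iota A E E'.
Proof.
move=> hm cE cE'; have hm8 : (m < 8)%N by case/orP: hm => /eqP->.
have [emc einf ecz] : [/\ mainc m = 6, infc m = 7 & cz m = rho - iota (bet m)].
  by case/orP: hm => /eqP->.
have epar : par m = sig by case/orP: hm => /eqP->.
have [R1 [oc1 cR1 fR1 nt1]] := main_point (n := 5) (bet m) isT cE.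
have [R2 [oc2 cR2 fR2 nt2]] := main_point (n := m) 0 hm8 cE'.
have cR1m : cond_main m R1 by case: cR1 => oR con nz; split=> //; rewrite ?emc ?ecz.
have same R : cond_main 5 R -> cond_main m R -> R = fracs (cA 6) R -> R = R2.
  move=> c5 cm fR; apply: (main_unique hm8) => //; first by rewrite emc.
  have [oR _ ns] := c5; have [oR2 _ _] := cR2.
  apply: residue_iff nt2 => //; by rewrite epar rmorph0 subr0.
have e12 : R1 = R2 by exact: same.
subst R2; exists R1; first by split.
have cp1 := main_parameters (n := 5) isT cE (proj2 oc1) cR1 fR1 nt1.
have cp2 : curve_parameters R1 E' (eqn m) sig.
  by have := main_parameters hm8 cE' (proj2 oc2) cR2 fR2 nt2; rewrite rmorph0 subr0 epar.
split.
  exists sig, (eqn m); split=> //; split; first by apply: generated2C; case: cp2.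
  by case: cp1.
move=> R' oc oc' x.
have [_ [[c5 f5 _]|[[_ con _] _ _]]] := on_curve_cases (isT : (5 < 8)%N) cE oc; last first.
  by have := on_curve_contains hm8 cE' oc' (isT : (5 < 8)%N) con; rewrite emc einf.
have [_ [[cm _ _]|[[_ con _] _ _]]] := on_curve_cases hm8 cE' oc'; last first.
  by rewrite einf in con; have := on_curve_contains (isT : (5 < 8)%N) cE oc (isT : (7 < 8)%N) con.
by rewrite (same R' c5 cm f5).
Qed.

Hypothesis curves : forall n, (n < 8)%N -> exists E, is_curve n E.

Theorem charts_dual_graph : exceptional_dual_graph iota O A D8_graph.
Proof.
pose E n := epsilon (inhabits (fun=> True)) (is_curve n).
have hE n : (n < 8)%N -> is_curve n (E n) by move=> /curves; exact: epsilon_spec.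
exists (fun i : 'I_8 => E i); split.
- move=> i; split; first exact: (curve_exceptional (ltn_ord i) (hE _ (ltn_ord i))).
  exact: (curve_minus_two (ltn_ord i) (hE _ (ltn_ord i))).
- move=> i j /same_setE e; apply: val_inj.
  apply: (@curve_contains_both i j (E i)) => //; first exact: hE.
  by rewrite e; exact: hE.
- move=> E' /exceptional_is_curve [n hn cE']; exists (Ordinal hn) => x.
  by rewrite /= (curve_unique hn cE' (hE _ hn)).
- move=> [n hn] [m hm]; rewrite -val_eqE /D8_graph /=.
  have cn := hE n hn; have cm := hE m hm.
  have dis := curves_disjoint hn hm cn cm.
  move: (E n) (E m) cn cm dis => En Em; rewrite /mainc /infc.
  do 8?[case: n hn => [|n] hn //]; do 8?[case: m hm => [|m] hm //] => /= cn cm dis nm;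
    first [ by [] | by apply: dis | by apply: (chain_meet _ cn cm) | by apply: meet_sym; apply: (chain_meet _ cm cn)
          | by apply: (node_meet _ cn cm) | by apply: meet_sym; apply: (node_meet _ cm cn)
          | exact: ends_disjoint | by move=> R [oc oc']; exact: (ends_disjoint cm cn (conj oc' oc)) ].
Qed.

End Charts.

(** * Specializations of polynomial rings *)

Lemma mpoly_ring_ind (n : nat) (R : comNzRingType) (P : {mpoly R[n]} -> Prop) :
  (forall c, P c%:MP) -> (forall i, P 'X_i) ->
  (forall p q, P p -> P q -> P (p + q)) -> (forall p q, P p -> P q -> P (p * q)) ->
  forall p, P p.
Proof.
move=> hC hX hD hM; elim/mpolyind => [|c m p _ _ IH]; first by rewrite -mpolyC0.
apply: (hD) => //; rewrite -mul_mpolyC; apply: (hM) => //.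
rewrite mpolyXE_id; apply: big_ind => [||i _]; [by rewrite -mpolyC1 | exact: hM |].
elim: (m i) => [|d IHd]; first by rewrite expr0 -mpolyC1.
by rewrite exprS; exact: hM.
Qed.

Lemma rmorph_mmap (n : nat) (R : comNzRingType) (S T : comNzRingType)
  (f : {rmorphism R -> S}) (g : {rmorphism S -> T}) (f' : {rmorphism R -> T}) (x : 'I_n -> S)
  (p : {mpoly R[n]}) : (forall c, g (f c) = f' c) ->
  g (mmap f x p) = mmap f' (fun i => g (x i)) p.
Proof.
move=> hc; elim/mpoly_ring_ind: p => [c|i|p q hp hq|p q hp hq].
- by rewrite !mmapC hc.
- by rewrite !mmapX !mmap1U.
- by rewrite !rmorphD /= hp hq.
- by rewrite !rmorphM /= hp hq.
Qed.

Lemma eq_mmap (n : nat) (R : comNzRingType) (S : comNzRingType)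
  (f : {rmorphism R -> S}) (x y : 'I_n -> S) (p : {mpoly R[n]}) : x =1 y ->
  mmap f x p = mmap f y p.
Proof.
move=> hxy; elim/mpoly_ring_ind: p => [c|i|p q hp hq|p q hp hq].
- by rewrite !mmapC.
- by rewrite !mmapX !mmap1U.
- by rewrite !rmorphD /= hp hq.
- by rewrite !rmorphM /= hp hq.
Qed.

Section Specialization.
Variables (P : comNzRingType) (L : fieldType) (M : idomainType).
Variables (phi : {rmorphism P -> L}) (psi : {rmorphism P -> M}).
Hypothesis hker : forall p, phi p = 0 -> psi p = 0.

(** By [hker] the map [psi] factors through the image of [phi], and this is the localization of that
    image at the resulting prime. Evaluation at the origin gives the local ring of the surface;
    restriction of a chart to a parametrized curve gives the generic point of that curve. *)
Definition spec_ring (x : L) : Prop := exists p q : P, psi q != 0 /\ x = phi p / phi q.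

Lemma spec_neq0 q : psi q != 0 -> phi q != 0.
Proof. by apply: contraNneq => /hker ->. Qed.

Lemma spec_phi p : spec_ring (phi p).
Proof. by exists p, 1; rewrite !rmorph1 oner_neq0 divr1. Qed.

Lemma spec_subring : subring spec_ring.
Proof.
split=> [|_ _ [p [q [q0 ->]]] [p' [q' [q0' ->]]]]; first by rewrite -(rmorph1 phi); exact: spec_phi.
have h := spec_neq0 q0; have h' := spec_neq0 q0'.
split.
  exists (p * q' - q * p'), (q * q'); rewrite !rmorphM mulf_neq0 // rmorphB !rmorphM; split=> //.
  by field; rewrite h h'.
exists (p * p'), (q * q'); rewrite !rmorphM mulf_neq0 //; split=> //.
by field; rewrite h h'.
Qed.

Lemma spec_unit p : psi p != 0 -> unit_of spec_ring (phi p).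
Proof.
move=> h; split; [exact: spec_neq0 | exact: spec_phi |].
by exists 1, p; rewrite rmorph1 div1r.
Qed.

Lemma spec_nonunit p : nonunit spec_ring (phi p) <-> psi p = 0.
Proof.
split=> [[_ h]|h].
  by apply/eqP/negPn/negP => h0; apply: h; exact: spec_unit.
split; first exact: spec_phi.
move=> [p0 _ [p' [q' [q0 e]]]]; have h' := spec_neq0 q0.
have : phi (q' - p * p') = 0.
  by rewrite rmorphB rmorphM -[phi p'](mulfVK h') -e mulrA divff // mul1r subrr.
by move/hker; rewrite rmorphB rmorphM h mul0r subr0 => /eqP; rewrite (negbTE q0).
Qed.

Lemma spec_nonunitE x : nonunit spec_ring x <->
  exists p q : P, [/\ psi p = 0, psi q != 0 & x = phi p / phi q].
Proof.
split=> [[[p [q [q0 ->]]] nu]|[p [q [p0 q0 ->]]]].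
  exists p, q; split=> //; apply/eqP/negPn/negP => p0; apply: nu.
  by apply: (unit_ofM spec_subring); [exact: spec_unit | apply: unit_ofV; exact: spec_unit].
apply: (nonunitMr spec_subring); first by apply/spec_nonunit.
by case: (unit_ofV (spec_unit q0)).
Qed.

Lemma spec_local : local_subring spec_ring.
Proof.
split; first exact: spec_subring.
move=> _ _ /spec_nonunitE [p [q [p0 q0 ->]]] /spec_nonunitE [p' [q' [p0' q0' ->]]].
have h := spec_neq0 q0; have h' := spec_neq0 q0'.
apply/spec_nonunitE; exists (p * q' + q * p'), (q * q').
rewrite rmorphD !rmorphM p0 p0' mul0r mulr0 addr0 mulf_neq0 //; split=> //.
by rewrite rmorphD !rmorphM; field; rewrite h h'.
Qed.
End Specialization.

(** * Cancelling variables from multiples of a polynomial *)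

Section VariableDivision.
Variables (n : nat) (R : idomainType).
Implicit Types (p q g G : {mpoly R[n]}) (i : 'I_n).

Definition zero_var i (j : 'I_n) : {mpoly R[n]} := if j == i then 0 else 'X_j.
Definition subst0 i p : {mpoly R[n]} := mmap (@mpolyC n R) (zero_var i) p.

Lemma subst0_div i p : exists q, p = subst0 i p + 'X_i * q.
Proof.
rewrite /subst0; elim/mpoly_ring_ind: p => [c|j|p q [p' hp] [q' hq]|p q [p' hp] [q' hq]].
- by exists 0; rewrite mmapC mulr0 addr0.
- rewrite mmapX mmap1U /zero_var; case: eqVneq => [->|_]; first by exists 1; rewrite add0r mulr1.
  by exists 0; rewrite mulr0 addr0.
- exists (p' + q'); rewrite rmorphD /= {1}hp {1}hq; ring.
- exists (p' * q + mmap (@mpolyC n R) (zero_var i) p * q').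
  rewrite rmorphM /= {1}hp {1}hq; set a := mmap _ _ p; set c := mmap _ _ q.
  by rewrite [in RHS]hq -/c; ring.
Qed.

(** [D] is a nonzerodivisor modulo [G], a notion visibly stable under products. *)
Definition coprime_to (G D : {mpoly R[n]}) : Prop :=
  forall p g, D * p = G * g -> exists g', p = G * g'.

Lemma coprime_toM G D D' : coprime_to G D -> coprime_to G D' -> coprime_to G (D * D').
Proof. by move=> h h' p g; rewrite -mulrA => /h [g'] /h'. Qed.

Lemma coprime_toX G D m : coprime_to G D -> coprime_to G (D ^+ m).
Proof.
move=> h; elim: m => [|m IH]; last by rewrite exprS; exact: coprime_toM.
by move=> p g; rewrite expr0 mul1r => ->; exists g.
Qed.

(** The point [a] shows that [G] is nonzero modulo ['X_i]. In the domain of polynomials without that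
    variable, [G * g = 0] forces [g = 0], so ['X_i] divides [g] and can be cancelled. *)
Lemma coprime_to_var G i (a : 'I_n -> R) : a i = 0 -> G.@[a] != 0 -> coprime_to G 'X_i.
Proof.
move=> ai Ga p g e.
have G0 : subst0 i G != 0.
  apply: contraNneq Ga => G0.
  have [q ->] := subst0_div i G; rewrite G0 add0r.
  by rewrite mevalM mevalXU ai mul0r.
have g0 : subst0 i g = 0.
  have : subst0 i (G * g) = 0.
    by rewrite -e /subst0 rmorphM /= mmapX mmap1U /zero_var eqxx mul0r.
  by rewrite /subst0 rmorphM /= => /eqP; rewrite mulf_eq0 (negbTE G0) /= => /eqP.
have [q hq] := subst0_div i g; exists q.
apply: (mulfI (x := 'X_i)); last by rewrite e hq g0 add0r mulrCA.
apply: contraTneq isT => /(congr1 (meval (fun=> 1))).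
by rewrite mevalXU meval0 => /eqP; rewrite oner_eq0.
Qed.
End VariableDivision.

Section Coordinates.
Variable A : nmodType.
Definition coord3 (a b c : A) (i : 'I_3) : A := [:: a; b; c]`_i.
End Coordinates.

Definition i0 : 'I_3 := @Ordinal 3 0 isT.
Definition i1 : 'I_3 := @Ordinal 3 1 isT.
Definition i2 : 'I_3 := @Ordinal 3 2 isT.

Lemma ord3P (P : 'I_3 -> Prop) : P i0 -> P i1 -> P i2 -> forall i, P i.
Proof.
move=> h0 h1 h2 [[|[|[|//]]] hi].
- by rewrite (_ : Ordinal hi = i0) //; apply: val_inj.
- by rewrite (_ : Ordinal hi = i1) //; apply: val_inj.
- by rewrite (_ : Ordinal hi = i2) //; apply: val_inj.
Qed.

Definition surface (A : comNzRingType) (eta c0 b del r u W : A) : A :=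
  W ^+ 2 - r * u * (r + u * (eta * W + c0 * r ^+ 2 + b * u ^+ 2 + del * r * u)).

Lemma rmorph_surface (A B : comNzRingType) (f : {rmorphism A -> B}) (eta c0 b del r u W : A) :
  f (surface eta c0 b del r u W) =
  surface (f eta) (f c0) (f b) (f del) (f r) (f u) (f W).
Proof. by rewrite /surface !(rmorphB, rmorphD, rmorphM, rmorphXn). Qed.

Section LocalCurves.
Variables (k : closedFieldType) (L : fieldType) (iota : {rmorphism k -> L}).
Local Notation M := {mpoly k[3]}.
Local Notation pe P t := (map_poly iota P).[t].
Variables (x : 'I_3 -> L) (y : 'I_3 -> {poly k}).
Local Notation phi := (mmap iota x : M -> L).
Local Notation psi := (mmap (@polyC k) y : M -> {poly k}).
Hypothesis hker : forall p : M, phi p = 0 -> psi p = 0.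
Variables (base : 'I_3 -> L) (sigma : 'I_3 -> M).
Hypotheses (hphi : forall i, phi (sigma i) = base i) (hpsi : forall i, psi (sigma i) = 0).

Local Notation O := (spec_ring (mmap iota base) (meval (fun=> 0) : M -> k)).
Local Notation E := (spec_ring phi psi).
Local Notation sub := (mmap (@mpolyC 3 k) sigma).

Lemma phi_sub p : phi (sub p) = mmap iota base p.
Proof.
rewrite (rmorph_mmap (f' := iota)); last by move=> c; rewrite /= mmapC.
exact: eq_mmap.
Qed.

Lemma psi_sub p : psi (sub p) = (p.@[fun=> 0])%:P.
Proof.
rewrite (rmorph_mmap (f' := @polyC k)); last by move=> c; rewrite /= mmapC.
rewrite (rmorph_mmap (f' := @polyC k)) //.
by apply: eq_mmap => i; rewrite /= polyC0; exact: hpsi.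
Qed.

Lemma spec_base : sub_set O E.
Proof.
move=> _ [p [q [q0 ->]]]; exists (sub p), (sub q).
by rewrite /= !phi_sub psi_sub polyC_eq0.
Qed.

Lemma spec_adjoin (gens : seq L) : (forall i, x i \in gens) -> (forall c, O (iota c)) ->
  (forall g, g \in gens -> E g) ->
  sub_set (adjoin O gens) E /\ E = fracs (adjoin O gens) E.
Proof.
move=> hx Oc hg; have lE : local_subring E := spec_local hker.
have AE : sub_set (adjoin O gens) E.
  by apply: adjoin_min => //; [case: lE | exact: spec_base].
split=> //; apply: same_setE => z; split; last exact: fracs_sub.
have sA : subring (adjoin O gens) by exact: adjoin_subring.
have Ap p : adjoin O gens (phi p).
  elim/mpoly_ring_ind: p => [c|i|p q hp hq|p q hp hq].
  - by rewrite mmapC; apply: adjoin_base; exact: Oc.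
  - by rewrite mmapX mmap1U; apply: adjoin_gen.
  - by rewrite rmorphD; apply: (subringD sA).
  - by rewrite rmorphM; apply: (subringM sA).
by move=> [p [q [q0 ->]]]; exists (phi p), (phi q); split=> //; apply: (spec_unit hker).
Qed.

Lemma spec_transcendental i : y i = 'X -> transcendental iota E (x i).
Proof.
move=> yi P P0.
have [q [<- eq]] : exists q, phi q = pe P (x i) /\ psi q = P.
  elim/poly_ind: {P0} P => [|P c [q [hq eq]]].
    by exists 0; rewrite pe0 !rmorph0.
  exists (q * 'X_i + c%:MP).
  rewrite peD peM peX peC !rmorphD !rmorphM /= hq eq.
  by rewrite !mmapX !mmap1U !mmapC yi.
by apply: (spec_unit hker); rewrite /= eq.
Qed.

End LocalCurves.

Section ChartKernel.
Variables (k : closedFieldType) (L : fieldType) (iota : {rmorphism k -> L}).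
Local Notation M := {mpoly k[3]}.
Variables (x : 'I_3 -> L) (y : 'I_3 -> {poly k}) (base : 'I_3 -> L) (sigma : 'I_3 -> M).
Local Notation phi := (mmap iota x : M -> L).
Local Notation psi := (mmap (@polyC k) y : M -> {poly k}).
Local Notation sub := (mmap (@mpolyC 3 k) sigma : M -> M).
Variables (f G d D : M).
Hypothesis hphi : forall i, phi (sigma i) = base i.
Hypothesis hbase : forall p : M, mmap iota base p = 0 -> exists g, p = f * g.
Hypothesis hd : forall i, exists m p, sub d ^+ m * 'X_i = sub p.
Hypotheses (hf : sub f = G * D) (hco : coprime_to G (sub d)) (hG : psi G = 0).

(** Multiplied by a power of [d], the polynomial [p] becomes a polynomial in [r], [u], [W], which is
    a multiple of [f] once it vanishes in [L]. The pull-back of [f] is the strict transform [G]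
    times the exceptional factor [D]; cancelling the power of [d] shows that [G] divides [p], and
    [psi] kills [G]. *)
Lemma chart_kernel p : phi p = 0 -> psi p = 0.
Proof.
have [m [p' e]] : exists m p', sub d ^+ m * p = sub p'.
  elim/mpoly_ring_ind: p => [c|i|p q [m [p' hp]] [m' [q' hq]]|p q [m [p' hp]] [m' [q' hq]]].
  - by exists 0%N, c%:MP; rewrite expr0 mul1r mmapC.
  - exact: hd.
  - exists (m + m')%N, (d ^+ m' * p' + d ^+ m * q').
    by rewrite rmorphD !rmorphM /= !rmorphXn /= -hp -hq exprD; ring.
  - exists (m + m')%N, (p' * q'); rewrite rmorphM /= -hp -hq exprD; ring.
move=> p0; have /hbase [g eg] : mmap iota base p' = 0.
  by rewrite -(phi_sub hphi) -e rmorphM /= p0 mulr0.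
have [g' ->] : exists g', p = G * g'.
  by apply: (coprime_toX (m := m) hco (g := D * sub g)); rewrite e eg rmorphM /= hf mulrA.
by rewrite rmorphM /= hG mul0r.
Qed.
End ChartKernel.

Lemma exprMnn (A : comNzRingType) (x y : A) m n p :
  (x ^+ m * y ^+ n) ^+ p = x ^+ (m * p) * y ^+ (n * p).
Proof. by rewrite exprMn !exprM. Qed.

(** [N] stands for [X 5 = h^6 / r], so the first factor on the right is the equation [hU] of [U] and
    the second is the exceptional part. *)
Lemma chain_identity (A : comNzRingType) (eta c0 b del R h Z N : A) : R * N = h ^+ 6 ->
  surface eta c0 b del R (h ^+ 2 * Z) (h * R) =
  (Z * (1 + (eta * Z * h ^+ 3 + c0 * h ^+ 2 * Z * R + b * Z ^+ 3 * N + del * h ^+ 4 * Z ^+ 2))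
   - 1) * - (R ^+ 2 * h ^+ 2).
Proof.
move=> e; rewrite /surface; apply/eqP; rewrite -subr_eq0; apply/eqP.
transitivity (b * R * h ^+ 2 * Z ^+ 4 * (R * N - h ^+ 6)); first by ring.
by rewrite e subrr mulr0.
Qed.

Section ChainCharts.
Variables (k : closedFieldType) (L : fieldType) (iota : {rmorphism k -> L}).
Variables (eta c0 b del : k) (r u W : L).
Local Notation M := {mpoly k[3]}.
Local Notation f := (surface eta%:MP c0%:MP b%:MP del%:MP 'X_i0 'X_i1 'X_i2 : M).
Local Notation base := (coord3 r u W).
Hypothesis hbase : forall p : M, mmap iota base p = 0 -> exists g, p = f * g.

Variable j : nat.
Hypotheses (j0 : (0 < j)%N) (j6 : (j < 6)%N).
Variables (X Y U : L).
Hypotheses (hr : r = X ^+ j * Y ^+ j.+1) (hu : u = (X * Y) ^+ 2 * U)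
  (hW : W = X ^+ j.+1 * Y ^+ j.+2).

Lemma chain_sigma_phi i : mmap iota (coord3 X Y U)
    (coord3 ('X_i0 ^+ j * 'X_i1 ^+ j.+1) (('X_i0 * 'X_i1) ^+ 2 * 'X_i2)
            ('X_i0 ^+ j.+1 * 'X_i1 ^+ j.+2) i : M) = base i.
Proof.
have hX l : mmap iota (coord3 X Y U) ('X_l : M) = coord3 X Y U l by rewrite mmapX mmap1U.
elim/ord3P: i; rewrite {2 3}/coord3 /=.
- by rewrite rmorphM !rmorphXn /= !hX.
- by rewrite rmorphM rmorphXn rmorphM /= !hX.
- by rewrite rmorphM !rmorphXn /= !hX.
Qed.

Lemma chain_kernel p : mmap iota (coord3 X Y U) p = 0 ->
  mmap (@polyC k) (coord3 0 'X 1) p = 0.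
Proof.
have [R eR] : exists R : M, R = 'X_i0 ^+ j * 'X_i1 ^+ j.+1 by eexists.
have [h eh] : exists h : M, h = 'X_i0 * 'X_i1 by eexists.
have [Z eZ] : exists Z : M, Z = 'X_i2 by eexists.
have [W' eW'] : exists W' : M, W' = 'X_i0 ^+ j.+1 * 'X_i1 ^+ j.+2 by eexists.
(* These are the exponents of [h^6 / r] in chart [j]. Since [j < 6], the polynomial vanishes on the
   curve [X = 0]. *)
have [N eN] : exists N : M, N = 'X_i0 ^+ (6 - j) * 'X_i1 ^+ (5 - j) by eexists.
have [G eG] : exists G : M, G = Z * (1 + (eta%:MP * Z * h ^+ 3 + c0%:MP * h ^+ 2 * Z * R
    + b%:MP * Z ^+ 3 * N + del%:MP * h ^+ 4 * Z ^+ 2)) - 1 by eexists.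
have eRN : R * N = h ^+ 6.
  have e1 : (j + (6 - j) = 6)%N by rewrite subnKC // ltnW.
  have e2 : (j.+1 + (5 - j) = 6)%N by rewrite addSn subnKC.
  by rewrite eR eN eh mulrACA -!exprD e1 e2 exprMn.
have eW : W' = h * R by rewrite eW' eR eh mulrACA -!exprS.
have sE i : mmap (@mpolyC 3 k) (coord3 R (h ^+ 2 * Z) W') 'X_i = coord3 R (h ^+ 2 * Z) W' i.
  by rewrite mmapX mmap1U.
have sD : mmap (@mpolyC 3 k) (coord3 R (h ^+ 2 * Z) W') ('X_i0 * 'X_i2 : M) = R * W'.
  by rewrite rmorphM /= !sE.
have G0 : G.@[fun=> 0] != 0.
  rewrite eG mevalB mevalM eZ mevalXU mul0r meval1 sub0r oppr_eq0; exact: oner_neq0.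
have coX i : coprime_to G 'X_i := coprime_to_var (erefl _) G0.
apply: (chart_kernel (sigma := coord3 R (h ^+ 2 * Z) W') _ hbase (d := 'X_i0 * 'X_i2) _
  (G := G) (D := - (R ^+ 2 * h ^+ 2))).
- by rewrite eR eh eZ eW'; exact: chain_sigma_phi.
(* The exponents of [r] and [W] in [X], [Y] form the matrix [(j, j+1; j+1, j+2)] of determinant -1,
   so [X = W^(j+1) / r^(j+2)] and [Y = r^(j+1) / W^j]. This is why [r W] is a sufficient
   denominator. *)
- have eA : R ^+ j.+2 * 'X_i0 = W' ^+ j.+1.
    have en : (j * j.+2).+1 = (j.+1 * j.+1)%N by ring.
    by rewrite eR eW' !exprMnn mulrAC -exprSr en [(j.+2 * _)%N]mulnC.
  have eB : W' ^+ j * 'X_i1 = R ^+ j.+1.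
    have en : (j.+2 * j).+1 = (j.+1 * j.+1)%N by ring.
    by rewrite eR eW' !exprMnn -mulrA -exprSr en [(j * _)%N]mulnC.
  rewrite sD; elim/ord3P.
  + exists j.+2, ('X_i2 ^+ (j.+1 + j.+2)).
    by rewrite rmorphXn /= sE exprMn mulrAC eA -exprD.
  + exists j, ('X_i0 ^+ (j + j.+1)).
    by rewrite rmorphXn /= sE exprMn -mulrA eB -exprD.
  + exists 2, ('X_i0 ^+ 4 * 'X_i1).
    rewrite rmorphM /= rmorphXn /= !sE -eZ /coord3 /= eW; ring.
- rewrite rmorph_surface /= !mmapC !sE /coord3 /= eW eG; exact: chain_identity.
- by rewrite sD eR eW'; apply: coprime_toM; apply: coprime_toM; apply: coprime_toX; exact: coX.
- have hZ : mmap (@polyC k) (coord3 0 'X 1) Z = 1 by rewrite eZ mmapX mmap1U.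
  have hh : mmap (@polyC k) (coord3 0 'X 1) h = 0.
    by rewrite eh rmorphM /= !mmapX !mmap1U mul0r.
  have hN : mmap (@polyC k) (coord3 0 'X 1) N = 0.
    by rewrite eN rmorphM /= !rmorphXn /= !mmapX !mmap1U /coord3 /= expr0n subn_eq0 leqNgt j6 mul0r.
  rewrite eG rmorphB rmorph1 rmorphM /= hZ mul1r rmorphD rmorph1 /=.
  by rewrite !rmorphD !rmorphM /= ?rmorphXn /= ?hh ?hN ?expr0n /= !(mulr0, mul0r, addr0) /= subrr.
Qed.
End ChainCharts.

Lemma node_identity (A : comNzRingType) (eta c0 b del sg rh om : A) :
  let v := om * sg in
  surface eta c0 b del (rh * v ^+ 3) v (om * v ^+ 3) =
  (om - sg * rh * (rh + b + v * (eta * om + c0 * rh ^+ 2 * v ^+ 3 + del * rh * v)))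
  * (v ^+ 6 * om).
Proof. by rewrite /surface /=; ring. Qed.

Section NodeChart.
Variables (k : closedFieldType) (L : fieldType) (iota : {rmorphism k -> L}).
Variables (eta c0 b del : k) (r u W : L).
Local Notation M := {mpoly k[3]}.
Local Notation f := (surface eta%:MP c0%:MP b%:MP del%:MP 'X_i0 'X_i1 'X_i2 : M).
Local Notation base := (coord3 r u W).
Hypothesis hbase : forall p : M, mmap iota base p = 0 -> exists g, p = f * g.

Variables (sg rh om : L).
Hypotheses (hr : r = rh * u ^+ 3) (hu : u = om * sg) (hW : W = om * u ^+ 3).

Definition node_sigma : 'I_3 -> M :=
  coord3 ('X_i1 * ('X_i2 * 'X_i0) ^+ 3) ('X_i2 * 'X_i0) ('X_i2 * ('X_i2 * 'X_i0) ^+ 3).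

Lemma node_sigma_phi i : mmap iota (coord3 sg rh om) (node_sigma i) = base i.
Proof.
have hX l : mmap iota (coord3 sg rh om) ('X_l : M) = coord3 sg rh om l by rewrite mmapX mmap1U.
rewrite /node_sigma; elim/ord3P: i; rewrite {2 3}/coord3 /=.
- by rewrite rmorphM rmorphXn rmorphM /= !hX /= hr hu.
- by rewrite rmorphM /= !hX /= hu.
- by rewrite rmorphM rmorphXn rmorphM /= !hX /= hW hu.
Qed.

(** Along [om = 0] the equation of chart 6 becomes [sig * rho * (rho + b) = 0], so the three factors
    provide curves 5, 6 and 7 in one statement. *)
Lemma node_kernel (y0 y1 : {poly k}) : y0 * y1 * (y1 + b%:P) = 0 ->
  forall p, mmap iota (coord3 sg rh om) p = 0 -> mmap (@polyC k) (coord3 y0 y1 0) p = 0.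
Proof.
move=> hy.
have [v ev] : exists v : M, v = 'X_i2 * 'X_i0 by eexists.
have [Z eZ] : exists Z : M, Z = 'X_i2 by eexists.
have [R eR] : exists R : M, R = 'X_i1 by eexists.
have [T eT] : exists T : M, T = 'X_i0 by eexists.
have [G eG] : exists G : M, G = Z - T * R * (R + b%:MP + v *
  (eta%:MP * Z + c0%:MP * R ^+ 2 * v ^+ 3 + del%:MP * R * v)) by eexists.
have ev' : v = Z * T by rewrite ev eZ eT.
have esig : node_sigma = coord3 (R * v ^+ 3) v (Z * v ^+ 3) by rewrite /node_sigma ev eZ eR.
have sE i : mmap (@mpolyC 3 k) (coord3 (R * v ^+ 3) v (Z * v ^+ 3)) 'X_i
    = coord3 (R * v ^+ 3) v (Z * v ^+ 3) i.
  by rewrite mmapX mmap1U.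
have sD : mmap (@mpolyC 3 k) (coord3 (R * v ^+ 3) v (Z * v ^+ 3)) ('X_i1 * 'X_i2 : M)
    = v * (Z * v ^+ 3).
  by rewrite rmorphM /= !sE.
have Gev a : v.@[a] = 0 -> G.@[a] = a i2 - a i0 * a i1 * (a i1 + b).
  by move=> va; rewrite eG mevalB !mevalM !mevalD !mevalM va eZ eR eT !mevalXU !mevalC mul0r addr0.
have vev a : v.@[a] = a i2 * a i0 by rewrite ev mevalM !mevalXU.
have co0 : coprime_to G 'X_i0.
  apply: (@coprime_to_var _ _ _ _ (coord3 0 0 1)) => //.
  by rewrite Gev ?vev /coord3 /= !(mulr0, mul0r) ?subr0 ?oner_neq0.
have co2 : coprime_to G 'X_i2.
  (* A point of the plane [om = 0] off the surface is needed: at [sig = 1], [rho = c] the polynomial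
     [G] takes the value -1. *)
  have [c hc] : exists c : k, c * (c + b) = 1.
    have [c /eqP] := @solve_monicpoly k 2 (fun i => if i == 0 then 1 else - b) isT.
    rewrite !big_ord_recl big_ord0 /= expr0 mulr1 addr0 expr1 mulNr => /eqP hc.
    by exists c; rewrite mulrDr -expr2 hc [c * b]mulrC addrNK.
  apply: (@coprime_to_var _ _ _ _ (coord3 1 c 0)) => //.
  by rewrite Gev ?vev /coord3 /= ?mul0r // mul1r hc sub0r oppr_eq0 oner_neq0.
have cov : coprime_to G v by rewrite ev; apply: coprime_toM.
rewrite -esig in sD sE.
apply: (chart_kernel (sigma := node_sigma) node_sigma_phi hbase (d := 'X_i1 * 'X_i2) _
  (G := G) (D := v ^+ 6 * Z)).
(* The denominator is [u W]: [sig = u^4 / W], [rho = r / u^3] and [om = W / u^3] become polynomials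
   after multiplication by the powers 1, 3 and 3 of it. *)
- rewrite sD; elim/ord3P.
  + exists 1, ('X_i1 ^+ 5).
    by rewrite rmorphXn /= sE esig /coord3 /= -eT expr1 ev'; ring.
  + exists 3, ('X_i2 ^+ 3 * 'X_i0).
    by rewrite rmorphM /= rmorphXn /= !sE esig -eR /coord3 /=; ring.
  + exists 3, ('X_i2 ^+ 4).
    by rewrite rmorphXn /= !sE esig -eZ /coord3 /=; ring.
- rewrite rmorph_surface /= !mmapC !sE esig /coord3 /= eG ev'; exact: node_identity.
- rewrite sD; apply: coprime_toM => //; apply: coprime_toM; first by rewrite eZ.
  exact: coprime_toX.
- have hv : mmap (@polyC k) (coord3 y0 y1 0) v = 0.
    by rewrite ev rmorphM /= !mmapX !mmap1U mul0r.
  have hZ : mmap (@polyC k) (coord3 y0 y1 0) Z = 0 by rewrite eZ mmapX mmap1U.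
  have hR : mmap (@polyC k) (coord3 y0 y1 0) R = y1 by rewrite eR mmapX mmap1U.
  have hT : mmap (@polyC k) (coord3 y0 y1 0) T = y0 by rewrite eT mmapX mmap1U.
  rewrite eG rmorphB /= hZ sub0r !rmorphM /= hT hR !rmorphD /= hR mmapC rmorphM /= hv mul0r addr0 hy.
  by rewrite oppr0.
Qed.
End NodeChart.

(** * The local ring of the affine surface *)

Section LocalD8.
Variables (k : closedFieldType) (L : fieldType) (iota : {rmorphism k -> L}).
Variables (eta c0 b del : k) (r u W : L).
Local Notation M := {mpoly k[3]}.
Local Notation f := (surface eta%:MP c0%:MP b%:MP del%:MP 'X_i0 'X_i1 'X_i2 : M).
Local Notation base := (coord3 r u W).
Local Notation phi0 := (mmap iota base : M -> L).
Local Notation psi0 := (meval (fun=> 0) : M -> k).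
Local Notation O := (spec_ring (mmap iota base) (meval (fun=> 0) : M -> k)).
Hypothesis b0 : b != 0.
Hypothesis hbase : forall p : M, phi0 p = 0 -> exists g, p = f * g.
Hypothesis hsurf : surface (iota eta) (iota c0) (iota b) (iota del) r u W = 0.

Lemma baseE i : phi0 'X_i = base i. Proof. by rewrite mmapX mmap1U. Qed.

(** A relation in [L] is a multiple of [f], hence holds at every rational point of the surface.
    Points on the axes thus show that [r], [u] and [W] are nonzero in [L]. *)
Lemma surface_eval (a : 'I_3 -> k) p : phi0 p = 0 ->
  surface eta c0 b del (a i0) (a i1) (a i2) = 0 -> p.@[a] = 0.
Proof.
move=> /hbase [g ->] ha; rewrite mevalM.
have -> : f.@[a] = surface eta c0 b del (a i0) (a i1) (a i2).
  by rewrite (rmorph_surface (meval a)) /= !mevalC !mevalXU.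
by rewrite ha mul0r.
Qed.

Lemma origin_kernel p : phi0 p = 0 -> psi0 p = 0.
Proof. by move=> h; apply: surface_eval => //; rewrite /surface; ring. Qed.

Lemma r_neq0 : r != 0.
Proof.
apply/eqP => e; have : phi0 'X_i0 = 0 by rewrite baseE.
move/(@surface_eval (coord3 1 0 0)); rewrite mevalXU /coord3 /= => /(_ _) /eqP.
by rewrite oner_eq0 => H; apply: notF; apply: H; rewrite /surface; ring.
Qed.

Lemma u_neq0' : u != 0.
Proof.
apply/eqP => e; have : phi0 'X_i1 = 0 by rewrite baseE.
move/(@surface_eval (coord3 0 1 0)); rewrite mevalXU /coord3 /= => /(_ _) /eqP.
by rewrite oner_eq0 => H; apply: notF; apply: H; rewrite /surface; ring.
Qed.

Lemma W_neq0 : W != 0.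
Proof.
apply/eqP => e; move: hsurf; rewrite /surface e expr0n /= sub0r => /eqP.
rewrite oppr_eq0 mulf_eq0 mulf_eq0 (negbTE r_neq0) (negbTE u_neq0') /= mulr0 add0r => /eqP h.
have : phi0 ('X_i0 + 'X_i1 * (c0%:MP * 'X_i0 ^+ 2 + b%:MP * 'X_i1 ^+ 2 + del%:MP * 'X_i0 * 'X_i1)) = 0.
  rewrite !(rmorphD, rmorphM) /= !baseE !mmapC; exact: h.
move/(@surface_eval (coord3 1 0 0)).
rewrite !(mevalD, mevalM) !mevalXU /coord3 /= mul0r addr0 => /(_ _) /eqP.
by rewrite oner_eq0 => H; apply: notF; apply: H; rewrite /surface; ring.
Qed.

Lemma O_local : local_subring O. Proof. exact: spec_local origin_kernel. Qed.
Lemma O_iota c : O (iota c).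
Proof. by have := spec_phi phi0 psi0 c%:MP; rewrite /= mmapC. Qed.
Lemma O_nonunit i : nonunit O (base i).
Proof. by rewrite -baseE; apply/(spec_nonunit origin_kernel); rewrite /= mevalXU. Qed.

Lemma mpoly_at_origin (p : M) : exists p0 p1 p2,
  p = (p.@[fun=> 0])%:MP + ('X_i0 * p0 + 'X_i1 * p1 + 'X_i2 * p2).
Proof.
elim/mpoly_ring_ind: p => [c|i|p q [p0 [p1 [p2 hp]]] [q0 [q1 [q2 hq]]]|p q [p0 [p1 [p2 hp]]] [q0 [q1 [q2 hq]]]].
- by exists 0, 0, 0; rewrite mevalC; ring.
- elim/ord3P: i; rewrite mevalXU mpolyC0.
  + by exists 1, 0, 0; ring.
  + by exists 0, 1, 0; ring.
  + by exists 0, 0, 1; ring.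
- exists (p0 + q0), (p1 + q1), (p2 + q2).
  by rewrite mevalD mpolyCD {1}hp {1}hq; move: (_.@[_]) (_.@[_]) => x y; ring.
- exists (p0 * q + (p.@[fun=> 0])%:MP * q0), (p1 * q + (p.@[fun=> 0])%:MP * q1),
    (p2 * q + (p.@[fun=> 0])%:MP * q2).
  rewrite mevalM mpolyCM {1}hp; move: (p.@[_]) => x.
  rewrite mulrDl {1}hq; move: (q.@[_]) => y; ring.
Qed.

Lemma O_maximal x : O x -> exists c a1 a2 a3,
  [/\ O a1, O a2, O a3 & x = iota c + (r * a1 + u * a2 + W * a3)].
Proof.
move=> [p [q [q0 ->]]]; have lO := O_local; have sO := proj1 lO.
have [p0 [p1 [p2 e]]] := mpoly_at_origin (p - ((psi0 p) / (psi0 q))%:MP * q).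
have uq : unit_of O (phi0 q) := spec_unit origin_kernel q0.
have [h0 Oq Oqv] := uq.
exists (psi0 p / psi0 q), (phi0 p0 / phi0 q), (phi0 p1 / phi0 q), (phi0 p2 / phi0 q).
split; try by [apply: (subringM sO) => //; exact: (spec_phi phi0 psi0)].
have : phi0 (p - ((psi0 p) / (psi0 q))%:MP * q) =
    phi0 ('X_i0 * p0 + 'X_i1 * p1 + 'X_i2 * p2).
  by rewrite {1}e mevalB mevalM mevalC divfK // subrr mpolyC0 add0r.
rewrite rmorphB !rmorphD !rmorphM /= !baseE mmapC => /eqP; rewrite subr_eq => /eqP ->.
by rewrite mmapC /coord3 /= mulrDl mulfK // addrC !mulrDl -!mulrA.
Qed.

Let h := W / r.
Let U := u / h ^+ 2.
Let X j := h ^+ j.+1 / r.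
Let Y j := r / h ^+ j.
Let rho := r / u ^+ 3.
Let om := W / u ^+ 3.
Let sig := u ^+ 4 / W.
Let tau := W / u ^+ 4.
Let s := u * (iota eta * om + iota c0 * rho ^+ 2 * u ^+ 3 + iota del * rho * u).
Let kap := rho * (rho + iota b + s).

Lemma W_sqr : W ^+ 2 = r * u * (r + u * (iota eta * W + iota c0 * r ^+ 2 + iota b * u ^+ 2 + iota del * r * u)).
Proof. by move/eqP: hsurf; rewrite /surface subr_eq0 => /eqP. Qed.

Lemma h_neq0 : h != 0.
Proof. by rewrite mulf_neq0 ?W_neq0 // invr_neq0 // r_neq0. Qed.

Let nr := r_neq0.
Let nu := u_neq0'.
Let nW := W_neq0.
Let nh := h_neq0.

Fact chart_eqs : [/\ W = h * r, u = h ^+ 2 * U, forall j, X j * Y j = h,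
  forall j, X j.+1 = h * X j & forall j, Y j = h * Y j.+1] /\
  [/\ forall j, X j * Y j.+1 = 1, Y 0 = r,
  U * (1 + (iota eta * u * h + iota c0 * r * u + iota b * (U ^+ 3 * X 5)
                 + iota del * u ^+ 2)) = 1, rho * (U ^+ 3 * X 5) = 1 & om = h * rho] /\
  [/\ sig = h * U ^+ 4 * X 5, sig * tau = 1, u = om * sig, om = u * tau & om = sig * kap] /\
  [/\ kap = u * tau ^+ 2, U * (rho + iota b + s) = rho, r = rho * u ^+ 3 & W = om * u ^+ 3].
Proof.
have fr := W_sqr.
have hn j : h ^+ j != 0 by rewrite expf_neq0.
split; [split | split; [split | split; split]].
- by rewrite /h divfK.
- by rewrite /U mulrC divfK.
- by move=> j; rewrite /X /Y exprS; field; rewrite nr hn.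
- by move=> j; rewrite /X [h ^+ j.+2]exprS mulrA.
- by move=> j; rewrite /Y exprS; field; rewrite nh hn.
- by move=> j; rewrite /X /Y; field; rewrite nr hn.
- by rewrite /Y expr0 divr1.
(* The quotient is 1 by the surface equation; inserting it leaves an identity of rational functions.
   The relations for [kap] and [hUr] below are treated in the same way. *)
- transitivity ((r * u * (r + u * (iota eta * W + iota c0 * r ^+ 2 + iota b * u ^+ 2 + iota del * r * u))) / W ^+ 2); last by rewrite -fr divff // expf_neq0.
  by rewrite /U /X /h; field; rewrite nr nW.
- by rewrite /rho /U /X /h; field; rewrite nr nW nu.
- by rewrite /om /h /rho; field; rewrite nr nu.
- by rewrite /sig /h /U /X /h; field; rewrite nr nW.
- by rewrite /sig /tau; field; rewrite nW nu.
- by rewrite /sig /om; field; rewrite nW nu.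
- by rewrite /tau /om; field; rewrite nu.
- transitivity ((r * u * (r + u * (iota eta * W + iota c0 * r ^+ 2 + iota b * u ^+ 2 + iota del * r * u))) / (W * u ^+ 3)).
    by rewrite -fr /om; field; rewrite nW nu.
  by rewrite /sig /kap /s /rho /om; field; rewrite nW nu.
- transitivity ((r * u * (r + u * (iota eta * W + iota c0 * r ^+ 2 + iota b * u ^+ 2 + iota del * r * u))) / u ^+ 7).
    by rewrite /kap /s /rho /om; field; rewrite nu.
  by rewrite -fr /tau; field; rewrite nu.
- transitivity ((r * u * (r + u * (iota eta * W + iota c0 * r ^+ 2 + iota b * u ^+ 2 + iota del * r * u))) * r / (W ^+ 2 * u ^+ 3)).
    by rewrite /U /h /s /rho /om; field; rewrite nW nu nr.
  by rewrite -fr /rho; field; rewrite nW nu.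
- by rewrite /rho divfK // expf_neq0.
- by rewrite /om divfK // expf_neq0.
Qed.

Local Notation curve := (is_curve iota b r u W U rho om sig tau X Y O).

Lemma specialized_curve n (x : 'I_3 -> L) (y : 'I_3 -> {poly k}) (sigma : 'I_3 -> M)
    (i : 'I_3) (z : M) :
  (forall p : M, mmap iota x p = 0 -> mmap (@polyC k) y p = 0) ->
  (forall l, mmap iota x (sigma l) = base l) -> (forall l, mmap (@polyC k) y (sigma l) = 0) ->
  chart U rho om sig tau X Y (mainc n) = [:: x i0; x i1; x i2] ->
  par rho sig Y n = x i -> y i = 'X ->
  cz iota b rho sig X n = mmap iota x z -> mmap (@polyC k) y z = 0 ->
  exists E, curve n E.
Proof.
move=> hk hs hz ec ep hy ecz hz0.
pose E := spec_ring (mmap iota x : M -> L) (mmap (@polyC k) y : M -> {poly k}).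
have lE : local_subring E by exact: spec_local hk.
have OE : sub_set O E by exact: (spec_base hs hz).
have hx l : x l \in chart U rho om sig tau X Y (mainc n).
  by rewrite ec; elim/ord3P: l; rewrite !inE eqxx ?orbT.
have Ex l : E (x l).
  have -> : x l = mmap iota x 'X_l by rewrite mmapX mmap1U.
  exact: (spec_phi (mmap iota x : M -> L) (mmap (@polyC k) y : M -> {poly k})).
have hE g : g \in chart U rho om sig tau X Y (mainc n) -> E g.
  by rewrite ec !inE => /or3P [] /eqP->.
have nE l : nonunit E (base l) by rewrite -hs; apply/(spec_nonunit hk); exact: hz.
have [AE fE] := spec_adjoin hk hs hz hx O_iota hE.
exists E; split=> //; last by rewrite ep; apply: spec_transcendental.
split=> //; last by rewrite ecz; apply/(spec_nonunit hk).
split=> //; split; [exact: (nE i0) | exact: (nE i1) | exact: (nE i2)].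
Qed.

(** Each generic point is a specialization of the main chart to [k[t]]: [(X, Y, U) = (0, t, 1)] on
    the chain, and [(sig, rho, om) = (0, t, 0)], [(t, 0, 0)], [(t, - b, 0)] for curves 5, 6, 7. *)
Lemma curves_exist n : (n < 8)%N -> exists E, curve n E.
Proof.
have [[hW hu hXY hXS hYS] [[hXY1 hY0 hU hrho hom] [[hsig hst huos hout hosk] [hkt hUr hrr hWo]]]] := chart_eqs.
move=> hn; have hX (y : 'I_3 -> {poly k}) l : mmap (@polyC k) y ('X_l : M) = y l.
  by rewrite mmapX mmap1U.
have hXL (x : 'I_3 -> L) l : mmap iota x ('X_l : M) = x l by rewrite mmapX mmap1U.
have hz y0 y1 l : mmap (@polyC k) (coord3 y0 y1 0) (node_sigma k l) = 0.
  rewrite /node_sigma; elim/ord3P: l; rewrite {2}/coord3 /=.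
  - by rewrite rmorphM rmorphXn rmorphM /= !hX mul0r expr0n mulr0.
  - by rewrite rmorphM /= !hX mul0r.
  - by rewrite rmorphM rmorphXn rmorphM /= !hX mul0r.
have hk y0 y1 : y0 * y1 * (y1 + b%:P) = 0 -> forall p : M,
    mmap iota (coord3 sig rho om) p = 0 -> mmap (@polyC k) (coord3 y0 y1 0) p = 0.
  by move=> e; exact: (node_kernel hbase hrr huos hWo e).
have hs := node_sigma_phi iota hrr huos hWo.
case: (ltnP n 5) => h5.
  have er : r = X n.+1 ^+ n.+1 * Y n.+1 ^+ n.+2.
    by rewrite [Y n.+1 ^+ _]exprSr mulrA -exprMn hXY -hY0 (YD hYS 0 n.+1) add0n.
  have eu : u = (X n.+1 * Y n.+1) ^+ 2 * U by rewrite hXY.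
  have eW : W = X n.+1 ^+ n.+2 * Y n.+1 ^+ n.+3.
    by rewrite [X n.+1 ^+ _]exprS [Y n.+1 ^+ _]exprS mulrACA -er hXY hW.
  apply: (@specialized_curve n (coord3 (X n.+1) (Y n.+1) U) (coord3 0 'X 1) _ i1 'X_i0
     (chain_kernel hbase (h5 : (n.+1 < 6)%N) er eu eW) (chain_sigma_phi iota er eu eW)) => //.
  - elim/ord3P; rewrite {2}/coord3 /=.
    + by rewrite rmorphM !rmorphXn /= !hX expr0n mul0r.
    + by rewrite rmorphM rmorphXn rmorphM /= !hX mul0r expr0n mul0r.
    + by rewrite rmorphM !rmorphXn /= !hX expr0n mul0r.
  - by rewrite /mainc h5 /chart ltnS h5.
  - by rewrite /par h5.
  - by rewrite /cz h5 hXL.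
  - by rewrite hX.
have [->|n5] := eqVneq n 5.
  apply: (@specialized_curve 5 (coord3 sig rho om) (coord3 0 'X 0) _ i1 'X_i0 (hk _ _ _) hs (hz _ _)) => //.
  - by rewrite !mul0r.
  - by rewrite /cz /= hXL.
  - by rewrite hX.
have [->|n6] := eqVneq n 6.
  apply: (@specialized_curve 6 (coord3 sig rho om) (coord3 'X 0 0) _ i0 'X_i1 (hk _ _ _) hs (hz _ _)) => //.
  - by rewrite mulr0 mul0r.
  - by rewrite /cz /bet /= hXL rmorph0 subr0.
  - by rewrite hX.
have -> : n = 7 by move: h5 hn n5 n6; clear; do 8!case: n => [|n] //.
apply: (@specialized_curve 7 (coord3 sig rho om) (coord3 'X (- b)%:P 0) _ i0
  ('X_i1 - (- b)%:MP) (hk _ _ _) hs (hz _ _)) => //.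
- by rewrite polyCN addNr mulr0.
- by rewrite /cz /bet /= rmorphB /= hXL mmapC.
- by rewrite rmorphB /= hX mmapC subrr.
Qed.

Theorem local_D8 : exists (n : nat) (A : 'I_n -> L -> Prop),
  resolution iota O A /\ exceptional_dual_graph iota O A D8_graph.
Proof.
have [[hW hu hXY hXS hYS] [[hXY1 hY0 hU hrho hom] [[hsig hst huos hout hosk] [hkt hUr hrr hWo]]]] := chart_eqs.
exists 8%N, (fun i : 'I_8 => adjoin O (chart U rho om sig tau X Y i)).
split.
  by apply: (charts_resolution b0 hW hu hXY hXS hYS hXY1 hY0 hU hrho hom hsig hst huos hout
    hosk (erefl kap) hkt hUr hrr hWo (erefl s) O_local O_iota (O_nonunit i0) (O_nonunit i1)
    (O_nonunit i2) O_maximal).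
by apply: (charts_dual_graph b0 hW hu hXY hXS hYS hXY1 hY0 hU hrho hom hsig hst huos hout
    hosk (erefl kap) hkt hUr hrr hWo (erefl s) O_local O_iota (O_nonunit i0) (O_nonunit i1)
    (O_nonunit i2) O_maximal curves_exist).
Qed.

End LocalD8.

(** * The function field *)

Lemma fraction_decomposition (R : idomainType) (x : {fraction R}) :
  exists n d : R, d != 0 /\ x = tofrac n / tofrac d.
Proof.
elim/quotW: x => x; exists (frac x).1, (frac x).2; split; first exact: denom_ratioP.
rewrite -{1}[x]Ratio_numden.
have d0 : tofrac (frac x).2 != 0 by rewrite tofrac_eq0 denom_ratioP.
apply: (mulIf d0); rewrite mulfVK //.
rewrite !piE /FracField.mulf /=.
rewrite !numden_Ratio ?mulr1 ?oner_neq0 ?denom_ratioP //.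
apply/eqmodP; rewrite /= FracField.equivfE !numden_Ratio ?oner_neq0 ?denom_ratioP //.
by rewrite mulr1 mulrC.
Qed.

Lemma clear_denominator (F : fieldType) (x y a c g : F) : y != 0 ->
  x ^+ 2 - (a * x * y + c * g * y ^+ 2) = y ^+ 2 * ((x / y) ^+ 2 - (a * (x / y) + c * g)).
Proof. by move=> y0; field. Qed.

Section NoRoot.
Variables (F : fieldType) (eta : F) (g : {poly F}).
Hypothesis g0 : g.[0] != 0.

(* Otherwise compare the multiplicities of [0] as a root on the two sides. *)
Lemma quadratic_no_root (x : {fraction {poly F}}) :
  x ^+ 2 - (tofrac (eta *: 'X) * x + tofrac ('X * g)) != 0.
Proof.
have [n [d [d0 ->]]] := fraction_decomposition x.
have fd0 : tofrac d != 0 by rewrite tofrac_eq0.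
apply/negP => /eqP e.
have {}e : n ^+ 2 - (eta *: 'X * n * d + 'X * g * d ^+ 2) = 0.
  apply/eqP; rewrite -tofrac_eq0 !(tofracB, tofracD, tofracM, tofracXn).
  by rewrite clear_denominator // -tofracM e mulr0.
have n0 : n != 0.
  apply/eqP => n0; move: e; rewrite n0 expr0n /= mulr0 mul0r !add0r => /eqP.
  rewrite oppr_eq0 !mulf_eq0 polyX_eq0 (negbTE d0) /= !orbF => /eqP e.
  by move: g0; rewrite e horner0 eqxx.
have [i [n' hn' en]] := multiplicity_XsubC n 0; have [j [d' hd' ed]] := multiplicity_XsubC d 0.
rewrite n0 /= in hn'; rewrite d0 /= in hd'; rewrite subr0 in en ed.
have X0 : ('X : {poly F}) != 0 by rewrite polyX_eq0.
(* The three terms have orders [2 i], at least [1 + i + j], and [1 + 2 j]. The first is strictly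
   smallest if [i <= j], the last if [i > j], so they cannot cancel. *)
case: (leqP i j) => hij.
  have [c ec] : exists c, j = (i + c)%N by exists (j - i)%N; rewrite subnKC.
  have : 'X ^+ (i + i) * (n' ^+ 2 - 'X * (eta *: 'X ^+ c * n' * d' + 'X ^+ (c + c) * g * d' ^+ 2)) = 0.
    by rewrite -e en ed ec -!mul_polyC !exprD; ring.
  move/eqP; rewrite mulf_eq0 expf_eq0 (negbTE X0) andbF /= => /eqP/(congr1 (fun q => q.[0])).
  rewrite hornerD hornerN [X in _ - X]hornerM hornerX mul0r subr0 horner_exp horner0 => /eqP.
  by rewrite expf_eq0 /= => h; move/negP: hn'; apply.
have [c ec] : exists c, i = (j + c).+1 by exists (i - j.+1)%N; rewrite -addSn subnKC.
have : 'X ^+ (j + j).+1 * (g * d' ^+ 2 - 'X * ('X ^+ (c + c) * n' ^+ 2 - eta *: 'X ^+ c * n' * d')) = 0.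
  rewrite -[RHS]oppr0 -[in RHS]e en ed ec -!mul_polyC !exprS !exprD; ring.
move/eqP; rewrite mulf_eq0 expf_eq0 (negbTE X0) andbF /= => /eqP/(congr1 (fun q => q.[0])).
rewrite hornerD hornerN [X in _ - X]hornerM hornerX mul0r subr0 hornerM horner_exp horner0 => /eqP.
by rewrite mulf_eq0 expf_eq0 (negbTE g0) /= => h; move/negP: hd'; apply.
Qed.
End NoRoot.

Lemma quadratic_product (R : comNzRingType) (a a1 a2 a3 C D F x g g' : R) :
  x ^+ 2 = F + (C + D * x) ->
  (a + a1 * x + F * g) * (a2 + a3 * x + F * g') =
  (a * a2 + a1 * a3 * C) + (a * a3 + a1 * a2 + a1 * a3 * D) * x
  + F * ((a + a1 * x) * g' + (a2 + a3 * x + F * g') * g + a1 * a3).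
Proof.
move=> e; transitivity (a * a2 + (a * a3 + a1 * a2) * x + a1 * a3 * x ^+ 2
  + F * ((a + a1 * x) * g' + (a2 + a3 * x + F * g') * g)); first by ring.
by rewrite e; ring.
Qed.

Lemma quadratic_sum (R : comNzRingType) (a a1 a2 a3 F x g g' : R) :
  (a + a1 * x + F * g) + (a2 + a3 * x + F * g') =
  (a + a2) + (a1 + a3) * x + F * (g + g').
Proof. by ring. Qed.

Section AffineKernel.
Variables (k : closedFieldType) (L : fieldType) (eps : {rmorphism {poly {poly k}} -> L}).
Variables (eta c0 b del : k) (W : L).
Local Notation M := {mpoly k[3]}.
Local Notation f := (surface eta%:MP c0%:MP b%:MP del%:MP 'X_i0 'X_i1 'X_i2 : M).
Definition scalar_embedding : k -> L := eps \o (@polyC {poly k} \o @polyC k).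
HB.instance Definition _ := GRing.RMorphism.on scalar_embedding.
Local Notation iota := (scalar_embedding : {rmorphism k -> L}).
Local Notation base := (coord3 (eps 'X) (eps 'X%:P) W).
Hypothesis hW : surface (iota eta) (iota c0) (iota b) (iota del) (eps 'X) (eps 'X%:P) W = 0.
Hypothesis free : forall A B, eps A + eps B * W = 0 -> A = 0 /\ B = 0.

Let cc : k -> {poly {poly k}} := @polyC {poly k} \o @polyC k.
Let to_poly : M -> {poly {poly k}} := mmap cc (coord3 'X 'X%:P 0).

Let inner_comm : commr_rmorph (@mpolyC 3 k) ('X_i1 : M). Proof. by move=> x; exact: mulrC. Qed.
Let inner : {rmorphism {poly k} -> M} := horner_morph inner_comm.
Let outer_comm : commr_rmorph inner ('X_i0 : M). Proof. by move=> x; exact: mulrC. Qed.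
Let of_poly : {rmorphism {poly {poly k}} -> M} := horner_morph outer_comm.

Lemma of_poly_to_poly (p : M) : of_poly (to_poly p) = subst0 i2 p.
Proof.
rewrite /to_poly (rmorph_mmap (f' := @mpolyC 3 k)); last first.
  by move=> c; rewrite /cc /= /of_poly /inner /= horner_morphC /= horner_morphC.
apply: eq_mmap; apply: ord3P; rewrite /coord3 /zero_var /= /of_poly /inner /=.
- by rewrite horner_morphX.
- by rewrite horner_morphC /inner /= horner_morphX.
- by rewrite rmorph0.
Qed.

Lemma eval_subst0 (p : M) : mmap iota base (subst0 i2 p) = eps (to_poly p).
Proof.
rewrite (rmorph_mmap (f' := iota)); last by move=> c; rewrite /= mmapC.
rewrite /to_poly (rmorph_mmap (f' := iota)) //.
apply: eq_mmap; apply: ord3P; rewrite /zero_var /= ?mmapX ?mmap1U //.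
by rewrite !rmorph0.
Qed.

(** Division by [f], which is monic of degree 2 in the last variable. The substitution [subst0 i2]
    records that the coefficients of the remainder do not contain that variable. *)
Lemma remainder (p : M) : exists A B g : M, p = subst0 i2 A + subst0 i2 B * 'X_i2 + f * g.
Proof.
have s0 i : subst0 i2 ('X_i : M) = zero_var k i2 i by rewrite /subst0 mmapX mmap1U.
have sD p1 p2 : subst0 i2 (p1 + p2 : M) = subst0 i2 p1 + subst0 i2 p2 by rewrite /subst0 rmorphD.
have sM p1 p2 : subst0 i2 (p1 * p2 : M) = subst0 i2 p1 * subst0 i2 p2 by rewrite /subst0 rmorphM.
have sC c : subst0 i2 (c%:MP : M) = c%:MP by rewrite /subst0 mmapC.
have s00 : subst0 i2 (0 : M) = 0 by rewrite /subst0 rmorph0.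
have [C [D hCD]] : exists C D : M, ('X_i2 : M) ^+ 2 = f + (subst0 i2 C + subst0 i2 D * 'X_i2).
  exists ('X_i0 * 'X_i1 * ('X_i0 + 'X_i1 * (c0%:MP * 'X_i0 * 'X_i0 + b%:MP * 'X_i1 * 'X_i1
     + del%:MP * 'X_i0 * 'X_i1))), ('X_i0 * 'X_i1 * 'X_i1 * eta%:MP).
  rewrite !(sD, sM) !sC !s0 /zero_var /= /surface; ring.
elim/mpoly_ring_ind: p => [c|i|p q [A [B [g hp]]] [A' [B' [g' hq]]]|p q [A [B [g hp]]] [A' [B' [g' hq]]]].
- by exists c%:MP, 0, 0; rewrite sC s00 mul0r mulr0 !addr0.
- case: (eqVneq i i2) => [->|ni].
    by exists 0, 1, 0; rewrite s00 -mpolyC1 sC mpolyC1 mul1r mulr0 add0r addr0.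
  by exists 'X_i, 0, 0; rewrite s00 s0 /zero_var (negbTE ni) mul0r mulr0 !addr0.
- by exists (A + A'), (B + B'), (g + g'); rewrite !sD {1}hp {1}hq quadratic_sum.
- exists (A * A' + B * B' * C), (A * B' + B * A' + B * B' * D),
    ((subst0 i2 A + subst0 i2 B * 'X_i2) * g'
     + (subst0 i2 A' + subst0 i2 B' * 'X_i2 + f * g') * g + subst0 i2 B * subst0 i2 B').
  by rewrite !(sD, sM) hp hq (quadratic_product _ _ _ _ _ _ hCD).
Qed.

Lemma affine_kernel (p : M) : mmap iota base p = 0 -> exists g, p = f * g.
Proof.
have [A [B [g ->]]] := remainder p; move=> H; exists g.
have f0 : mmap iota base f = 0.
  rewrite (rmorph_surface (mmap iota base)) /= !mmapC !mmapX !mmap1U; exact: hW.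
move: H; rewrite rmorphD rmorphD !rmorphM /= f0 mul0r addr0 mmapX mmap1U !eval_subst0.
move=> /free [eA eB]; rewrite -!of_poly_to_poly eA eB.
by rewrite !rmorph0 mul0r !add0r.
Qed.

Lemma base_polynomial (A : {poly {poly k}}) : exists p, mmap iota base p = eps A.
Proof.
have hc (C : {poly k}) : exists p, mmap iota base p = eps C%:P.
  elim/poly_ind: C => [|C c [p hp]]; first by exists 0; rewrite !rmorph0.
  exists (p * 'X_i1 + c%:MP).
  by rewrite rmorphD rmorphM /= hp mmapC mmapX mmap1U polyCD polyCM rmorphD rmorphM.
elim/poly_ind: A => [|A C [p hp]]; first by exists 0; rewrite !rmorph0.
have [q hq] := hc C; exists (p * 'X_i0 + q).
by rewrite rmorphD rmorphM /= hp hq mmapX mmap1U rmorphD rmorphM.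
Qed.

Lemma base_fractions (z : L) A B D : D != 0 -> eps D * z = eps A + eps B * W ->
  exists p q, mmap iota base q != 0 /\ z = mmap iota base p / mmap iota base q.
Proof.
move=> D0 hz; have [p hp] := base_polynomial A; have [q hq] := base_polynomial B.
have [s hs] := base_polynomial D; exists (p + q * 'X_i2), s.
have s0 : mmap iota base s != 0.
  rewrite hs; apply: contra_neq D0 => e; have [] := @free D 0; last by [].
  by rewrite e rmorph0 mul0r addr0.
by split=> //; rewrite rmorphD rmorphM /= hp hq mmapX mmap1U -hz -hs mulrAC divff // mul1r.
Qed.
End AffineKernel.

Lemma cross_multiply (F : fieldType) (n d a c : F) : d != 0 ->
  a * (c * d) * (n / d) = a * n * c.
Proof. by move=> d0; field. Qed.

(** In the quadratic equation for [W] over [k(u)[r]] the constant coefficient is [- r] times this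
    polynomial in [r]. Its value [b u^4] at [r = 0] is nonzero, so the equation is of Eisenstein
    type at [r]. *)
Definition constant_part (F : comNzRingType) (u c b d : F) : {poly F} :=
  u%:P * ('X + u%:P * (c%:P * 'X ^+ 2 + b%:P * u%:P ^+ 2 + d%:P * 'X * u%:P)).

Lemma constant_part0 (F : comNzRingType) (u c b d : F) :
  (constant_part u c b d).[0] = u * (u * (b * u ^+ 2)).
Proof.
rewrite /constant_part !(hornerM, hornerD, hornerX, hornerC, horner_exp).
by ring.
Qed.

Lemma constant_part0_neq0 (F : fieldType) (u c b d : F) : u != 0 -> b != 0 ->
  (constant_part u c b d).[0] != 0.
Proof. by move=> u0 b0; rewrite constant_part0 !mulf_neq0 ?expf_neq0. Qed.

Lemma linear_part (F : comNzRingType) (u e : F) :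
  'X * u%:P * u%:P * e%:P = (e * u ^+ 2) *: 'X :> {poly F}.
Proof. by rewrite -mul_polyC !polyCM; ring. Qed.

Lemma map_constant_part (F G : comNzRingType) (f : {rmorphism F -> G}) (u c b d : F) :
  map_poly f (constant_part u c b d) = constant_part (f u) (f c) (f b) (f d).
Proof.
by rewrite /constant_part !(rmorphM, rmorphD, rmorphXn) /= !map_polyX !map_polyC.
Qed.

Lemma surface_quadratic (A : comNzRingType) (eta c b d r u W : A) :
  surface eta c b d r u W = W ^+ 2 - (r * u * u * eta * W
    + r * (u * (r + u * (c * r ^+ 2 + b * u ^+ 2 + d * r * u)))).
Proof. by rewrite /surface; ring. Qed.

Lemma combine_fractions (A : comNzRingType) (d d' x y w : A) :
  d * d' * (x + y * w) = d * x * d' + d' * y * d * w.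
Proof. by ring. Qed.

Section SurfaceField.
Variables (k : closedFieldType) (eta c0 b del : k).
Hypothesis b0 : b != 0.
Let K1 := {fraction {poly k}}.
Let K := {fraction {poly K1}}.
Let to_K1 : {rmorphism {poly k} -> K1} := @tofrac {poly k}.
Definition bivariate_fraction : {poly {poly k}} -> K := @tofrac {poly K1} \o map_poly to_K1.
HB.instance Definition _ := GRing.RMorphism.on bivariate_fraction.
Local Notation psi := bivariate_fraction.

Lemma psi_inj : injective psi.
Proof.
move=> x y /eqP; rewrite tofrac_eq => /eqP; apply: map_inj_poly; last exact: rmorph0.
by move=> p q /eqP; rewrite tofrac_eq => /eqP.
Qed.

Lemma psi_fraction (x : K) : exists A D, D != 0 /\ psi D * x = psi A.
Proof.
have key (n : {poly K1}) : exists A D, D != 0 /\ psi D * tofrac n = psi A.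
  elim/poly_ind: n => [|n c [A [D [D0 e]]]].
    by exists 0, 1; rewrite oner_neq0 !rmorph0 mulr0.
  have [cn [cd [cd0 ec]]] := fraction_decomposition c.
  exists (A * cd%:P * 'X + D * cn%:P), (D * cd%:P).
  rewrite mulf_neq0 ?polyC_eq0 //; split=> //.
  have eX : psi 'X = tofrac ('X : {poly K1}) by rewrite /psi /= map_polyX.
  have eC q : psi q%:P = tofrac (to_K1 q)%:P by rewrite /psi /= map_polyC.
  have ecd : psi cd%:P * tofrac c%:P = psi cn%:P.
    rewrite !eC -tofracM -polyCM ec /to_K1 mulrC divfK // tofrac_eq0 //.
  rewrite !rmorphM !rmorphD !rmorphM /= -eX -e.
  by rewrite -ecd; move: (tofrac n) (tofrac c%:P) (psi D) (psi cd%:P) (psi 'X) => n' c' D' d' X'; ring.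
have [n [d [d0 ->]]] := fraction_decomposition x.
have [A [D [D0 e]]] := key n; have [A' [D' [D0' e']]] := key d.
have fd0 : tofrac d != 0 by rewrite tofrac_eq0.
have pinj0 q : q != 0 -> psi q != 0 by apply: contraNneq => h; apply/eqP/psi_inj; rewrite h rmorph0.
exists (A * D'), (D * A'); split.
  rewrite mulf_neq0 //; apply: contraNneq fd0 => A0.
  by move: e'; rewrite A0 rmorph0 => /eqP; rewrite mulf_eq0 (negbTE (pinj0 _ D0')).
by rewrite !rmorphM /= -e -e' cross_multiply.
Qed.

Let A1 : {poly {poly k}} := 'X * 'X%:P * 'X%:P * eta%:P%:P.
Let A0 : {poly {poly k}} := 'X * constant_part 'X c0%:P b%:P del%:P.
Let quad : {poly K} := 'X^2 - (psi A1 *: 'X + (psi A0)%:P).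

Lemma quad_no_root (x : K) : ~~ root quad x.
Proof.
rewrite /root /quad hornerD hornerN hornerXn hornerD hornerZ hornerX hornerC.
have u10 : to_K1 'X != 0 by rewrite /to_K1 tofrac_eq0 polyX_eq0.
pose g : {poly K1} := constant_part (to_K1 'X) (to_K1 c0%:P) (to_K1 b%:P) (to_K1 del%:P).
have g0 : g.[0] != 0.
  have bb : to_K1 b%:P != 0 by rewrite /to_K1 tofrac_eq0 polyC_eq0.
  exact: (constant_part0_neq0 _ _ u10 bb).
have e1 : psi A1 = tofrac ((to_K1 eta%:P * to_K1 'X ^+ 2) *: 'X).
  by rewrite -linear_part /psi /= /A1 !rmorphM /= map_polyX !map_polyC.
have e0 : psi A0 = tofrac ('X * g).
  by rewrite /psi /= /g -map_constant_part /A0 rmorphM /= map_polyX.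
rewrite e1 e0; exact: (quadratic_no_root (to_K1 eta%:P * to_K1 'X ^+ 2) g0 x).
Qed.

(** [L] is the quadratic extension of [k(u)(r)] generated by a root [W] of the surface equation. The
    outer variable is [r] and the inner one [u]; a quadratic polynomial without roots is
    irreducible. *)
Theorem surface_field : exists (L : fieldType) (eps : {rmorphism {poly {poly k}} -> L}) (W : L),
  let iota := scalar_embedding eps in
  [/\ surface (iota eta) (iota c0) (iota b) (iota del) (eps 'X) (eps 'X%:P) W = 0,
      forall A B, eps A + eps B * W = 0 -> A = 0 /\ B = 0 &
      forall z, exists A B D, D != 0 /\ eps D * z = eps A + eps B * W].
Proof.
have szq : size quad = 3%N.
  rewrite /quad size_polyDl ?size_polyXn // size_polyN.
  by rewrite (leq_ltn_trans (size_polyD _ _)) // gtn_max (leq_ltn_trans (size_scale_leq _ _)) ?size_polyX // (leq_ltn_trans (size_polyC_leq1 _)).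
have irr : irreducible_poly quad.
  by apply: cubic_irreducible; [rewrite szq | exact: quad_no_root].
have [L _ [W rW fW]] := irredp_FAdjoin irr.
pose eps : {poly {poly k}} -> L := in_alg L \o psi.
pose epsM : {rmorphism {poly {poly k}} -> L} := GRing.RMorphism.clone _ _ eps _.
exists L, epsM, W => iota; split.
- move: rW; rewrite /root /quad rmorphB rmorphD /= map_polyXn map_polyZ map_polyX map_polyC.
  rewrite !(hornerD, hornerN, hornerXn, hornerZ, hornerX, hornerC) => /eqP e.
  rewrite surface_quadratic -[RHS]e; congr (_ - (_ * _ + _)).
    by rewrite -[RHS]/(epsM A1) /A1 !rmorphM.
  rewrite -[RHS]/(epsM A0) /A0 /constant_part !(rmorphM, rmorphD, rmorphXn) //.
- have eps0 A : epsM A = 0 -> A = 0.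
    move=> e; apply: psi_inj; rewrite rmorph0; apply/eqP.
    by rewrite -(fmorph_eq0 (in_alg L)); apply/eqP.
  (* Otherwise [W = - A / B] would be a root in the base field [k(u)(r)]. *)
  move=> A B e; have B0 : B = 0.
    apply/eqP/negPn/negP => B0.
    have p0 : psi B != 0 by apply: contraNneq B0 => h; apply/eqP/psi_inj; rewrite h rmorph0.
    have eW : W = in_alg L (- (psi A / psi B)).
      have i0 : in_alg L (psi B) != 0 by rewrite fmorph_eq0.
      apply: (mulfI i0); rewrite -rmorphM mulrN mulrCA divff // mulr1 rmorphN.
      by apply/eqP; rewrite -addr_eq0 addrC; apply/eqP.
    by move: rW; rewrite eW fmorph_root (negbTE (quad_no_root _)).
  by split=> //; apply: eps0; move: e; rewrite B0 rmorph0 mul0r addr0.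
- move=> z; have /Fadjoin_polyP [p /polyOver1P [q ->] ->] : z \in <<1; W>>%VS by rewrite fW memvf.
  have [A [D [D0 eA]]] := psi_fraction (q %% quad)`_0.
  have [B [D' [D0' eB]]] := psi_fraction (q %% quad)`_1.
  exists (A * D'), (B * D), (D * D'); rewrite mulf_neq0 //; split=> //.
  have -> : (map_poly (in_alg L) q).[W] =
     in_alg L (q %% quad)`_0 + in_alg L (q %% quad)`_1 * W.
    rewrite {1}(divp_eq q quad) rmorphD rmorphM hornerD hornerM (rootP rW) mulr0 add0r.
    have sz : (size (q %% quad)%R <= 2)%N by rewrite -ltnS -szq ltn_modp -size_poly_eq0 szq.
    rewrite (horner_coef_wide _ (n := 2)); last by rewrite size_map_poly.
    by rewrite !big_ord_recl big_ord0 /= !coef_map /= expr0 expr1 mulr1 addr0.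
  rewrite !rmorphM -[epsM A]/(in_alg L (psi A)) -[epsM B]/(in_alg L (psi B)) -eA -eB !rmorphM.
  rewrite -[epsM D]/(in_alg L (psi D)) -[epsM D']/(in_alg L (psi D')).
  exact: combine_fractions.
Qed.
End SurfaceField.

(** * The normal form of the quartic *)

Definition normal_form (A : comNzRingType) (c d del eta r u v w : A) : A :=
  (c * r ^+ 2 + d * u ^+ 2 + del * r * u + v * w) ^+ 2
  - eta ^+ 2 * (r * u * (r * v + u * w)).

Lemma rmorph_normal_form (A B : comNzRingType) (f : {rmorphism A -> B}) (c d del eta r u v w : A) :
  f (normal_form c d del eta r u v w) =
  normal_form (f c) (f d) (f del) (f eta) (f r) (f u) (f v) (f w).
Proof. by rewrite /normal_form !(rmorphB, rmorphD, rmorphM, rmorphXn). Qed.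

Lemma mmap_homog (n d : nat) (R S : comNzRingType) (f : {rmorphism R -> S})
    (x : 'I_n -> S) (t : S) (p : {mpoly R[n]}) : p \is d.-homog ->
  mmap f (fun i => t * x i) p = t ^+ d * mmap f x p.
Proof.
move/dhomogP => hp; rewrite /mmap mulr_sumr big_seq [RHS]big_seq; apply: eq_bigr => m hm.
rewrite /mmap1 mulrCA; congr (_ * _).
have <- : mdeg m = d := hp _ hm.
rewrite mdegE -prodrXr -big_split /=.
by apply: eq_bigr => i _; rewrite exprMn.
Qed.

Section Coordinates4.
Variable A : nmodType.
Definition coord4 (a b c d : A) (i : 'I_4) : A := [:: a; b; c; d]`_i.
End Coordinates4.

Definition j0 : 'I_4 := @Ordinal 4 0 isT.
Definition j1 : 'I_4 := @Ordinal 4 1 isT.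
Definition j2 : 'I_4 := @Ordinal 4 2 isT.
Definition j3 : 'I_4 := @Ordinal 4 3 isT.

Lemma ord4P (P : 'I_4 -> Prop) : P j0 -> P j1 -> P j2 -> P j3 -> forall i, P i.
Proof.
move=> h0 h1 h2 h3 [[|[|[|[|//]]]] hi].
- by rewrite (_ : Ordinal hi = j0) //; apply: val_inj.
- by rewrite (_ : Ordinal hi = j1) //; apply: val_inj.
- by rewrite (_ : Ordinal hi = j2) //; apply: val_inj.
- by rewrite (_ : Ordinal hi = j3) //; apply: val_inj.
Qed.

Lemma normal_form_affine (F : fieldType) (c d del eta r u v w : F) : v != 0 -> eta != 0 ->
  surface eta (- c) (- d) (- del) (r / v) (u / v)
    ((c * r ^+ 2 + d * u ^+ 2 + del * r * u + v * w) / (eta * v ^+ 2)) =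
  normal_form c d del eta r u v w / (eta ^+ 2 * v ^+ 4).
Proof. by move=> v0 e0; rewrite /surface /normal_form; field; rewrite v0 e0. Qed.

Lemma normal_form_affine1 (F : comNzRingType) (c d del eta r u W : F) :
  normal_form c d del eta r u 1 (eta * W + - c * r ^+ 2 + - d * u ^+ 2 + - del * r * u) =
  eta ^+ 2 * surface eta (- c) (- d) (- del) r u W.
Proof. by rewrite /surface /normal_form; ring. Qed.

Lemma dehomogenized_coordinate (F : fieldType) (c d del eta r u v w : F) : v != 0 -> eta != 0 ->
  v * (eta * ((c * r ^+ 2 + d * u ^+ 2 + del * r * u + v * w) / (eta * v ^+ 2))
    + - c * (r / v) ^+ 2 + - d * (u / v) ^+ 2 + - del * (r / v) * (u / v)) = w.
Proof. by move=> v0 e0; field; rewrite v0 e0. Qed.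

Lemma clear_homogeneous (F : fieldType) (v eta x y ve vn : F) : v != 0 -> eta != 0 ->
  v ^+ 4 * vn * (eta ^+ 2 * (ve * (x / (eta ^+ 2 * v ^+ 4) * y))) = x * (ve * (vn * y)).
Proof. by move=> v0 e0; field; rewrite v0 e0. Qed.

Section NormalForm.
Variables (k : closedFieldType) (c d del eta : k).
Hypotheses (d0 : d != 0) (eta0 : eta != 0).
Local Notation M := {mpoly k[4]}.
Local Notation M3 := {mpoly k[3]}.
Variables (l m : 'I_4 -> M) (P : 'rV[k]_4) (nu : k).
Hypotheses (hl : forall i, l i \is 1.-homog) (hm : forall i, m i \is 1.-homog).
Local Notation sub_l := (mmap (@mpolyC 4 k) l : M -> M).
Local Notation sub_m := (mmap (@mpolyC 4 k) m : M -> M).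
Hypotheses (hml : forall i, sub_l (m i) = 'X_i) (hlm : forall i, sub_m (l i) = 'X_i).
Hypotheses (nu0 : nu != 0) (hP : forall i, (l i).@[P ord0] = coord4 0 0 nu 0 i).

Let F0 : M := normal_form c%:MP d%:MP del%:MP eta%:MP 'X_j0 'X_j1 'X_j2 'X_j3.
Let F : M := normal_form c%:MP d%:MP del%:MP eta%:MP (l j0) (l j1) (l j2) (l j3).

Lemma sub_l_F0 : sub_l F0 = F.
Proof. by rewrite /F0 (rmorph_normal_form sub_l) /= !mmapC !mmapX !mmap1U. Qed.

Lemma mmap_id (p : M) : mmap (@mpolyC 4 k) (fun i => 'X_i) p = p.
Proof.
elim/mpoly_ring_ind: p => [a|i|p q hp hq|p q hp hq].
- by rewrite mmapC.
- by rewrite mmapX mmap1U.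
- by rewrite rmorphD /= hp hq.
- by rewrite rmorphM /= hp hq.
Qed.

Lemma mmap_sub (S : comNzRingType) (f : {rmorphism k -> S}) (x : 'I_4 -> S) (s : 'I_4 -> M) p :
  mmap f x (mmap (@mpolyC 4 k) s p) = mmap f (fun i => mmap f x (s i)) p.
Proof. by rewrite (rmorph_mmap (f' := f)) // => a; rewrite /= mmapC. Qed.

Lemma sub_lm p : sub_l (sub_m p) = p.
Proof. by rewrite mmap_sub (eq_mmap _ _ hml) mmap_id. Qed.

Lemma sub_m_homog (S : comNzRingType) (f : {rmorphism k -> S}) (x : 'I_4 -> S) (t : S) e p :
  p \is e.-homog -> mmap f (fun i => t * x i) (sub_m p) = t ^+ e * mmap f x (sub_m p).
Proof.
move=> hp; rewrite !mmap_sub -mmap_homog //; apply: eq_mmap => i.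
by rewrite (mmap_homog _ _ _ (hm i)) expr1.
Qed.

Lemma coprime_F0 : coprime_to F0 'X_j2.
Proof.
apply: (@coprime_to_var _ _ _ _ (coord4 0 1 0 0)) => //.
rewrite (rmorph_normal_form (meval (coord4 0 1 0 0))) /= !mevalC !mevalXU /coord4 /=.
have -> : normal_form c d del eta 0 1 0 0 = d ^+ 2 by rewrite /normal_form; ring.
by rewrite expf_neq0.
Qed.

(* In the chart [v = 1] the coordinate [W = Q / eta] replaces [w]. *)
Definition affine_coordinates : 'I_4 -> M3 :=
  coord4 'X_i0 'X_i1 1 (eta%:MP * 'X_i2 + (- c)%:MP * 'X_i0 ^+ 2 + (- d)%:MP * 'X_i1 ^+ 2
    + (- del)%:MP * 'X_i0 * 'X_i1).
Local Notation dehom := (mmap (@mpolyC 3 k) affine_coordinates : M -> M3).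

Local Notation f3 := (surface eta%:MP (- c)%:MP (- d)%:MP (- del)%:MP 'X_i0 'X_i1 'X_i2 : M3).

Section Homogenization.
Variables (Phi : fieldType) (fr : {rmorphism M -> Phi}) (frC : {rmorphism k -> Phi}).
Hypothesis frCE : forall a, fr a%:MP = frC a.
Hypothesis fr_inj : injective fr.
Let Q : M := c%:MP * 'X_j0 ^+ 2 + d%:MP * 'X_j1 ^+ 2 + del%:MP * 'X_j0 * 'X_j1 + 'X_j2 * 'X_j3.
Let theta : 'I_3 -> Phi :=
  coord3 (fr 'X_j0 / fr 'X_j2) (fr 'X_j1 / fr 'X_j2) (fr Q / (frC eta * fr 'X_j2 ^+ 2)).

Lemma frX_neq0 : fr 'X_j2 != 0.
Proof.
apply/eqP; rewrite -(rmorph0 fr) => /fr_inj /(congr1 (meval (fun=> 1))).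
by rewrite mevalXU meval0 => /eqP; rewrite oner_eq0.
Qed.

Lemma frC_neq0 a : a != 0 -> frC a != 0. Proof. by rewrite fmorph_eq0. Qed.

Lemma theta_clear (g : M3) : exists N g', fr 'X_j2 ^+ N * mmap frC theta g = fr g'.
Proof.
elim/mpoly_ring_ind: g => [a|i|p q [N [p' hp]] [N' [q' hq]]|p q [N [p' hp]] [N' [q' hq]]].
- by exists 0%N, a%:MP; rewrite expr0 mul1r mmapC frCE.
- have V0 := frX_neq0; elim/ord3P: i; rewrite mmapX mmap1U /theta /coord3 /=.
  + by exists 1%N, 'X_j0; rewrite expr1 mulrCA divff // mulr1.
  + by exists 1%N, 'X_j1; rewrite expr1 mulrCA divff // mulr1.
  + exists 2%N, (eta^-1%:MP * Q); rewrite rmorphM.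
    have -> : fr eta^-1%:MP = (frC eta)^-1 by rewrite frCE fmorphV.
    by rewrite invfM mulrCA [_^-1 * _^-1]mulrC mulVKf ?expf_neq0 // mulrC.
- exists (N + N')%N, ('X_j2 ^+ N' * p' + 'X_j2 ^+ N * q').
  rewrite !rmorphD !rmorphM !rmorphXn /= -hp -hq exprD mulrDr !mulrA.
  by rewrite [fr 'X_j2 ^+ N' * _]mulrC.
- exists (N + N')%N, (p' * q'); by rewrite !rmorphM -hp -hq exprD mulrACA.
Qed.

(** At [W = Q / (eta v^2)] the polynomial replacing [w] becomes [w / v]. Dehomogenizing and then
    applying [theta] therefore only divides all coordinates by [v]. *)
Lemma theta_dehom e p : p \is e.-homog ->
  fr 'X_j2 ^+ e * mmap frC theta (dehom (sub_m p)) = fr (sub_m p).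
Proof.
move=> hp; rewrite (rmorph_mmap (f' := frC) (g := mmap frC theta)); last by move=> a; rewrite /= mmapC.
have V0 := frX_neq0; have E0 := frC_neq0 eta0.
rewrite -(sub_m_homog _ _ _ hp) -[RHS]/(fr _).
have -> : fr (sub_m p) = mmap frC (fun i => fr 'X_i) (sub_m p).
  by rewrite -{1}(mmap_id (sub_m p)) (rmorph_mmap (f' := frC)).
apply: eq_mmap; have hX i : mmap frC theta 'X_i = theta i by rewrite mmapX mmap1U.
elim/ord4P; rewrite /affine_coordinates {1}/coord4 /=.
- by rewrite hX /theta /coord3 /= mulrCA divff // mulr1.
- by rewrite hX /theta /coord3 /= mulrCA divff // mulr1.
- by rewrite rmorph1 mulr1.
- rewrite !rmorphD !rmorphM /= !mmapC !hX /theta /coord3 /=.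
  have -> : fr Q = frC c * fr 'X_j0 ^+ 2 + frC d * fr 'X_j1 ^+ 2 + frC del * fr 'X_j0 * fr 'X_j1
     + fr 'X_j2 * fr 'X_j3.
    by rewrite /Q !(rmorphD, rmorphM, rmorphXn) !frCE.
  rewrite !rmorphN; exact: dehomogenized_coordinate.
Qed.


(** Replacing [w] by a polynomial in [W] is not ordinary dehomogenization, so degrees cannot be
    compared directly. Instead [theta] carries the factorization into the fraction field, powers of
    [v] clear the denominators, and [coprime_F0] cancels them. *)
Lemma homogeneous_divisible_frac e p g : p \is e.-homog -> dehom (sub_m p) = f3 * g ->
  exists g', p = F * g'.
Proof.
move=> hp eg; have := theta_dehom hp; have [N [g' hg]] := theta_clear g.
have V0 := frX_neq0; have E0 := frC_neq0 eta0.
have hX i : mmap frC theta 'X_i = theta i by rewrite mmapX mmap1U.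
have eN a : frC (- a) = - frC a by rewrite rmorphN.
have eC a : mmap frC theta a%:MP = frC a by rewrite mmapC.
have ef : mmap frC theta f3 = fr F0 / (frC eta ^+ 2 * fr 'X_j2 ^+ 4).
  rewrite (rmorph_surface (mmap frC theta)) /= !eC !hX !eN.
  rewrite /F0 (rmorph_normal_form fr) !frCE /theta /coord3 /=.
  have -> : fr Q = frC c * fr 'X_j0 ^+ 2 + frC d * fr 'X_j1 ^+ 2 + frC del * fr 'X_j0 * fr 'X_j1
     + fr 'X_j2 * fr 'X_j3.
    by rewrite /Q !(rmorphD, rmorphM, rmorphXn) !frCE.
  exact: normal_form_affine.
rewrite eg rmorphM /= ef => e1.
have e2 : 'X_j2 ^+ 4 * 'X_j2 ^+ N * (eta%:MP ^+ 2 * sub_m p) = F0 * ('X_j2 ^+ e * g').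
  apply: fr_inj; rewrite !rmorphM !rmorphXn /= -e1 -hg frCE.
  exact: clear_homogeneous.
have [g2 e3] := coprime_toM (coprime_toX (m := 4) coprime_F0) (coprime_toX (m := N) coprime_F0) e2.
exists (sub_l ((eta ^- 2)%:MP * g2)).
have -> : p = sub_l (sub_m p) by rewrite sub_lm.
rewrite -sub_l_F0 -rmorphM; congr (sub_l _).
by rewrite mulrCA -e3 mulrA -(rmorphXn (@mpolyC 4 k)) -mpolyCM mulVf ?expf_neq0 // mpolyC1 mul1r.
Qed.

End Homogenization.

Lemma homogeneous_divisible e p g : p \is e.-homog -> dehom (sub_m p) = f3 * g ->
  exists g', p = F * g'.
Proof.
pose frC : {rmorphism k -> {fraction M}} := GRing.RMorphism.clone _ _ (@tofrac M \o @mpolyC 4 k) _.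
apply: (@homogeneous_divisible_frac {fraction M} (@tofrac M) frC) => //.
by move=> x y /eqP; rewrite tofrac_eq => /eqP.
Qed.

Lemma ev_dehom e p : p \is e.-homog -> ev p P = nu ^+ e * (dehom (sub_m p)).@[fun=> 0].
Proof.
move=> hp; rewrite /ev -{1}(sub_lm p).
have -> : (sub_l (sub_m p)).@[P ord0] = (sub_m p).@[fun i => nu * coord4 0 0 1 0 i].
  rewrite (rmorph_mmap (f' := idfun) (g := meval (P ord0))); last by move=> a /=; rewrite mevalC.
  by apply: eq_mmap => i; rewrite /= hP; elim/ord4P: i; rewrite /coord4 /= ?mulr0 ?mulr1.
rewrite /meval (sub_m_homog idfun _ _ hp); congr (_ * _).
rewrite [RHS](rmorph_mmap (f' := idfun) (g := meval (fun=> 0))); last by move=> a /=; rewrite mevalC.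
apply: eq_mmap; elim/ord4P; rewrite /affine_coordinates /coord4 /= ?mevalXU ?meval1 //.
by rewrite !(mevalD, mevalM, mevalXU, rmorphXn) /= ?mevalXU ?expr0n !mulr0 !addr0.
Qed.

Section GenericPoint.
Variables (L : fieldType) (iota : {rmorphism k -> L}) (r u W : L).
Local Notation phi := (mmap iota (coord3 r u W) : M3 -> L).
Hypothesis hker : forall g, phi g = 0 -> exists g', g = f3 * g'.
Hypothesis hsurf :
  surface (iota eta) (iota (- c)) (iota (- d)) (iota (- del)) r u W = 0.
Hypothesis hfrac : forall z, exists p q, phi q != 0 /\ z = phi p / phi q.

Definition generic_coordinate (i : 'I_4) : L := phi (dehom (m i)).
Local Notation xi := generic_coordinate.
Local Notation eval_xi := (mmap iota xi).

Lemma eval_xiE p : eval_xi p = phi (dehom (sub_m p)).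
Proof.
rewrite (rmorph_mmap (f' := @mpolyC 3 k) (g := dehom)); last by move=> a; rewrite /= mmapC.
by rewrite (rmorph_mmap (f' := iota) (g := phi)) //= => a; rewrite mmapC.
Qed.

Lemma eval_xi_l i : eval_xi (l i) = phi (affine_coordinates i).
Proof. by rewrite eval_xiE hlm mmapX mmap1U. Qed.

Lemma eval_xi_l2 : eval_xi (l j2) = 1.
Proof. by rewrite eval_xi_l /affine_coordinates /coord4 /= rmorph1. Qed.

Lemma ev_l i : ev (l i) P = coord4 0 0 nu 0 i.
Proof. exact: hP. Qed.

(** [r] and [u] come from linear forms, and [W] from the quadratic form [Q / eta]. Degrees are
    equalized with powers of the form [v], which is 1 in [L] and [nu] at [P]. *)
Lemma homogenize (g : M3) : exists e p,
  [/\ p \is e.-homog, eval_xi p = phi g & ev p P = nu ^+ e * g.@[fun=> 0]].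
Proof.
have hX i : phi 'X_i = coord3 r u W i by rewrite mmapX mmap1U.
have l2X e : (l j2) ^+ e \is e.-homog by rewrite -[X in X.-homog]mul1n; apply: dhomogMn.
have evX e : ev (l j2 ^+ e) P = nu ^+ e by rewrite /ev rmorphXn /= -/(ev _ _) ev_l.
elim/mpoly_ring_ind: g => [a|i|p q [e [p' [h1 h2 h3]]] [e' [q' [h1' h2' h3']]]
   |p q [e [p' [h1 h2 h3]]] [e' [q' [h1' h2' h3']]]].
- exists 0%N, a%:MP; split; first by rewrite -(mulr1 a%:MP) mul_mpolyC; apply: rpredZ; exact: dhomog1.
    by rewrite !mmapC.
  by rewrite /ev !mevalC mul1r.
- elim/ord3P: i; rewrite hX mevalXU /coord3 /=.
  + exists 1%N, (l j0); split => //; last by rewrite ev_l mulr0.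
    by rewrite eval_xi_l /affine_coordinates /coord4 /= hX.
  + exists 1%N, (l j1); split => //; last by rewrite ev_l mulr0.
    by rewrite eval_xi_l /affine_coordinates /coord4 /= hX.
  + exists 2%N, (eta^-1%:MP * (c%:MP * (l j0 * l j0) + d%:MP * (l j1 * l j1) + del%:MP * (l j0 * l j1) + l j2 * l j3)).
    split.
    * have hM a b : l a * l b \is 2.-homog by exact: (dhomogM (d := 1) (e := 1) (hl a) (hl b)).
      by rewrite !mul_mpolyC; apply: rpredZ; do !apply: rpredD => //; apply: rpredZ.
    * rewrite !(rmorphM, rmorphD) /= !mmapC eval_xi_l2 !eval_xi_l /affine_coordinates /coord4 /=.
      rewrite !(rmorphM, rmorphD) /= !mmapC ?rmorphXn /= !hX /coord3 /= !rmorphN fmorphV.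
      have e0 : iota eta != 0 by rewrite fmorph_eq0.
      by field.
    * rewrite /ev !(mevalM, mevalD) -!/(ev _ _) !ev_l /coord4 /=; ring.
- exists (e + e')%N, (l j2 ^+ e' * p' + l j2 ^+ e * q'); split.
  + by apply: rpredD; [rewrite addnC|]; apply: dhomogM.
  + by rewrite !rmorphD !rmorphM !rmorphXn /= eval_xi_l2 !expr1n !mul1r h2 h2'.
  + rewrite /ev mevalD !mevalM -!/(ev _ _) h3 h3' !evX mevalD exprD; ring.
- exists (e + e')%N, (p' * q'); split; first exact: dhomogM.
    by rewrite !rmorphM /= h2 h2'.
  by rewrite /ev !mevalM -!/(ev _ _) h3 h3' exprD; ring.
Qed.

Lemma homogenize_fraction (p q : M3) : exists e p' q',
  [/\ p' \is e.-homog, q' \is e.-homog, eval_xi p' = phi p, eval_xi q' = phi q &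
      ev q' P = nu ^+ e * q.@[fun=> 0]].
Proof.
have l2X e : (l j2) ^+ e \is e.-homog by rewrite -[X in X.-homog]mul1n; apply: dhomogMn.
have evX e : ev (l j2 ^+ e) P = nu ^+ e by rewrite /ev rmorphXn /= -/(ev _ _) ev_l.
have [e [p' [h1 h2 h3]]] := homogenize p; have [e' [q' [h1' h2' h3']]] := homogenize q.
exists (e + e')%N, (l j2 ^+ e' * p'), (l j2 ^+ e * q'); split.
- by rewrite addnC; apply: dhomogM.
- exact: dhomogM.
- by rewrite rmorphM rmorphXn /= eval_xi_l2 expr1n mul1r.
- by rewrite rmorphM rmorphXn /= eval_xi_l2 expr1n mul1r.
- by rewrite /ev mevalM -!/(ev _ _) h3' evX exprD mulrA.
Qed.

Lemma normal_form_function_field : function_field iota F xi.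
Proof.
split=> [e p hp|z].
  split=> [|[g ->]].
    rewrite eval_xiE => /hker [g /(homogeneous_divisible hp) [g' ->]].
    by exists g'; rewrite mulrC.
  have hX i : phi 'X_i = coord3 r u W i by rewrite mmapX mmap1U.
  rewrite rmorphM /= /F (rmorph_normal_form eval_xi) /= !mmapC eval_xi_l2 !eval_xi_l.
  rewrite /affine_coordinates /coord4 /=.
  rewrite !(rmorphM, rmorphD) /= !mmapC ?rmorphXn /= !hX /coord3 /= !rmorphN ?expr2.
  by rewrite normal_form_affine1 -!rmorphN hsurf !mulr0.
have [p [q [q0 ->]]] := hfrac z.
have [e [p' [q' [hp hq ep eq _]]]] := homogenize_fraction p q.
by exists e, p', q'; rewrite ep eq.
Qed.

Lemma local_ringE : same_set (local_ring iota xi P)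
  (spec_ring (mmap iota (coord3 r u W)) (meval (fun=> 0) : M3 -> k)).
Proof.
move=> z; split=> [[e [p [q [hp hq q0 ->]]]]|[p [q [q0 ->]]]].
  exists (dehom (sub_m p)), (dehom (sub_m q)); rewrite !eval_xiE; split=> //.
  by move: q0; rewrite (ev_dehom hq) mulf_eq0 negb_or => /andP [].
have [e [p' [q' [hp hq ep eq h]]]] := homogenize_fraction p q.
by exists e, p', q'; rewrite ep eq h mulf_neq0 // expf_neq0.
Qed.

End GenericPoint.

Theorem normal_form_D8 : exists (L : fieldType) (iota : {rmorphism k -> L}) (xi : 'I_4 -> L),
    function_field iota F xi /\
    exists (n : nat) (A : 'I_n -> L -> Prop),
      resolution iota (local_ring iota xi P) A /\
      exceptional_dual_graph iota (local_ring iota xi P) A D8_graph.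
Proof.
have d0' : - d != 0 by rewrite oppr_eq0.
have [L [eps [W [hW hfree hdec]]]] := surface_field eta (- c) (- del) d0'.
pose iota : {rmorphism k -> L} := scalar_embedding eps.
have hker := affine_kernel hW hfree.
have hfrac z : exists p q, mmap iota (coord3 (eps 'X) (eps 'X%:P) W) q != 0 /\
  z = mmap iota (coord3 (eps 'X) (eps 'X%:P) W) p / mmap iota (coord3 (eps 'X) (eps 'X%:P) W) q.
  have [A [B [D [D0 hz]]]] := hdec z; exact: (base_fractions hfree D0 hz).
exists L, iota, (generic_coordinate iota (eps 'X) (eps 'X%:P) W); split.
  exact: normal_form_function_field.
rewrite (same_setE (local_ringE iota (eps 'X) (eps 'X%:P) W)).
exact: (local_D8 d0' hker hW).
Qed.
End NormalForm.

(** * Reduction to the normal form in characteristic 2 *)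

Definition quartic (A : comNzRingType) (a c1 c2 c3 d1 d2 d3 b1 b2 b3 b4 x y z t : A) : A :=
  (b3 ^+ 2 * c1) * x ^+ 4 + (b2 ^+ 2 * d1) * y ^+ 4
  + (b1 ^+ 2 * d1) * z ^+ 4 + (b4 ^+ 2 * c1) * t ^+ 4
  + (b3 ^+ 2 * d2 + b2 ^+ 2 * c2 + a ^+ 2 * c3 + a * b2 * b3)
      * (x ^+ 2 * y ^+ 2)
  + (b3 ^+ 2 * d3 + b1 ^+ 2 * c3 + a ^+ 2 * c2 + a * b1 * b3)
      * (x ^+ 2 * z ^+ 2)
  + (b2 ^+ 2 * d3 + b4 ^+ 2 * c3 + a ^+ 2 * d2 + a * b2 * b4)
      * (y ^+ 2 * t ^+ 2)
  + (b1 ^+ 2 * d2 + b4 ^+ 2 * c2 + a ^+ 2 * d3 + a * b1 * b4)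
      * (z ^+ 2 * t ^+ 2)
  + a ^+ 2 * (b3 * (x ^+ 2 * y * z) + b2 * (x * y ^+ 2 * t)
               + b1 * (x * z ^+ 2 * t) + b4 * (y * z * t ^+ 2)).

Section QuarticReduction.
Variables (A : comNzRingType) (two0 : 2 = 0 :> A).
Implicit Types x y z t : A.

Lemma addr_self x : x + x = 0.
Proof. by rewrite -mulr2n -mulr_natr two0 mulr0. Qed.

Lemma opp_self x : - x = x.
Proof. by apply/eqP; rewrite -subr_eq0 -opprD addr_self oppr0. Qed.

Lemma sqrD x y : (x + y) ^+ 2 = x ^+ 2 + y ^+ 2.
Proof. by rewrite sqrrD -mulr_natr two0 mulr0 addr0. Qed.

Variables (a m c1 c2 c3 d1 d2 d3 s1 s2 s3 s4 e1 e2 f3 f4 p kap q eta : A).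
Hypotheses (he : s2 * e1 + s1 * e2 = 1) (hf : s3 * f4 + s4 * f3 = 1) (hs : s3 * s4 = s1 * s2).
Hypotheses (hm : m ^+ 2 = a) (hp : p ^+ 2 = s1 * s2) (hkap : kap ^+ 2 = e1 * e2 + f3 * f4).
Hypotheses (heta : eta ^+ 2 * q = a ^+ 2).

(** In characteristic 2, with all parameters square roots of those of the quartic except [a], its
    square is [a ^+ 2] times the expression in the non-singularity condition. *)
Definition vw_coefficient : A :=
  a * (s1 * s3 * d2 + s2 * s3 * d3 + s2 * s4 * c2 + s1 * s4 * c3).

Definition wu_coefficient : A :=
  d2 * (s3 ^+ 2 * s4 * e1 + s1 ^+ 2 * e2 * s3 + a * e1 * s3)
  + d3 * (s3 ^+ 2 * s4 * e2 + s2 ^+ 2 * e1 * s3 + a * e2 * s3)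
  + c2 * (s2 ^+ 2 * s4 * e1 + s4 ^+ 2 * e2 * s3 + a * s4 * e2)
  + c3 * (s1 ^+ 2 * s4 * e2 + s4 ^+ 2 * e1 * s3 + a * s4 * e1) + a * p.

Definition vr_coefficient : A :=
  d2 * (s3 ^+ 2 * f4 * s1 + s1 ^+ 2 * s2 * f3 + a * s1 * f3)
  + d3 * (s3 ^+ 2 * f4 * s2 + s2 ^+ 2 * s1 * f3 + a * s2 * f3)
  + c2 * (s2 ^+ 2 * f4 * s1 + s4 ^+ 2 * s2 * f3 + a * f4 * s2)
  + c3 * (s1 ^+ 2 * f4 * s2 + s4 ^+ 2 * s1 * f3 + a * f4 * s1) + a * p.

Definition ru_coefficient : A :=
  d2 * (s3 ^+ 2 * f4 * e1 + s1 ^+ 2 * e2 * f3 + a * e1 * f3)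
  + d3 * (s3 ^+ 2 * f4 * e2 + s2 ^+ 2 * e1 * f3 + a * e2 * f3)
  + c2 * (s2 ^+ 2 * f4 * e1 + s4 ^+ 2 * e2 * f3 + a * f4 * e2)
  + c3 * (s1 ^+ 2 * f4 * e2 + s4 ^+ 2 * e1 * f3 + a * f4 * e1) + m + a * kap.

(** Square root of the part of the quartic that is a square in characteristic 2. The factor
    [m * (r * u)] collects the terms with [a * b_i * b_j], whose sum is [a r^2 u^2]. *)
Definition quadratic_part x y z t r u v w : A :=
  c1 * r ^+ 2 + d1 * u ^+ 2
  + (d2 * (s3 ^+ 2 * (x * y) + s1 ^+ 2 * (z * t) + a * (y * t))
  + d3 * (s3 ^+ 2 * (x * z) + s2 ^+ 2 * (y * t) + a * (z * t))
  + c2 * (s2 ^+ 2 * (x * y) + s4 ^+ 2 * (z * t) + a * (x * z))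
  + c3 * (s1 ^+ 2 * (x * z) + s4 ^+ 2 * (y * t) + a * (x * y)))
  + m * (r * u) + a * (p * (r * v) + p * (u * w) + kap * (r * u)).

(** Every product pairs one of [x], [t] with one of [y], [z], so neither [v ^+ 2] nor [w ^+ 2]
    occurs. The surplus in the coefficient of [v * w] carries the factor [s3 * s4 + s1 * s2 = 0]. *)
Lemma quadratic_partE r u v w :
  quadratic_part (s4 * w + f4 * r) (s1 * v + e1 * u) (s2 * v + e2 * u) (s3 * w + f3 * r) r u v w =
  c1 * r ^+ 2 + d1 * u ^+ 2 + ru_coefficient * r * u + vw_coefficient * (v * w)
  + wu_coefficient * (w * u) + vr_coefficient * (v * r).
Proof.
have h0 : s3 * s4 + s1 * s2 = 0 by rewrite hs addr_self.
transitivity (c1 * r ^+ 2 + d1 * u ^+ 2 + ru_coefficient * r * u + vw_coefficient * (v * w)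
  + wu_coefficient * (w * u) + vr_coefficient * (v * r)
  + (s3 * s4 + s1 * s2) * (d2 * s1 * s3 + d3 * s2 * s3 + c2 * s2 * s4 + c3 * s1 * s4) * (v * w)).
  rewrite /quadratic_part /ru_coefficient /vw_coefficient /wu_coefficient /vr_coefficient; ring.
by rewrite h0 !mul0r addr0.
Qed.

(** The four non-square monomials add up to [a^2 (r^2 y z + u^2 x t)]. Expanding
    [y z = p^2 v^2 + u v + e1 e2 u^2] and [x t = p^2 w^2 + w r + f3 f4 r^2] leaves squares and
    [a^2 r u (r v + u w)]. *)
Lemma quarticE r u v w :
  quartic a (c1 ^+ 2) (c2 ^+ 2) (c3 ^+ 2) (d1 ^+ 2) (d2 ^+ 2) (d3 ^+ 2)
    (s1 ^+ 2) (s2 ^+ 2) (s3 ^+ 2) (s4 ^+ 2)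
    (s4 * w + f4 * r) (s1 * v + e1 * u) (s2 * v + e2 * u) (s3 * w + f3 * r) =
  quadratic_part (s4 * w + f4 * r) (s1 * v + e1 * u) (s2 * v + e2 * u) (s3 * w + f3 * r) r u v w ^+ 2
  + a ^+ 2 * (r * u * (r * v + u * w)).
Proof.
have hyz : (s1 * v + e1 * u) * (s2 * v + e2 * u) = p ^+ 2 * v ^+ 2 + u * v + e1 * e2 * u ^+ 2.
  rewrite hp -[u * v]mul1r -he; ring.
have hxt : (s4 * w + f4 * r) * (s3 * w + f3 * r) = p ^+ 2 * w ^+ 2 + w * r + f3 * f4 * r ^+ 2.
  rewrite hp -hs -[w * r]mul1r -hf; ring.
have hr : r ^+ 2 = s3 ^+ 2 * (s4 * w + f4 * r) ^+ 2 + s4 ^+ 2 * (s3 * w + f3 * r) ^+ 2.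
  rewrite -!exprMn -sqrD; congr (_ ^+ 2); rewrite -[LHS]mul1r -hf.
  rewrite -[LHS]addr0 -(addr_self (s3 * s4 * w)); ring.
have hu : u ^+ 2 = s2 ^+ 2 * (s1 * v + e1 * u) ^+ 2 + s1 ^+ 2 * (s2 * v + e2 * u) ^+ 2.
  rewrite -!exprMn -sqrD; congr (_ ^+ 2); rewrite -[LHS]mul1r -he.
  rewrite -[LHS]addr0 -(addr_self (s1 * s2 * v)); ring.
move: (s4 * w + f4 * r) (s1 * v + e1 * u) (s2 * v + e2 * u) (s3 * w + f3 * r) hyz hxt hr hu.
move=> x y z t hyz hxt hr hu; have hr4 : r ^+ 2 ^+ 2 = s3 ^+ 4 * x ^+ 4 + s4 ^+ 4 * t ^+ 4.
  by rewrite hr sqrD; ring.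
have hu4 : u ^+ 2 ^+ 2 = s2 ^+ 4 * y ^+ 4 + s1 ^+ 4 * z ^+ 4.
  by rewrite hu sqrD; ring.
set D := (d2 ^+ 2 * (s3 ^+ 4 * (x ^+ 2 * y ^+ 2) + s1 ^+ 4 * (z ^+ 2 * t ^+ 2) + a ^+ 2 * (y ^+ 2 * t ^+ 2)) +
    d3 ^+ 2 * (s3 ^+ 4 * (x ^+ 2 * z ^+ 2) + s2 ^+ 4 * (y ^+ 2 * t ^+ 2) + a ^+ 2 * (z ^+ 2 * t ^+ 2)) +
    c2 ^+ 2 * (s2 ^+ 4 * (x ^+ 2 * y ^+ 2) + s4 ^+ 4 * (z ^+ 2 * t ^+ 2) + a ^+ 2 * (x ^+ 2 * z ^+ 2)) +
    c3 ^+ 2 * (s1 ^+ 4 * (x ^+ 2 * z ^+ 2) + s4 ^+ 4 * (y ^+ 2 * t ^+ 2) + a ^+ 2 * (x ^+ 2 * y ^+ 2))).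
have -> : quadratic_part x y z t r u v w ^+ 2 = c1 ^+ 2 * r ^+ 2 ^+ 2 + d1 ^+ 2 * u ^+ 2 ^+ 2 + D
    + m ^+ 2 * (r ^+ 2 * u ^+ 2)
    + a ^+ 2 * (p ^+ 2 * (r ^+ 2 * v ^+ 2) + p ^+ 2 * (u ^+ 2 * w ^+ 2) + kap ^+ 2 * (r ^+ 2 * u ^+ 2)).
  rewrite /quadratic_part !mulrDr !sqrD /D; ring.
rewrite hr4 hu4 hkap hm.
transitivity (
 (c1 ^+ 2 * (s3 ^+ 4 * x ^+ 4 + s4 ^+ 4 * t ^+ 4) + d1 ^+ 2 * (s2 ^+ 4 * y ^+ 4 + s1 ^+ 4 * z ^+ 4) +
   D)
  + a * ((s3 ^+ 2 * x ^+ 2 + s4 ^+ 2 * t ^+ 2) * (s2 ^+ 2 * y ^+ 2 + s1 ^+ 2 * z ^+ 2))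
  + a ^+ 2 * ((s3 ^+ 2 * x ^+ 2 + s4 ^+ 2 * t ^+ 2) * (y * z) + (s2 ^+ 2 * y ^+ 2 + s1 ^+ 2 * z ^+ 2) * (x * t))).
  rewrite /quartic /D; ring.
rewrite -hr -hu hyz hxt; ring.
Qed.

Hypotheses (hq : q ^+ 2 = vw_coefficient) (hwu : wu_coefficient = 0) (hvr : vr_coefficient = 0).

(** Once the two mixed coefficients vanish, scaling both [v] and [w] by the square root [q] makes
    the coefficient of [v w] equal to 1; [eta ^+ 2 = a ^+ 2 / q] compensates in the cubic factor. *)
Lemma quartic_normal_form x y z t :
  quartic a (c1 ^+ 2) (c2 ^+ 2) (c3 ^+ 2) (d1 ^+ 2) (d2 ^+ 2) (d3 ^+ 2)
    (s1 ^+ 2) (s2 ^+ 2) (s3 ^+ 2) (s4 ^+ 2) x y z t =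
  normal_form c1 d1 ru_coefficient eta (s3 * x + s4 * t) (s2 * y + s1 * z)
    (q * e2 * y + q * e1 * z) (q * f3 * x + q * f4 * t).
Proof.
set r := s3 * x + s4 * t; set u := s2 * y + s1 * z.
pose v := e2 * y + e1 * z; pose w := f3 * x + f4 * t.
have inv (g g' h h' x' y' : A) : g * h + h' * g' = 1 ->
    h' * (g' * x' + h * y') + h * (g * x' + h' * y') = x'.
  move=> e; transitivity ((g * h + h' * g') * x' + (h' * h * y' + h' * h * y')); first by ring.
  by rewrite e addr_self addr0 mul1r.
have ex : x = s4 * w + f4 * r by rewrite /r /w; symmetry; exact: inv.
have et : t = s3 * w + f3 * r.
  by rewrite /r /w ![_ * x + _]addrC; symmetry; apply: inv; rewrite addrC.
have ey : y = s1 * v + e1 * u by rewrite /u /v; symmetry; apply: inv.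
have ez : z = s2 * v + e2 * u.
  by rewrite /u /v ![_ * y + _]addrC; symmetry; apply: inv; rewrite addrC.
have -> : q * e2 * y + q * e1 * z = q * v by rewrite /v; ring.
have -> : q * f3 * x + q * f4 * t = q * w by rewrite /w; ring.
rewrite {1}ex {1}ey {1}ez {1}et quarticE quadratic_partE hwu hvr !mul0r !addr0 -hq -heta.
rewrite /normal_form opp_self; ring.
Qed.
End QuarticReduction.

Lemma sqrt_exists (k : closedFieldType) (c : k) : exists g, g ^+ 2 = c.
Proof.
have [x hx] := @solve_monicpoly k 2 (fun i => if i == 0%N then c else 0) isT.
by exists x; rewrite hx big_ord_recr big_ord1 /= mul0r expr0 mulr1 addr0.
Qed.

Lemma linear_eval (n : nat) (k : comNzRingType) (p : {mpoly k[n]}) (x y : 'I_n -> k) :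
  p \is 1.-homog -> p.@[fun i => x i + y i] = p.@[x] + p.@[y].
Proof.
move/dhomogP => hp; rewrite /meval /mmap -big_split /= big_seq [RHS]big_seq.
apply: eq_bigr => m /hp /eqP /mdeg1P [i /eqP ->].
by rewrite !mmap1U mulrDr.
Qed.

(* [X + Y] and [X + Z] detect that a factorization of [p] on the plane would force
   both factors to vanish at [Y] and [Z], while [p] does not vanish at [Y + Z]. *)
Lemma plane_conic_irreducible (k : closedFieldType) (l p : {mpoly k[4]}) (X Y Z : 'I_4 -> k) : l \is 1.-homog -> p \is 2.-homog ->
  l != 0 -> l.@[X] = 0 -> l.@[Y] = 0 -> l.@[Z] = 0 ->
  p.@[X] != 0 -> p.@[Y] = 0 -> p.@[Z] = 0 ->
  p.@[fun i => X i + Y i] = p.@[X] -> p.@[fun i => X i + Z i] = p.@[X] ->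
  p.@[fun i => Y i + Z i] != 0 -> irreducible_conic l p.
Proof.
move=> hl hp l0 lX lY lZ pX pY pZ pXY pXZ pYZ; split=> // -[m1 [m2 [h [h1 h2 e]]]].
have ep T : l.@[T] = 0 -> p.@[T] = m1.@[T] * m2.@[T] by rewrite e mevalD !mevalM => ->; rewrite mul0r add0r.
have add0 T T' : l.@[T] = 0 -> l.@[T'] = 0 -> l.@[fun i => T i + T' i] = 0.
  by move=> hT hT'; rewrite linear_eval // hT hT' addr0.
move: pX pY pZ pXY pXZ pYZ; rewrite !ep ?add0 // !(linear_eval _ _ h1) !(linear_eval _ _ h2).
move: (m1.@[X]) (m1.@[Y]) (m1.@[Z]) (m2.@[X]) (m2.@[Y]) (m2.@[Z]) => a1 a2 a3 b1 b2 b3.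
rewrite mulf_eq0 negb_or => /andP [a10 b10] e2 e3 e12 e13.
have cross (x y x' y' : k) : x' * y' = 0 -> (x + x') * (y + y') = x * y -> x != 0 -> y != 0 ->
    x' = 0 /\ y' = 0.
  move=> /eqP; rewrite mulf_eq0 => /orP [] /eqP -> exy x0 y0; split=> //.
    by apply: (mulfI x0); apply: (addrI (x * y)); rewrite mulr0 addr0 -[RHS]exy; ring.
  by apply: (mulIf y0); apply: (addrI (x * y)); rewrite mul0r addr0 -[RHS]exy; ring.
have [-> ->] := cross _ _ _ _ e2 e12 a10 b10; have [-> ->] := cross _ _ _ _ e3 e13 a10 b10.
by rewrite !addr0 mul0r eqxx.
Qed.

Section Combinations.
Variables (k : closedFieldType) (n : nat).
Implicit Types (a b p g : k) (i j : 'I_n).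

Definition combination a b i j : {mpoly k[n]} := a *: 'X_i + b *: 'X_j.

Lemma combination_homog a b i j : combination a b i j \is 1.-homog.
Proof. by rewrite /combination; apply: rpredD; apply: rpredZ; rewrite dhomogX; apply/eqP; exact: mdeg1. Qed.

Lemma mmap_combination (x : 'I_n -> {mpoly k[n]}) a b i j :
  mmap (@mpolyC n k) x (combination a b i j) = a *: x i + b *: x j.
Proof. by rewrite rmorphD /= !mmapZ !mmapX !mmap1U !mul_mpolyC. Qed.

Lemma eval_combination (x : 'I_n -> k) a b i j : (combination a b i j).@[x] = a * x i + b * x j.
Proof. by rewrite mevalD !mevalZ !mevalXU. Qed.

Lemma deriv_combination a b i j l : (combination a b i j)^`M(l) = (a * (i == l)%:R + b * (j == l)%:R)%:MP.
Proof.
have dX h : ('X_h : {mpoly k[n]})^`M(l) = (h == l)%:R%:MP.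
  rewrite mderivX mnm1E; case: eqVneq => [->|_]; last by rewrite scale0r mpolyC0.
  by rewrite scale1r -{1}(add0m U_(l)%MM) addmK mpolyX0 mpolyC1.
by rewrite mderivD !mderivZ !dX -!mul_mpolyC -!mpolyCM -mpolyCD.
Qed.

Lemma scale_combination a b p g p' g' i j :
  a *: combination p g i j + b *: combination p' g' i j =
  combination (a * p + b * p') (a * g + b * g') i j.
Proof. by rewrite !scalerDr !scalerA addrACA -!scalerDl. Qed.

Lemma combination10 a b i j : a = 1 -> b = 0 -> combination a b i j = 'X_i.
Proof. by move=> -> ->; rewrite /combination scale1r scale0r addr0. Qed.

Lemma combination01 a b i j : a = 0 -> b = 1 -> combination a b i j = 'X_j.
Proof. by move=> -> ->; rewrite /combination scale1r scale0r add0r. Qed.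
End Combinations.

(** * Singular points and tropes *)

Section Geometry.
Variables (k : closedFieldType) (two0 : 2 = 0 :> k).
Variables (c d del eta q s1 s2 s3 s4 e1 e2 f3 f4 : k).
Hypotheses (c0 : c != 0) (d0 : d != 0) (eta0 : eta != 0) (q0 : q != 0).
Hypotheses (he : s2 * e1 + s1 * e2 = 1) (hf : s3 * f4 + s4 * f3 = 1).
Local Notation M := {mpoly k[4]}.

Definition form_r : M := combination s3 s4 j0 j3.
Definition form_u : M := combination s2 s1 j1 j2.
Definition form_v : M := combination (q * e2) (q * e1) j1 j2.
Definition form_w : M := combination (q * f3) (q * f4) j0 j3.
Local Notation r := form_r.
Local Notation u := form_u.
Local Notation v := form_v.
Local Notation w := form_w.
Let F : M := normal_form c%:MP d%:MP del%:MP eta%:MP r u v w.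
Let Q : M := c%:MP * r ^+ 2 + d%:MP * u ^+ 2 + del%:MP * r * u + v * w.
Let P1 := point 0 s1 s2 0.
Let P2 := point s4 0 0 s3.

Lemma sum_eq0 (x y : k) : x = y -> x + y = 0.
Proof. by move=> ->; exact: addr_self. Qed.

Local Ltac scalar := first [by rewrite -he; field | by rewrite -hf; field | by apply: sum_eq0; field].

Lemma type_D8_P1 : exists (L : fieldType) (iota : {rmorphism k -> L}) (xi : 'I_4 -> L),
    function_field iota F xi /\
    exists (n : nat) (A : 'I_n -> L -> Prop),
      resolution iota (local_ring iota xi P1) A /\
      exceptional_dual_graph iota (local_ring iota xi P1) A D8_graph.
Proof.
apply: (@normal_form_D8 k c d del eta d0 eta0 (coord4 r u v w)
  (coord4 (combination f4 (s4 / q) j0 j3) (combination e1 (s1 / q) j1 j2)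
    (combination e2 (s2 / q) j1 j2) (combination f3 (s3 / q) j0 j3)) P1 q _ _ _ _ q0).
- by elim/ord4P; rewrite /coord4 /=; exact: combination_homog.
- by elim/ord4P; rewrite /coord4 /=; exact: combination_homog.
- elim/ord4P; rewrite {1}/coord4 /= mmap_combination /coord4 /= scale_combination;
  [apply: combination10|apply: combination10|apply: combination01|apply: combination01]; scalar.
- elim/ord4P; rewrite {1}/coord4 /= mmap_combination /coord4 /= scale_combination;
  [apply: combination10|apply: combination10|apply: combination01|apply: combination01]; scalar.
- elim/ord4P; rewrite /coord4 /= eval_combination !mxE /=.
  + by rewrite !mulr0 addr0.
  + by apply: sum_eq0; rewrite mulrC.
  + by rewrite -[RHS]mulr1 -he; ring.
  + by rewrite !mulr0 addr0.
Qed.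

Lemma type_D8_P2 : exists (L : fieldType) (iota : {rmorphism k -> L}) (xi : 'I_4 -> L),
    function_field iota F xi /\
    exists (n : nat) (A : 'I_n -> L -> Prop),
      resolution iota (local_ring iota xi P2) A /\
      exceptional_dual_graph iota (local_ring iota xi P2) A D8_graph.
Proof.
have -> : F = normal_form d%:MP c%:MP del%:MP eta%:MP u r w v.
  by rewrite /F /normal_form; move: (c%:MP) (d%:MP) (del%:MP) (eta%:MP) r u v w => *; ring.
apply: (@normal_form_D8 k d c del eta c0 eta0 (coord4 u r w v)
  (coord4 (combination f4 (s4 / q) j1 j2) (combination e1 (s1 / q) j0 j3)
    (combination e2 (s2 / q) j0 j3) (combination f3 (s3 / q) j1 j2)) P2 q _ _ _ _ q0).
- by elim/ord4P; rewrite /coord4 /=; exact: combination_homog.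
- by elim/ord4P; rewrite /coord4 /=; exact: combination_homog.
- elim/ord4P; rewrite {1}/coord4 /= mmap_combination /coord4 /= scale_combination;
  [apply: combination10|apply: combination10|apply: combination01|apply: combination01]; scalar.
- elim/ord4P; rewrite {1}/coord4 /= mmap_combination /coord4 /= scale_combination;
  [apply: combination10|apply: combination10|apply: combination01|apply: combination01]; scalar.
- elim/ord4P; rewrite /coord4 /= eval_combination !mxE /=.
  + by rewrite !mulr0 addr0.
  + by apply: sum_eq0; rewrite mulrC.
  + by rewrite -[RHS]mulr1 -hf; ring.
  + by rewrite !mulr0 addr0.
Qed.

Lemma form_values (x y z t R U V W : k) :
  R = s3 * x + s4 * t -> U = s2 * y + s1 * z -> V = q * e2 * y + q * e1 * z ->
  W = q * f3 * x + q * f4 * t ->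
  [/\ x = f4 * R + s4 / q * W, y = e1 * U + s1 / q * V,
      z = e2 * U + s2 / q * V & t = f3 * R + s3 / q * W].
Proof.
have inv (g g' h h' X Y Z T : k) : h * g' + h' * g = 1 -> Z = h * X + h' * Y -> T = q * g * X + q * g' * Y ->
    X = g' * Z + h' / q * T /\ Y = g * Z + h / q * T.
  move=> e -> ->; split.
    rewrite -[LHS]addr0 -(sum_eq0 (erefl (g' * h' * Y))) -[X in X + _]mul1r -e; by field.
  rewrite -[LHS]addr0 -(sum_eq0 (erefl (g * h * X))) -[Y in Y + _]mul1r -e; by field.
move=> hR hU hV hW; have [-> ->] := inv _ _ _ _ _ _ _ _ hf hR hW.
by have [-> ->] := inv _ _ _ _ _ _ _ _ he hU hV.
Qed.

Definition quadric (R U V W : k) : k := c * R ^+ 2 + d * U ^+ 2 + del * R * U + V * W.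

Lemma meval_Q x : Q.@[x] = quadric r.@[x] u.@[x] v.@[x] w.@[x].
Proof.
rewrite /Q /quadric; move: r u v w => R U V W.
by rewrite !(mevalD, mevalM, mevalC, rmorphXn).
Qed.

Lemma eval_Q P : ev Q P = quadric (ev r P) (ev u P) (ev v P) (ev w P).
Proof. exact: meval_Q. Qed.

Lemma eval_F P : ev F P = normal_form c d del eta (ev r P) (ev u P) (ev v P) (ev w P).
Proof. by rewrite /ev /F (rmorph_normal_form (meval (P ord0))) /= !mevalC. Qed.

(** In characteristic 2 the square of the quadric has zero derivative, and so do the factors
    [R ^+ 2] and [U ^+ 2] of the remaining two monomials. *)
Lemma eval_derivative (R U V W : M) P i :
  ev (normal_form c%:MP d%:MP del%:MP eta%:MP R U V W)^`M(i) P =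
  - eta ^+ 2 * (ev R^`M(i) P * ev U P ^+ 2 * ev W P + ev U^`M(i) P * ev R P ^+ 2 * ev V P
     + ev V^`M(i) P * ev R P ^+ 2 * ev U P + ev W^`M(i) P * ev R P * ev U P ^+ 2).
Proof.
rewrite /ev /normal_form !expr2 !(mderivB, mderivD, mderivM, mderivC, mul0r, mulr0, add0r).
rewrite !(mevalB, mevalD, mevalM, mevalC).
set R' := (R^`M(i)).@[_]; set U' := (U^`M(i)).@[_]; set V' := (V^`M(i)).@[_].
set W' := (W^`M(i)).@[_]; set r' := R.@[_]; set u' := U.@[_]; set v' := V.@[_]; set w' := W.@[_].
(* The inserted zero is [two0] times exactly the terms that the product rule produces with a factor
   2. *)
rewrite -[RHS]addr0 -(mul0r ((c * r' ^+ 2 + d * u' ^+ 2 + del * r' * u' + v' * w') *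
  (2 * c * r' * R' + 2 * d * u' * U' + del * (R' * u' + r' * U') + V' * w' + v' * W')
   - eta ^+ 2 * (r' * R' * u' * v' + u' * U' * r' * w'))) -two0; ring.
Qed.

(** [r] and [w] involve only [x], [t], while [u] and [v] involve only [y], [z]. The gradient
    therefore splits into two linear systems of determinant [q], and the four coefficients vanish
    separately. *)
Lemma singular_equations P : singular_point F P <->
  [/\ P != 0, ev r P = 0, ev u P = 0 & ev v P * ev w P = 0].
Proof.
have form0 (g g' h h' X Y : k) : h * g' + h' * g = 1 -> X * h + Y * (q * g) = 0 ->
    X * h' + Y * (q * g') = 0 -> X = 0 /\ Y = 0.
  move=> e e1' e2'; split.
    transitivity (X * (h * g' + h' * g) + (Y * q * g * g' + Y * q * g * g')).
      by rewrite e (addr_self two0) mulr1 addr0.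
    transitivity (g' * (X * h + Y * (q * g)) + g * (X * h' + Y * (q * g'))); first by ring.
    by rewrite e1' e2' !mulr0 addr0.
  apply: (mulfI q0); rewrite mulr0.
  transitivity (q * Y * (h * g' + h' * g) + (X * h * h' + X * h * h')).
    by rewrite e (addr_self two0) mulr1 addr0.
  transitivity (h' * (X * h + Y * (q * g)) + h * (X * h' + Y * (q * g'))); first by ring.
  by rewrite e1' e2' !mulr0 addr0.
split=> [[P0 hF hD]|[P0 hr hu hvw]]; last first.
  split=> // [|i]; first by rewrite eval_F hr hu /normal_form hvw; ring.
  by rewrite eval_derivative hr hu; ring.
move: hF hD; rewrite eval_F.
set R := ev r P; set U := ev u P; set V := ev v P; set W := ev w P => hF hD.
have hD' i : ev r^`M(i) P * (U ^+ 2 * W) + ev u^`M(i) P * (R ^+ 2 * V)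
     + ev v^`M(i) P * (R ^+ 2 * U) + ev w^`M(i) P * (R * U ^+ 2) = 0.
  apply: (mulfI (_ : - eta ^+ 2 != 0)); first by rewrite oppr_eq0 expf_neq0.
  by rewrite mulr0 -(hD i) eval_derivative -/R -/U -/V -/W; ring.
have := (hD' j0, hD' j1, hD' j2, hD' j3).
rewrite /ev !deriv_combination !mevalC /= !(mulr0, mulr1, mul0r, addr0, add0r) => -[[[E0 E1] E2] E3].
have [A1 A2] : U ^+ 2 * W = 0 /\ R * U ^+ 2 = 0.
  by apply: (form0 f3 f4 s3 s4 _ _ hf); rewrite mulrC [X in _ + X]mulrC.
have [A3 A4] : R ^+ 2 * V = 0 /\ R ^+ 2 * U = 0.
  by apply: (form0 e2 e1 s2 s1 _ _ he); rewrite mulrC [X in _ + X]mulrC.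
move: hF; rewrite /normal_form.
case: (eqVneq R 0) => [R0|R0].
  case: (eqVneq U 0) => [U0|U0].
    rewrite R0 U0 => hF; split=> //; move: hF.
    rewrite !(expr0n, mulr0, mul0r, add0r, subr0) /= => /eqP; rewrite expf_eq0 /= => /eqP.
    by [].
  (* With [R = W = 0] the quartic reduces to [(d U^2)^2], which excludes [U != 0]; the case [R != 0]
     is excluded by [c] in the same way. *)
  have W0 : W = 0 by apply: (mulfI (expf_neq0 2 U0)); rewrite mulr0.
  rewrite R0 W0 !(expr0n, mulr0, mul0r, add0r, addr0, subr0) /= => /eqP.
  by rewrite expf_eq0 /= mulf_eq0 (negbTE d0) expf_eq0 /= (negbTE U0).
have U0 : U = 0 by apply: (mulfI (expf_neq0 2 R0)); rewrite mulr0.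
have V0 : V = 0 by apply: (mulfI (expf_neq0 2 R0)); rewrite mulr0.
rewrite U0 V0 !(expr0n, mulr0, mul0r, add0r, addr0, subr0) /= => /eqP.
by rewrite expf_eq0 /= mulf_eq0 (negbTE c0) expf_eq0 /= (negbTE R0).
Qed.

Lemma lines_meet P : [/\ P != 0, ev r P = 0, ev u P = 0 & ev v P * ev w P = 0] <->
  same_point P1 P \/ same_point P2 P.
Proof.
have ev_comb a b i j : ev (combination a b i j) P = a * P ord0 i + b * P ord0 j.
  exact: eval_combination.
split=> [[P0 hr hu /eqP]|].
  have [h0 h1 h2 h3] := @form_values (P ord0 j0) (P ord0 j1) (P ord0 j2) (P ord0 j3)
    (ev r P) (ev u P) (ev v P) (ev w P)
    (ev_comb _ _ _ _) (ev_comb _ _ _ _) (ev_comb _ _ _ _) (ev_comb _ _ _ _).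
  move: h0 h1 h2 h3; rewrite hr hu !mulr0 !add0r => h0 h1 h2 h3.
  rewrite mulf_eq0 => /orP [/eqP hv|/eqP hw]; [right|left].
    have eP : P = (ev w P / q) *: P2.
      apply/rowP; elim/ord4P; rewrite !mxE /= ?h0 ?h1 ?h2 ?h3 ?hv ?mulr0 //; by field.
    exists (ev w P / q) => //; apply: contraNneq P0 => e; rewrite eP e scale0r //.
  have eP : P = (ev v P / q) *: P1.
    apply/rowP; elim/ord4P; rewrite !mxE /= ?h0 ?h1 ?h2 ?h3 ?hw ?mulr0 //; by field.
  exists (ev v P / q) => //; apply: contraNneq P0 => e; rewrite eP e scale0r //.
have scale0 g (X : 'rV[k]_4) : g != 0 -> X != 0 -> g *: X != 0.
  by move=> g0 X0; rewrite scaler_eq0 negb_or g0.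
have P1n : P1 != 0.
  apply/eqP => /rowP h; have := h j1; have := h j2; rewrite !mxE /= => e e'.
  by move: he; rewrite e e' !mul0r addr0 => /esym /eqP; rewrite oner_eq0.
have P2n : P2 != 0.
  apply/eqP => /rowP h; have := h j0; have := h j3; rewrite !mxE /= => e e'.
  by move: hf; rewrite e e' !mul0r addr0 => /esym /eqP; rewrite oner_eq0.
by case=> -[g g0 eP]; rewrite !ev_comb eP !mxE /=; split; rewrite ?scale0 ?mulr0 ?addr0 //;
  rewrite ?mul0r ?mulr0 //; apply: sum_eq0; ring.
Qed.

Lemma singular_points P : singular_point F P <-> same_point P1 P \/ same_point P2 P.
Proof. by rewrite singular_equations lines_meet. Qed.

Lemma distinct_points : ~ same_point P1 P2.
Proof.
move=> [g _ /rowP h]; have := h j0; have := h j3; rewrite !mxE /= !mulr0 => e e'.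
by move: hf; rewrite e e' !mul0r addr0 => /esym /eqP; rewrite oner_eq0.
Qed.

Lemma conics_meet P : on_conic u Q P /\ on_conic r Q P <-> same_point P1 P \/ same_point P2 P.
Proof.
have quadric0 V W : quadric 0 0 V W = V * W by rewrite /quadric; ring.
rewrite -lines_meet /on_conic eval_Q; split=> [[[P0 -> h] [_ hr _]]|[P0 -> -> h]].
  by move: h; rewrite hr quadric0.
by rewrite quadric0 h.
Qed.

(** The point where [r], [u], [v / q], [w / q] take the prescribed values, by inverting the change
    of coordinates. *)
Definition plane_point (R U V W : k) : 'I_4 -> k :=
  coord4 (f4 * R + s4 * W) (e1 * U + s1 * V) (e2 * U + s2 * V) (f3 * R + s3 * W).

Lemma eval_plane_point R U V W : [/\ r.@[plane_point R U V W] = R, u.@[plane_point R U V W] = U,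
  v.@[plane_point R U V W] = q * V & w.@[plane_point R U V W] = q * W].
Proof.
rewrite !eval_combination /plane_point /coord4 /=; split.
- by rewrite -[RHS]mul1r -hf -[RHS]addr0 -(sum_eq0 (erefl (s3 * s4 * W))); ring.
- by rewrite -[RHS]mul1r -he -[RHS]addr0 -(sum_eq0 (erefl (s1 * s2 * V))); ring.
- by rewrite -[q * V]mul1r -he -[RHS]addr0 -(sum_eq0 (erefl (q * e1 * e2 * U))); ring.
- by rewrite -[q * W]mul1r -hf -[RHS]addr0 -(sum_eq0 (erefl (q * f3 * f4 * R))); ring.
Qed.

Lemma plane_pointD R U V W R' U' V' W' :
  (fun i => plane_point R U V W i + plane_point R' U' V' W' i) =
  plane_point (R + R') (U + U') (V + V') (W + W').
Proof.
by apply: functional_extensionality; elim/ord4P; rewrite /plane_point /coord4 /=; ring.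
Qed.

Lemma eval_Q_plane R U V W : Q.@[plane_point R U V W] = quadric R U (q * V) (q * W).
Proof.
have [hr hu hv hw] := eval_plane_point R U V W.
by rewrite meval_Q hr hu hv hw.
Qed.

Lemma Q_homog : Q \is 2.-homog.
Proof.
have [hr hu hv hw] : [/\ r \is 1.-homog, u \is 1.-homog, v \is 1.-homog & w \is 1.-homog].
  by split; exact: combination_homog.
have hM (f g : M) : f \is 1.-homog -> g \is 1.-homog -> f * g \is 2.-homog.
  exact: (dhomogM (d := 1) (e := 1)).
rewrite /Q !expr2 -!mulrA !mul_mpolyC.
by do !apply: rpredD; do ?apply: rpredZ; apply: hM.
Qed.

Local Ltac quadric_values := rewrite ?plane_pointD ?eval_Q_plane /quadric;
  rewrite !(expr0n, expr1n, mulr0, mul0r, mulr1, addr0, add0r) /= ?mulf_neq0.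

(** On the plane [u = 0] the quadric is [c r^2 + v w]. At the three coordinate points it takes the
    values [c], 0, 0, and at the sum of the last two the value [q^2]. *)
Lemma irreducible_u : irreducible_conic u Q.
Proof.
have ev_u R U V W : u.@[plane_point R U V W] = U by case: (eval_plane_point R U V W).
apply: (plane_conic_irreducible (X := plane_point 1 0 0 0) (Y := plane_point 0 0 1 0)
  (Z := plane_point 0 0 0 1)); rewrite ?ev_u //; try by quadric_values.
- exact: combination_homog.
- exact: Q_homog.
- by apply/eqP => /(congr1 (meval (plane_point 0 1 0 0))); rewrite ev_u meval0 => /eqP; rewrite oner_eq0.
Qed.

Lemma irreducible_r : irreducible_conic r Q.
Proof.
have ev_r R U V W : r.@[plane_point R U V W] = R by case: (eval_plane_point R U V W).
apply: (plane_conic_irreducible (X := plane_point 0 1 0 0) (Y := plane_point 0 0 1 0)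
  (Z := plane_point 0 0 0 1)); rewrite ?ev_r //; try by quadric_values.
- exact: combination_homog.
- exact: Q_homog.
- by apply/eqP => /(congr1 (meval (plane_point 1 0 0 0))); rewrite ev_r meval0 => /eqP; rewrite oner_eq0.
Qed.

Lemma tropes : trope F u Q /\ trope F r Q.
Proof.
split; split; [exact: irreducible_u| |exact: irreducible_r|].
  exists (- eta%:MP ^+ 2 * (r * (r * v + u * w))); rewrite /F /Q /normal_form.
  by move: (c%:MP) (d%:MP) (del%:MP) (eta%:MP) r u v w => *; ring.
exists (- eta%:MP ^+ 2 * (u * (r * v + u * w))); rewrite /F /Q /normal_form.
by move: (c%:MP) (d%:MP) (del%:MP) (eta%:MP) r u v w => *; ring.
Qed.
End Geometry.

(* Adding multiples of [(y, x)] to [(e, e')] keeps [x * e + y * e'] in characteristic 2. *)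
Lemma complete_basis (k : fieldType) (x y al : k) (phi : k -> k -> k) : 2 = 0 :> k ->
  (x != 0) || (y != 0) -> al != 0 ->
  (forall e e' t, phi (e + t * y) (e' + t * x) = phi e e' + t * al) ->
  exists e e', x * e + y * e' = 1 /\ phi e e' = 0.
Proof.
move=> two0 xy al0 hphi.
have [e [e' h]] : exists e e', x * e + y * e' = 1.
  case/orP: xy => h; first by exists x^-1, 0; rewrite mulfV // mulr0 addr0.
  by exists 0, y^-1; rewrite mulfV // mulr0 add0r.
pose t := - phi e e' / al.
exists (e + t * y), (e' + t * x); split; last by rewrite hphi /t mulfVK // subrr.
by rewrite -[RHS]h -[RHS]addr0 -(addr_self two0 (t * x * y)); ring.
Qed.

Section Morphisms.
Variables (A B : comNzRingType) (f : {rmorphism A -> B}).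

Lemma rmorph_vw a c2 c3 d2 d3 s1 s2 s3 s4 : f (vw_coefficient a c2 c3 d2 d3 s1 s2 s3 s4) =
  vw_coefficient (f a) (f c2) (f c3) (f d2) (f d3) (f s1) (f s2) (f s3) (f s4).
Proof. by rewrite /vw_coefficient !(rmorphM, rmorphD). Qed.

Lemma rmorph_wu a c2 c3 d2 d3 s1 s2 s3 s4 e1 e2 p :
  f (wu_coefficient a c2 c3 d2 d3 s1 s2 s3 s4 e1 e2 p) =
  wu_coefficient (f a) (f c2) (f c3) (f d2) (f d3) (f s1) (f s2) (f s3) (f s4) (f e1) (f e2) (f p).
Proof. by rewrite /wu_coefficient !expr2 !(rmorphM, rmorphD). Qed.

Lemma rmorph_vr a c2 c3 d2 d3 s1 s2 s3 s4 f3 f4 p :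
  f (vr_coefficient a c2 c3 d2 d3 s1 s2 s3 s4 f3 f4 p) =
  vr_coefficient (f a) (f c2) (f c3) (f d2) (f d3) (f s1) (f s2) (f s3) (f s4) (f f3) (f f4) (f p).
Proof. by rewrite /vr_coefficient !expr2 !(rmorphM, rmorphD). Qed.

Lemma rmorph_ru a m c2 c3 d2 d3 s1 s2 s3 s4 e1 e2 f3 f4 kap :
  f (ru_coefficient a m c2 c3 d2 d3 s1 s2 s3 s4 e1 e2 f3 f4 kap) =
  ru_coefficient (f a) (f m) (f c2) (f c3) (f d2) (f d3) (f s1) (f s2) (f s3) (f s4)
    (f e1) (f e2) (f f3) (f f4) (f kap).
Proof. by rewrite /ru_coefficient !expr2 !(rmorphM, rmorphD). Qed.
End Morphisms.

Lemma S1_quartic (k : closedFieldType) (a1 a2 c1 c2 c3 d1 d2 d3 b1 b2 b3 b4 : k) :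
  S1 a1 a2 c1 c2 c3 d1 d2 d3 b1 b2 b3 b4 =
  quartic (a1 + a2)%:MP c1%:MP c2%:MP c3%:MP d1%:MP d2%:MP d3%:MP b1%:MP b2%:MP b3%:MP b4%:MP
    (Xx k) (Xy k) (Xz k) (Xt k).
Proof.
rewrite /S1 /quartic -!mul_mpolyC; move: (Xx k) (Xy k) (Xz k) (Xt k) => x y z t.
by rewrite !expr2 !(rmorphM, rmorphD).
Qed.

(* s1, s2, s3, s4 are the square roots of b1, b2, b3, b4, which are unique in
   characteristic 2. *)
Theorem theorem4p3 (k : closedFieldType) (char2 : 2%N \in [pchar k])
  (a1 a2 a3 c1 c2 c3 d1 d2 d3 b1 b2 b3 b4 : k)
  (al2 be2 ga2 de2 al3 be3 ga3 de3 : k)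
  (ha12 : a1 != a2) (ha23 : a2 = a3)
  (hdet2 : al2 * de2 + be2 * ga2 = 1) (hdet3 : al3 * de3 + be3 * ga3 = 1)
  (hb1 : b1 = be3 * ga2) (hb2 : b2 = al2 * de3)
  (hb3 : b3 = ga2 * de3) (hb4 : b4 = al2 * be3)
  (hcd : c1 * d1 != 0)
  (hns : b2 * b4 * c2 + b1 * b4 * c3 + b1 * b3 * d2 + b2 * b3 * d3 != 0)
  (s1 s2 s3 s4 : k)
  (hs1 : s1 ^+ 2 = b1) (hs2 : s2 ^+ 2 = b2)
  (hs3 : s3 ^+ 2 = b3) (hs4 : s4 ^+ 2 = b4) :
  let S := S1 a1 a2 c1 c2 c3 d1 d2 d3 b1 b2 b3 b4 in
  let P1 := point 0 s1 s2 0 in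
  let P2 := point s4 0 0 s3 in
  let l1 := s2 *: Xy k + s1 *: Xz k in
  let l2 := s3 *: Xx k + s4 *: Xt k in
  [/\ ~ same_point P1 P2 /\
      (forall P, singular_point S P <-> same_point P1 P \/ same_point P2 P),
      type_D8 S P1,
      type_D8 S P2 &
      exists q1 q2 : {mpoly k[4]},
        [/\ trope S l1 q1, trope S l2 q2 &
            forall P, on_conic l1 q1 P /\ on_conic l2 q2 P <->
                      same_point P1 P \/ same_point P2 P]].
Proof.
have two0 : 2 = 0 :> k by move: char2; rewrite inE => /andP [_ /eqP].
have a0 : a1 + a2 != 0.
  by apply: contra_neq ha12 => /eqP; rewrite addr_eq0 opp_self // => /eqP.
move=> S P1 P2 l1 l2; set a := a1 + a2 in a0.
(* Injectivity of Frobenius turns [b1 * b2 = b3 * b4] into [s1 * s2 = s3 * s4]. *)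
have sqr_inj (x y : k) : x ^+ 2 = y ^+ 2 -> x = y.
  move=> h; apply/eqP; rewrite -subr_eq0 -sqrf_eq0 opp_self // sqrD // h addr_self //.
have hs : s3 * s4 = s1 * s2.
  by apply: sqr_inj; rewrite !exprMn hs1 hs2 hs3 hs4 hb1 hb2 hb3 hb4; ring.
have [g1 hg1] := sqrt_exists c1; have [g2 hg2] := sqrt_exists c2; have [g3 hg3] := sqrt_exists c3.
have [h1 hh1] := sqrt_exists d1; have [h2 hh2] := sqrt_exists d2; have [h3 hh3] := sqrt_exists d3.
have [m hm] := sqrt_exists a; have [p hp] := sqrt_exists (s1 * s2).
(* The non-singularity condition enters here, together with [a != 0]; it also excludes [s1 = s2 = 0]
   and [s3 = s4 = 0]. *)
have vw0 : vw_coefficient a g2 g3 h2 h3 s1 s2 s3 s4 != 0.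
  rewrite -sqrf_eq0 /vw_coefficient exprMn; apply: mulf_neq0; first exact: expf_neq0.
  rewrite !sqrD // !exprMn.
  rewrite hs1 hs2 hs3 hs4 hg2 hg3 hh2 hh3; apply: contraNneq hns => e.
  by rewrite -e; apply/eqP; ring.
have s12 : (s2 != 0) || (s1 != 0).
  rewrite -negb_and; apply: contra vw0 => /andP [/eqP -> /eqP ->].
  by rewrite /vw_coefficient !(mul0r, mulr0, addr0).
have s34 : (s3 != 0) || (s4 != 0).
  rewrite -negb_and; apply: contra vw0 => /andP [/eqP -> /eqP ->].
  by rewrite /vw_coefficient !(mul0r, mulr0, addr0).
(* Replacing [(e1, e2)] by [(e1 + t s1, e2 + t s2)] adds [t] times the [v w] coefficient to the
   [w u] coefficient, so a suitable [t] removes the latter. The pair [(f4, f3)] removes the [v r]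
   coefficient likewise. *)
have [e1 [e2 [he hwu]]] : exists e1 e2, s2 * e1 + s1 * e2 = 1 /\
    wu_coefficient a g2 g3 h2 h3 s1 s2 s3 s4 e1 e2 p = 0.
  apply: (complete_basis (phi := fun x y => wu_coefficient a g2 g3 h2 h3 s1 s2 s3 s4 x y p) two0 s12 vw0) => e e' t.
  transitivity (wu_coefficient a g2 g3 h2 h3 s1 s2 s3 s4 e e' p
      + t * vw_coefficient a g2 g3 h2 h3 s1 s2 s3 s4
      + (s3 * s4 + s1 * s2) * (t * (h2 * s1 * s3 + h3 * s2 * s3 + g2 * s2 * s4 + g3 * s1 * s4))).
    by rewrite /wu_coefficient /vw_coefficient; ring.
  by rewrite hs addr_self // mul0r addr0.
have [f4 [f3 [hf hvr]]] : exists f4 f3, s3 * f4 + s4 * f3 = 1 /\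
    vr_coefficient a g2 g3 h2 h3 s1 s2 s3 s4 f3 f4 p = 0.
  apply: (complete_basis (phi := fun x y => vr_coefficient a g2 g3 h2 h3 s1 s2 s3 s4 y x p) two0 s34 vw0) => e e' t.
  transitivity (vr_coefficient a g2 g3 h2 h3 s1 s2 s3 s4 e' e p
      + t * vw_coefficient a g2 g3 h2 h3 s1 s2 s3 s4
      + (s3 * s4 + s1 * s2) * (t * (h2 * s1 * s3 + h3 * s2 * s3 + g2 * s2 * s4 + g3 * s1 * s4))).
    by rewrite /vr_coefficient /vw_coefficient; ring.
  by rewrite hs addr_self // mul0r addr0.
have [kap hkap] := sqrt_exists (e1 * e2 + f3 * f4).
have [q hq] := sqrt_exists (vw_coefficient a g2 g3 h2 h3 s1 s2 s3 s4).
have q0 : q != 0 by apply: contraNneq vw0 => e; rewrite -hq e expr0n.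
have [eta heta] := sqrt_exists (a ^+ 2 / q).
have eta0 : eta != 0 by rewrite -sqrf_eq0 heta mulf_neq0 ?expf_neq0 ?invr_eq0.
have g10 : g1 != 0 by apply: contraNneq hcd => e; rewrite -hg1 e expr0n mul0r.
have h10 : h1 != 0 by apply: contraNneq hcd => e; rewrite -hh1 e expr0n mulr0.
pose del := ru_coefficient a m g2 g3 h2 h3 s1 s2 s3 s4 e1 e2 f3 f4 kap.
have eS : S = normal_form g1%:MP h1%:MP del%:MP eta%:MP (form_r s3 s4) (form_u s1 s2)
    (form_v q e1 e2) (form_w q f3 f4).
  have two0M : 2 = 0 :> {mpoly k[4]} by rewrite -(rmorph_nat (@mpolyC 4 k)) two0 rmorph0.
  have hX (x : k) : (x ^+ 2)%:MP = x%:MP ^+ 2 :> {mpoly k[4]} by rewrite rmorphXn.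
  rewrite /S S1_quartic -hs1 -hs2 -hs3 -hs4 -hg1 -hg2 -hg3 -hh1 -hh2 -hh3 !hX.
  rewrite (@quartic_normal_form _ two0M _ m%:MP _ _ _ _ _ _ _ _ _ _ e1%:MP e2%:MP f3%:MP f4%:MP
    p%:MP kap%:MP q%:MP eta%:MP).
  + rewrite /del rmorph_ru /form_r /form_u /form_v /form_w /combination.
    by rewrite -!mpolyCM !mul_mpolyC.
  + by rewrite -!mpolyCM -mpolyCD he.
  + by rewrite -!mpolyCM -mpolyCD hf.
  + by rewrite -!mpolyCM hs.
  + by rewrite -hX hm.
  + by rewrite -hX hp mpolyCM.
  + by rewrite -hX hkap mpolyCD !mpolyCM.
  + by rewrite -!hX heta -mpolyCM mulfVK.
  + by rewrite -hX hq rmorph_vw.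
  + by rewrite -(rmorph_wu (@mpolyC 4 k)) hwu rmorph0.
  + by rewrite -(rmorph_vr (@mpolyC 4 k)) hvr rmorph0.
have hsing P : singular_point S P <-> same_point P1 P \/ same_point P2 P.
  by rewrite eS; exact: singular_points.
have refl P : same_point P P by exists 1; rewrite ?oner_neq0 ?scale1r.
split.
- by split; first exact: (distinct_points hf).
- by split; [apply/hsing; left | rewrite eS; exact: type_D8_P1].
- by split; [apply/hsing; right | rewrite eS; exact: type_D8_P2].
eexists _, _; have [t1 t2] := tropes two0 del eta g10 h10 q0 he hf.
split; [rewrite eS; exact: t1|rewrite eS; exact: t2|].
move=> P; exact: conics_meet.
Qed.
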